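(* (Convergence) Consider the constrained optimal control Problem B and its discretization Problem $B^N$ (both defined in the context). Suppose Problem B has an optimal solution $(x^\ast(t),u^\ast(t))$ in which $(x_r^\ast(t))^{(m)}$ has bounded variation for some integer $m\ge3$. In Problem $B^N$, let $m_1$ be any integer and $\beta$ any real number satisfying $2\le m_1\le m-1$ and $0<\beta<(m-m_1)-\frac34$, and let the bounds $\underline b,\bar b,\underline b_j,\bar b_j,d$ be large enough in the sense of the context. Then for any sequence $\{(\bar x^{\ast N},\bar u^{\ast N})\}_{N=N_1}^\infty$ of optimal solutions of Problem $B^N$, there exist a subsequence $\{(\bar x^{\ast N_j},\bar u^{\ast N_j})\}_{j\ge1}$ and an optimal solution of Problem B, again denoted $(x^\ast(t),u^\ast(t))$ (not necessarily the one given above), so that $$\lim_{N_j\to\infty}\left(x^{\ast N_j}(t)-x^\ast(t)\right)=0,\qquad \lim_{N_j\to\infty}\left(u^{\ast N_j}(t)-u^\ast(t)\right)=0$$ uniformly in $[-1,1]$, and $$\lim_{N_j\to\infty}\bar J^{N_j}(\bar x^{\ast N_j},\bar u^{\ast N_j})=J(x^\ast(\cdot),u^\ast(\cdot)),\qquad \lim_{N_j\to\infty}J(x^{\ast N_j}(\cdot),u^{\ast N_j}(\cdot))=J(x^\ast(\cdot),u^\ast(\cdot)),$$ where $(x^{\ast N_j}(t),u^{\ast N_j}(t))$ is the interpolation of $(\bar x^{\ast N_j},\bar u^{\ast N_j})$.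
   Context: Derivatives are weak derivatives unless ''strong'' is specified. **Problem B.** Determine the state-control function pair $(x(t),u(t))$, $x\in\mathbb{R}^r$, $u\in\mathbb{R}$, $t\in[-1,1]$, minimizing $$J(x(\cdot),u(\cdot))=\int_{-1}^1F(x(t),u(t))\,dt+E(x(-1),x(1))$$ subject to the state equation $\dot x_1=x_2,\ \dots,\ \dot x_{r-1}=x_r,\ \dot x_r=f(x)+g(x)u$, the endpoint condition $e(x(-1),x(1))=0$, and the state-control constraint $h(x(t),u(t))\le0$. Here $F:\mathbb{R}^r\times\mathbb{R}\to\mathbb{R}$, $E:\mathbb{R}^r\times\mathbb{R}^r\to\mathbb{R}$, $f,g:\mathbb{R}^r\to\mathbb{R}$, $e:\mathbb{R}^r\times\mathbb{R}^r\to\mathbb{R}^{N_e}$, $h:\mathbb{R}^r\times\mathbb{R}\to\mathbb{R}^{N_h}$ are Lipschitz continuous in their arguments and $g(x)\ne0$ for all $x$. **LGL nodes, weights, differentiation matrix.** $L_N$ is the Legendre polynomial of degree $N$. The nodes are $t_0=-1$, $t_N=1$, and $t_1<\dots<t_{N-1}$ the roots of $\dot L_N$. The weights are $w_k=\frac{2}{N(N+1)}\frac{1}{L_N(t_k)^2}$. $D$ is the $(N+1)\times(N+1)$ matrix with entries $D_{ik}=\frac{L_N(t_i)}{L_N(t_k)}\frac{1}{t_i-t_k}$ for $i\neq k$, $D_{00}=-\frac{N(N+1)}4$, $D_{NN}=\frac{N(N+1)}4$, and $0$ otherwise; it maps the nodal values of a polynomial of degree $\le N$ to the nodal values of its derivative.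 **Discrete variables and interpolation.** $\bar x^{Nk}=(\bar x_1^{Nk},\dots,\bar x_r^{Nk})^T\in\mathbb{R}^r$, $\bar u^{Nk}\in\mathbb{R}$, $k=0,\dots,N$; $\bar x_i^N=[\bar x_i^{N0}\ \cdots\ \bar x_i^{NN}]$ (row vector). The interpolation of $(\bar x^N,\bar u^N)$ is the pair $(x^N(t),u^N(t))$ where $x_i^N(t)$ is the polynomial of degree $\le N$ with $x_i^N(t_k)=\bar x_i^{Nk}$ for all $k$, and $u^N(t)=\frac{\dot x_r^N(t)-f(x^N(t))}{g(x^N(t))}$. **Spectral coefficients.** For an integer $m_1\ge1$ and $0\le n\le N-r-m_1+1$, $$a_n^N(m_1)=\left(n+\tfrac12\right)\sum_{k=0}^N L_n(t_k)\,w_k\,\left(D^{m_1}(\bar x_r^N)^T\right)_k ,$$ the Legendre coefficients of the polynomial interpolating $\bar x_r^N(D^T)^{m_1}$ (entries of vectors indexed $0,\dots,N$). **Problem $B^N$.** Find $\bar x^{Nk}\in\mathbb{R}^r$, $\bar u^{Nk}\in\mathbb{R}$, $k=0,\dots,N$, minimizing $$\bar J^N(\bar x^N,\bar u^N)=\sum_{k=0}^NF(\bar x^{Nk},\bar u^{Nk})w_k+E(\bar x^{N0},\bar x^{NN})$$ subject to: (1) $D(\bar x_i^N)^T=(\bar x_{i+1}^N)^T$ for $1\le i\le r-1$, and $(D(\bar x_r^N)^T)_k=f(\bar x^{Nk})+g(\bar x^{Nk})\bar u^{Nk}$ for $0\le k\le N$; (2) $\|e(\bar x^{N0},\bar x^{NN})\|_\infty\le(N-r-1)^{-\beta}$;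 (3) $h(\bar x^{Nk},\bar u^{Nk})\le(N-r-1)^{-\beta}\cdot\mathbf 1$ componentwise for $0\le k\le N$, with $\mathbf 1$ the all-ones vector; (4) $\underline b\le(\bar x^{Nk},\bar u^{Nk})\le\bar b$ componentwise for $0\le k\le N$; (5) if $m_1\ge2$: $\underline b_j\le[1\ 0\ \cdots\ 0]D^j(\bar x_r^N)^T\le\bar b_j$ for $1\le j\le m_1-1$; (6) $\sum_{n=0}^{N-r-m_1+1}|a_n^N(m_1)|\le d$. Here $\underline b,\bar b\in\mathbb{R}^{r+1}$ and $\underline b_j,\bar b_j,d\in\mathbb{R}$ are fixed, independent of $N$. **''Bounds large enough''.** There are thresholds, depending on Problem B, the given optimal solution $(x^\ast,u^\ast)$, $m$ and $m_1$ but not on $N$, such that the assertion holds whenever $\bar b,\bar b_j,d$ lie (componentwise) above and $\underline b,\underline b_j$ below the corresponding thresholds. In particular, $(x^\ast(t),u^\ast(t))$ lies in the interior of the box $[\underline b,\bar b]$, $(x_r^\ast(t))^{(j)}$ lies in the interior of $[\underline b_j,\bar b_j]$, and $d>\frac6{\sqrt\pi}\left(U((x_r^\ast)^{(m_1+1)})+V((x_r^\ast)^{(m_1+1)})\right)\zeta(3/2)$, where $U(h)$ is an upper bound of $|h|$, $V(h)$ the total variation of $h$ on $[-1,1]$, and $\zeta(s)=\sum_{k\ge1}k^{-s}$. *)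

(* Defs.v *)
From HB Require Import structures.
From mathcomp Require Import all_boot all_order all_algebra.
From mathcomp Require Import all_classical all_reals all_analysis.
From mathcomp Require Import polyrcf.

Set Implicit Arguments.
Unset Strict Implicit.
Unset Printing Implicit Defensive.

Import Order.TTheory GRing.Theory Num.Theory.
Import numFieldNormedType.Exports.

Local Open Scope classical_set_scope.
Local Open Scope ring_scope.

(* Throughout, the state dimension is r = q.+1, so that r >= 1 is built in and
   the last state component x_r has index [ord_max].  The norm on column
   vectors is MathComp-Analysis' sup norm. *)

Section WeakDerivative.
Variable R : realType.
Local Notation mu := (@lebesgue_measure R).

Definition test_function (phi : R -> R) : Prop :=
  (forall n t, derivable (derive1n n phi) t 1) /\
  exists2 c : R, c < 1 & forall t, c < `|t| -> phi t = 0.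

(* [y] is the [n]-th weak derivative of [x] on the open interval (-1, 1); it is
   determined only up to a null set. *)
Definition weak_derivn (n : nat) (x y : R -> R) : Prop :=
  [/\ locally_integrable `]-1, 1[ x,
      locally_integrable `]-1, 1[ y &
      forall phi, test_function phi ->
        \int[mu]_(t in `]-1, 1[) (x t * derive1n n phi t) =
        (-1) ^+ n * \int[mu]_(t in `]-1, 1[) (y t * phi t)].

Definition zeta (s : R) : R := limn (series (fun k => (k.+1%:R `^ s)^-1)).

End WeakDerivative.

Section ProblemB.
Variables (R : realType) (q Ne Nh : nat).
Local Notation mu := (@lebesgue_measure R).

Record problemB := ProblemB {
  costF : 'cV[R]_q.+1 * R -> R ;
  costE : 'cV[R]_q.+1 * 'cV[R]_q.+1 -> R ;
  dynf : 'cV[R]_q.+1 -> R ;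
  dyng : 'cV[R]_q.+1 -> R ;
  cone : 'cV[R]_q.+1 * 'cV[R]_q.+1 -> 'cV[R]_Ne ;
  conh : 'cV[R]_q.+1 * R -> 'cV[R]_Nh ;
  costF_lip : lipschitz costF ;
  costE_lip : lipschitz costE ;
  dynf_lip : lipschitz dynf ;
  dyng_lip : lipschitz dyng ;
  cone_lip : lipschitz cone ;
  conh_lip : lipschitz conh ;
  dyng_neq0 : forall x, dyng x != 0
}.

Variable P : problemB.

Definition costJ (x : R -> 'cV[R]_q.+1) (u : R -> R) : R :=
  (\int[mu]_(t in `[-1, 1]) costF P (x t, u t)) + costE P (x (-1), x 1).

(* The state is the continuous representative of its class (so that x(-1) and
   x(1) make sense); the control is an integrable function, hence the state
   equation and the constraint on (x, u) are understood almost everywhere. *)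
Definition feasibleB (x : R -> 'cV[R]_q.+1) (u : R -> R) : Prop :=
  [/\ {within `[-1, 1], continuous x} /\
        mu.-integrable `[-1, 1] (EFin \o u),
      forall i j : 'I_q.+1, j = i.+1 :> nat ->
        weak_derivn 1 (fun t => x t i 0) (fun t => x t j 0),
      weak_derivn 1 (fun t => x t ord_max 0)
        (fun t => dynf P (x t) + dyng P (x t) * u t),
      cone P (x (-1), x 1) = 0 &
      {ae mu, forall t, t \in `[-1, 1] -> forall i, conh P (x t, u t) i 0 <= 0}].

Definition optimalB (x : R -> 'cV[R]_q.+1) (u : R -> R) : Prop :=
  feasibleB x u /\ forall x' u', feasibleB x' u' -> costJ x u <= costJ x' u'.

End ProblemB.

Section LGL.
Variable R : realType.

(* Rodrigues' formula. *)
Definition legendre (n : nat) : {poly R} :=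
  (2 ^+ n * n`!%:R)^-1 *: derivn n (('X^2 - 1) ^+ n).

Variable N : nat.

(* [rootsR] lists the real roots in increasing order; those of L_N' are N - 1
   points of (-1, 1). *)
Definition lgl_nodes : seq R := -1 :: rcons (rootsR (deriv (legendre N))) 1.

Definition node (k : 'I_N.+1) : R := lgl_nodes`_k.

Definition weight (k : 'I_N.+1) : R :=
  2 / (N%:R * N.+1%:R) / (legendre N).[node k] ^+ 2.

Definition diffmx : 'M[R]_N.+1 := \matrix_(i, k)
  if i != k then (legendre N).[node i] / (legendre N).[node k] / (node i - node k)
  else if i == ord0 then - (N%:R * N.+1%:R / 4)
  else if i == ord_max then N%:R * N.+1%:R / 4
  else 0.

(* Lagrange's form of the polynomial of degree <= N with values [v 0 k] at
   [node k]. *)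
Definition interp (v : 'rV[R]_N.+1) : {poly R} :=
  \sum_k v 0 k *:
    \prod_(j | j != k) ((node k - node j)^-1 *: ('X - (node j)%:P)).

(* a_n^N(m1), as a function of the nodal values [v] of x_r. *)
Definition spectral_coef (m1 n : nat) (v : 'rV[R]_N.+1) : R :=
  (n%:R + 1 / 2) *
  \sum_k (legendre n).[node k] * weight k * (diffmx ^+ m1 *m v^T) k 0.

End LGL.

Section ProblemBN.
Variables (R : realType) (q Ne Nh : nat).
Local Notation mu := (@lebesgue_measure R).

(* Points of R^(r+1) are split as R^r * R. *)
Record bounds := Bounds {
  box_lo : 'cV[R]_q.+1 * R ;
  box_hi : 'cV[R]_q.+1 * R ;
  der_lo : nat -> R ;
  der_hi : nat -> R ;
  coef_hi : R
}.

Definition beyond (m1 : nat) (T b : bounds) : Prop :=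
  [/\ forall i, (box_lo b).1 i 0 < (box_lo T).1 i 0 /\
                (box_hi T).1 i 0 < (box_hi b).1 i 0,
      (box_lo b).2 < (box_lo T).2 /\ (box_hi T).2 < (box_hi b).2,
      forall j, (0 < j < m1)%N ->
        der_lo b j < der_lo T j /\ der_hi T j < der_hi b j &
      coef_hi T < coef_hi b].

(* The explicit requirements that the thresholds have to meet for a given
   (x, u).  The weak derivatives of x_r enter through representatives:
   continuous ones for the orders below m1, one of bounded variation for the
   order m1 + 1. *)
Definition encloses (m1 : nat) (b : bounds)
    (x : R -> 'cV[R]_q.+1) (u : R -> R) : Prop :=
  [/\ forall t, t \in `[-1, 1] -> forall i,
        (box_lo b).1 i 0 < x t i 0 < (box_hi b).1 i 0,
      {ae mu, forall t, t \in `[-1, 1] -> (box_lo b).2 < u t < (box_hi b).2},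
      forall j, (0 < j < m1)%N -> exists y : R -> R,
        [/\ weak_derivn j (fun t => x t ord_max 0) y,
            {within `[-1, 1], continuous y} &
            forall t, t \in `[-1, 1] -> der_lo b j < y t < der_hi b j] &
      exists (y : R -> R) (U : R),
        [/\ weak_derivn m1.+1 (fun t => x t ord_max 0) y,
            bounded_variation (-1) 1 y,
            forall t, t \in `[-1, 1] -> `|y t| <= U &
            6 / Num.sqrt pi * (U + fine (total_variation (-1) 1 y))
              * zeta (3 / 2) < coef_hi b]].

Variable P : problemB R q Ne Nh.

Section Discretization.
Variable N : nat.
Implicit Types (xb : 'M[R]_(q.+1, N.+1)) (ub : 'rV[R]_N.+1).

(* [xb i k] is component i of the state at node k, so [row i xb] and [col k xb]
   are the row vector of the i-th component and the state at node k. *)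

Definition costJN xb ub : R :=
  (\sum_k costF P (col k xb, ub 0 k) * weight R k)
  + costE P (col ord0 xb, col ord_max xb).

(* (N - r - 1)^(-beta), computed in R. *)
Definition tolerance (beta : R) : R := (N%:R - q.+1%:R - 1) `^ (- beta).

(* The sum on the coefficients has the indices 0 <= n <= N - r - m1 + 1. *)
Definition feasibleBN (m1 : nat) (beta : R) (b : bounds) xb ub : Prop :=
  [/\ (forall i j : 'I_q.+1, j = i.+1 :> nat ->
         diffmx R N *m (row i xb)^T = (row j xb)^T) /\
      (forall k, (diffmx R N *m (row ord_max xb)^T) k 0 =
                 dynf P (col k xb) + dyng P (col k xb) * ub 0 k),
      (`|cone P (col ord0 xb, col ord_max xb)| <= tolerance beta) /\
      (forall k i, conh P (col k xb, ub 0 k) i 0 <= tolerance beta),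
      forall k,
        (forall i, (box_lo b).1 i 0 <= xb i k <= (box_hi b).1 i 0) /\
        (box_lo b).2 <= ub 0 k <= (box_hi b).2,
      forall j, (0 < j < m1)%N ->
        der_lo b j <= (diffmx R N ^+ j *m (row ord_max xb)^T) ord0 0
          <= der_hi b j &
      \sum_(n < N.+2 - (q.+1 + m1)) `|spectral_coef m1 n (row ord_max xb)|
        <= coef_hi b].

Definition optimalBN (m1 : nat) (beta : R) (b : bounds) xb ub : Prop :=
  feasibleBN m1 beta b xb ub /\
  forall xb' ub', feasibleBN m1 beta b xb' ub' -> costJN xb ub <= costJN xb' ub'.

Definition interp_state xb (t : R) : 'cV[R]_q.+1 :=
  \col_i (interp (row i xb)).[t].

Definition interp_control xb (t : R) : R :=
  ((deriv (interp (row ord_max xb))).[t] - dynf P (interp_state xb t))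
    / dyng P (interp_state xb t).

End Discretization.
End ProblemBN.

(* Main.v *)
From HB Require Import structures.
Require Import Defs.
From mathcomp Require Import all_boot all_order all_algebra.
From mathcomp Require Import all_classical all_reals all_analysis.
From mathcomp Require Import polyrcf measurable_realfun.
From mathcomp Require Import ring lra zify.

Set Implicit Arguments.
Unset Strict Implicit.
Unset Printing Implicit Defensive.

Import Order.TTheory GRing.Theory Num.Theory.
Import numFieldNormedType.Exports.

Local Open Scope classical_set_scope.
Local Open Scope ring_scope.

(** The proof is a compactness argument that compares discrete optimal solutions
    with discretizations of the given one.

    A discrete trajectory satisfying the linear state equations is the sequence
    of nodal values of a polynomial Q and of its derivatives
    ([feasible_is_sample]), because the matrix D differentiates interpolants
    ([diffmx_interp]).  The spectral coefficients are the Legendre coefficients of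
    the derivative of order r - 1 + m1 of Q ([spectral_coefE]), and the weighted
    sums at the nodes are integrals for polynomials of degree less than 2 N
    ([quadrature]), hence converge to integrals for continuous functions
    ([quadrature_cvg]).

    Compactness.  Since |L_n| <= 1, the bound d on the spectral coefficients
    bounds the highest derivative of Q; with the bounds on the initial values,
    integration bounds all the lower ones ([feasible_bounded]).  As m1 >= 2, the
    state and the derivative of x_r are equi-Lipschitz, so that a subsequence
    converges uniformly ([ascoli]), and with it the controls, since g does not
    vanish.  The tolerances tend to 0, so the limit is feasible
    ([limit_feasible]), and the costs converge ([cost_close]).

    Approximation.  The weak derivatives of the given solution are a chain of
    primitives ([regular_chain]) that ends with a function of bounded variation.
    The Legendre moments of a function of bounded variation are O(n^(-3/2)),
    and each integration gains one power ([decay_bv], [decay_primitive]).  Hence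
    the partial Legendre sums of x_r^(m1) converge uniformly, with error
    O(N^(-(m - m1 - 1/2))), and with uniformly summable coefficients
    ([legendre_approx]).  Their iterated primitives satisfy the constraints up
    to this error, which is eventually less than the tolerance N^(-beta) because
    beta < m - m1 - 3/4: they are feasible for the discrete problem
    ([approx_feasible]), and their discrete costs tend to the optimal value.

    The cost of the limit is the limit of the discrete optimal costs, so it is at
    most the limit of the discrete costs of these approximations: the limit is
    optimal. *)

(** * Legendre polynomials *)

Section PolyIntegral.
Variable R : realType.
Implicit Types p q : {poly R}.

Definition antid p : {poly R} := \poly_(i < (size p).+1) (p`_i.-1 / i%:R).

Lemma coef_antid p i : (antid p)`_i = p`_i.-1 / i%:R.
Proof.
rewrite coef_poly; case: ltnP => // h.
by rewrite nth_default ?mul0r //; case: i h.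
Qed.

Lemma size_antid p : (size (antid p) <= (size p).+1)%N.
Proof. exact: size_poly. Qed.

Lemma deriv_antid p : (antid p)^`() = p.
Proof.
apply/polyP => i; rewrite coef_deriv coef_antid /= -[LHS]mulr_natr.
by rewrite divfK ?pnatr_eq0.
Qed.

Lemma antid_deriv p : antid p^`() = p - (p`_0)%:P.
Proof.
apply/polyP => -[|i]; rewrite coef_antid coefB coefC /=.
  by rewrite invr0 mulr0 subrr.
by rewrite coef_deriv subr0 -[X in X / _]mulr_natr mulfK // pnatr_eq0.
Qed.

Lemma antid_is_linear : linear antid.
Proof.
move=> a p q; apply/polyP => i.
by rewrite !(coefD, coefZ, coef_antid) mulrDl mulrA.
Qed.

HB.instance Definition _ :=
  GRing.isLinear.Build R {poly R} {poly R} _ antid antid_is_linear.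

(** The integral over [-1, 1], computed algebraically; [intg_poly] identifies it
    with the Lebesgue integral. *)
Definition pint p : R := (antid p).[1] - (antid p).[-1].

Lemma pint_is_linear : linear_for *%R pint.
Proof.
move=> a p q; rewrite /pint linearP !hornerD !hornerZ; ring.
Qed.

HB.instance Definition _ :=
  GRing.isLinear.Build R {poly R} R _ pint pint_is_linear.

Lemma pintD p q : pint (p + q) = pint p + pint q.
Proof. exact: linearD. Qed.

Lemma pintB p q : pint (p - q) = pint p - pint q.
Proof. exact: linearB. Qed.

Lemma pintZ a p : pint (a *: p) = a * pint p.
Proof. exact: linearZ. Qed.

Lemma pint_deriv p : pint p^`() = p.[1] - p.[-1].
Proof. by rewrite /pint antid_deriv !hornerE; ring. Qed.

Lemma pint_by_parts p q :
  pint (p * q^`()) = (p * q).[1] - (p * q).[-1] - pint (p^`() * q).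
Proof. by rewrite -pint_deriv derivM pintD addrAC subrr add0r. Qed.

Lemma poly_eq0_itv p : (forall t, -1 < t < 1 -> p.[t] = 0) -> p = 0.
Proof.
move=> p0; apply/eqP; apply: contraT => pN0.
pose s := [seq (i.+2%:R : R)^-1 | i <- iota 0 (size p)].
have := @max_poly_roots _ p s pN0.
rewrite size_map size_iota ltnn; apply.
  apply/allP => x /mapP[i _ ->]; apply/rootP; apply: p0.
  have : 0 < (i.+2%:R : R)^-1 by rewrite invr_gt0 ltr0n.
  have : (i.+2%:R : R)^-1 < 1 by rewrite invf_lt1 ?ltr0n // ltr1n.
  by move: (_^-1) => z; lra.
rewrite map_inj_uniq ?iota_uniq // => i j /invr_inj /eqP.
by rewrite eqr_nat => /eqP [].
Qed.

(** The antiderivative of p^2 is monotone, and takes the same value at both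
    ends. *)
Lemma pint_sqr_eq0 p : pint (p * p) = 0 -> p = 0.
Proof.
move=> p20; apply: poly_eq0_itv => t t1.
have mono : {in `[-1, 1] &, {homo horner (antid (p * p)) : x y / x <= y}}.
  apply: ler_hornerW => z zin; rewrite deriv_antid hornerM; exact: sqr_ge0.
suff cst : antid (p * p) - ((antid (p * p)).[1])%:P = 0.
  have /(congr1 (fun q => q^`().[t])) := cst.
  rewrite derivB deriv_antid derivC subr0 hornerM [in RHS]linear0 horner0.
  by move/eqP; rewrite mulf_eq0 orbb => /eqP.
apply: poly_eq0_itv => s s1; rewrite !hornerE.
have h1 : (antid (p * p)).[-1] <= (antid (p * p)).[s].
  by apply: mono; rewrite ?in_itv /=; lra.
have h2 : (antid (p * p)).[s] <= (antid (p * p)).[1].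
  by apply: mono; rewrite ?in_itv /=; lra.
by move: p20 h1 h2; rewrite /pint; lra.
Qed.

End PolyIntegral.

Section Legendre.
Variable R : realType.
Implicit Types p q r : {poly R}.

Local Notation L := (legendre R).

(** With Rodrigues' formula, the derivatives at c of a multiple of (X - c)^n give
    the values of L_n at both ends, and show that the boundary terms of the
    integrations by parts below vanish. *)
Lemma derivn_root_lt n k (c : R) r : (k < n)%N ->
  (derivn k (('X - c%:P) ^+ n * r)).[c] = 0.
Proof.
elim: k n r => [|k IH] [|n] // r kn.
  by rewrite derivn0 exprS -mulrA hornerM hornerXsubC subrr mul0r.
rewrite derivSn.
have -> : (('X - c%:P) ^+ n.+1 * r)^`() =
   ('X - c%:P) ^+ n * (n.+1%:R *: r + ('X - c%:P) * r^`()).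
  rewrite derivM deriv_exp derivXsubC mul1r /= -scaler_nat.
  rewrite mulrDr -scalerAl -scalerAr; congr (_ + _).
  by rewrite exprSr mulrA.
exact: IH.
Qed.

Lemma derivn_root_eq n (c : R) r :
  (derivn n (('X - c%:P) ^+ n * r)).[c] = n`!%:R * r.[c].
Proof.
elim: n r => [|n IH] r; first by rewrite derivn0 expr0 mul1r fact0 mul1r.
rewrite derivSn.
have -> : (('X - c%:P) ^+ n.+1 * r)^`() =
   ('X - c%:P) ^+ n * (n.+1%:R *: r + ('X - c%:P) * r^`()).
  rewrite derivM deriv_exp derivXsubC mul1r /= -scaler_nat.
  rewrite mulrDr -scalerAl -scalerAr; congr (_ + _).
  by rewrite exprSr mulrA.
rewrite IH hornerD hornerZ hornerM hornerXsubC subrr mul0r addr0.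
by rewrite factS natrM; ring.
Qed.

Lemma X21E : 'X^2 - 1 = ('X - 1%:P) * ('X - (-1)%:P) :> {poly R}.
Proof. by rewrite polyCN opprK -polyC1; ring. Qed.

Lemma derivn_rod_lt1 n k : (k < n)%N ->
  (derivn k (('X^2 - 1 : {poly R}) ^+ n)).[1] = 0.
Proof. by move=> kn; rewrite X21E exprMn derivn_root_lt. Qed.

Lemma derivn_rod_ltN1 n k : (k < n)%N ->
  (derivn k (('X^2 - 1 : {poly R}) ^+ n)).[-1] = 0.
Proof. by move=> kn; rewrite X21E exprMn mulrC derivn_root_lt. Qed.

Lemma succr_neq0 n : (n.+1%:R : R) != 0.
Proof. by rewrite pnatr_eq0. Qed.

Lemma factr_neq0 n : (n`!%:R : R) != 0.
Proof. by rewrite pnatr_eq0 -lt0n fact_gt0. Qed.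

Lemma pow2_neq0 n : (2 ^+ n : R) != 0.
Proof. by rewrite expf_neq0 // pnatr_eq0. Qed.

Lemma rod_coef_neq0 n : (2 ^+ n * n`!%:R : R) != 0.
Proof.
by rewrite mulf_neq0 ?pow2_neq0 ?factr_neq0.
Qed.

Lemma legendre1 n : (L n).[1] = 1.
Proof.
rewrite /legendre hornerZ X21E exprMn derivn_root_eq horner_exp hornerXsubC.
have -> : (1 - -1 : R) = 2 by ring.
by rewrite [_`!%:R * _]mulrC mulVf ?rod_coef_neq0.
Qed.

Lemma legendreN1 n : (L n).[-1] = (-1) ^+ n.
Proof.
rewrite /legendre hornerZ X21E exprMn [X in derivn _ X]mulrC derivn_root_eq horner_exp.
rewrite hornerXsubC; have -> : (-1 - 1 : R) = (-1) * 2 by ring.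
rewrite exprMn [_`!%:R * _]mulrC -mulrA mulrCA [X in _ * X]mulrA.
by rewrite -[_ * _ * _]mulrA mulVf ?rod_coef_neq0 ?mulr1.
Qed.

Lemma legendre0 : L 0 = 1.
Proof. by rewrite /legendre expr0 derivn0 expr0 fact0 mulr1 invr1 scale1r. Qed.

Lemma size_rod n : size (('X^2 - 1 : {poly R}) ^+ n) = (n.*2).+1.
Proof.
have := size_exp ('X^2 - 1 : {poly R}) n.
have := size_poly_eq0 (('X^2 - 1 : {poly R}) ^+ n).
rewrite -{3}polyC1 size_XnsubC //= expf_eq0 -size_poly_eq0 -{2}polyC1 size_XnsubC //= andbF.
by case: size => //= k _ ->; rewrite mul2n.
Qed.

Lemma size_derivn k p : size (derivn k p) = (size p - k)%N.
Proof.
elim: k => [|k IH]; first by rewrite derivn0 subn0.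
by rewrite derivnS polyorder.size_deriv IH -subnS.
Qed.

Lemma size_legendre n : size (L n) = n.+1.
Proof.
rewrite /legendre size_scale ?invr_neq0 ?rod_coef_neq0 //.
by rewrite size_derivn size_rod -addnn subSn ?leq_addr // addKn.
Qed.

Lemma legendre_1 : L 1 = 'X.
Proof.
rewrite /legendre !expr1 derivn1 derivB derivXn -polyC1 derivC subr0 expr1 mulr1.
by rewrite -[X in _ *: X]scaler_nat scalerA mulVf ?scale1r // pnatr_eq0.
Qed.

(** Since 0.-1 = 0 and L_0' = 0, the recurrence also holds at n = 0. *)
Lemma deriv_legendre_rec n :
  (L n.+1)^`() = (2 * n%:R + 1) *: L n + (L n.-1)^`().
Proof.
case: n => [|n].
  by rewrite legendre_1 legendre0 derivX derivC mulr0 add0r addr0 scale1r.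
rewrite /= /legendre !derivZ -!derivnS.
set u := ('X^2 - 1 : {poly R}).
have du : u^`() = 2%:R *: 'X.
  by rewrite derivB derivXn derivC subr0 expr1 scaler_nat.
have -> : (u ^+ n.+2)^`(n.+3) =
   derivn n.+1 ((2 * n.+2%:R * (2 * n.+1%:R + 1)) *: u ^+ n.+1 +
                (4 * n.+1%:R * n.+2%:R) *: u ^+ n).
  rewrite 2!derivSn; congr (derivn _ _).
  rewrite deriv_exp du /= derivMn derivM derivZ derivX deriv_exp du /=.
  rewrite -[_ *+ n.+2]mulr_natr -[_ *+ n.+1]mulr_natr -!mul_polyC.
  rewrite !polyCM !polyCD !polyCM !polyC_natr.
  have hX : 'X * 'X = u + 1 :> {poly R} by rewrite /u; ring.
  rewrite exprS; set v := u ^+ n.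
  set a := (n.+1%:R : {poly R}); set b := (n.+2%:R : {poly R}).
  transitivity (b * (u * v * 2%:R + 'X * 'X * (4 * a * v))); last first.
    by rewrite hX polyC1; ring.
  ring.
rewrite linearD !linearZ /= scalerDr !scalerA; congr (_ *: _ + _ *: _).
- rewrite (factS n.+1) (exprS _ n.+1) natrM.
  have := pow2_neq0 n.+1; have := factr_neq0 n.+1; have := succr_neq0 n.+1.
  move: (n.+2%:R) (2 ^+ n.+1) (_`!%:R) => a b c a0 b0 c0.
  by field; rewrite a0 b0 c0.
- rewrite (factS n.+1) (factS n) (exprS _ n.+1) (exprS _ n) !natrM.
  have := pow2_neq0 n; have := factr_neq0 n; have := succr_neq0 n.
  have := succr_neq0 n.+1.
  move: (n.+2%:R) (n.+1%:R) (2 ^+ n) (_`!%:R) => a a' b c a0 a'0 b0 c0.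
  by field; rewrite a0 a'0 b0 c0.
Qed.

(** Integrating by parts n times moves all the derivatives of Rodrigues' formula
    to q; the boundary terms vanish because (X^2 - 1)^n has zeros of order n at
    both ends. *)
Lemma legendre_orth n q : (size q <= n)%N -> pint (L n * q) = 0.
Proof.
move=> sq; rewrite /legendre -scalerAl pintZ.
suff H k r : (k <= n)%N -> (size r <= k)%N ->
    pint (derivn k (('X^2 - 1) ^+ n) * r) = 0 by rewrite H // mulr0.
elim: k r => [|k IH] r kn sr.
  by move: sr; rewrite leqn0 size_poly_eq0 => /eqP ->; rewrite mulr0 linear0.
rewrite derivnS mulrC pint_by_parts !hornerM derivn_rod_lt1 // derivn_rod_ltN1 //.
rewrite !mulr0 subrr sub0r mulrC IH ?oppr0 //; first exact: ltnW.
by rewrite polyorder.size_deriv; case: (size r) sr.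
Qed.

(** The integral of X (L_n^2)' is computed in two ways: by parts, and from the
    fact that X L_n' and n L_n differ by a polynomial of degree less than n. *)
Lemma legendre_norm n : pint (L n * L n) = 2 / (2 * n%:R + 1).
Proof.
have h1 : pint (L n * ('X * (L n)^`())) = n%:R * pint (L n * L n).
  apply/eqP; rewrite -subr_eq0; apply/eqP.
  have := @legendre_orth n ('X * (L n)^`() - n%:R *: L n).
  rewrite mulrBr -scalerAr pintB pintZ => -> //.
  apply/leq_sizeP => j nj; rewrite coefB coefZ coefXM coef_deriv.
  have [jn|jn] := eqVneq j n; last first.
    have h : (size (L n) <= j)%N by rewrite size_legendre ltn_neqAle eq_sym jn.
    by case: j nj jn h => [|j] nj jn h /=; rewrite (nth_default _ h) mulr0 ?mul0rn subr0.
  rewrite -jn; case: j {nj jn} => [|j] /=; first by rewrite mul0r subrr.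
  by rewrite mulr_natl subrr.
have h2 : pint ('X * (L n * L n)^`()) = 2 - pint (L n * L n).
  rewrite pint_by_parts !hornerM !hornerX derivX mul1r legendre1 legendreN1.
  by rewrite -exprMn mulrNN mulr1 expr1n; ring.
have h3 : pint ('X * (L n * L n)^`()) = 2 * pint (L n * ('X * (L n)^`())).
  rewrite derivM mulrDr pintD mulr_natl mulr2n.
  by congr (pint _ + pint _); ring.
rewrite h3 h1 in h2.
have : (2 * n%:R + 1 : R) != 0.
  by rewrite gt_eqF // -natrM natr1 ltr0n.
move=> h; apply: (mulIf h); rewrite divfK //.
by apply: (@etrans _ _ (2 * (n%:R * pint (L n * L n)) + pint (L n * L n))); [ring | rewrite h2; ring].
Qed.

Lemma onemX2_1 : (1 - 'X^2 : {poly R}).[1] = 0.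
Proof. by rewrite !hornerE; ring. Qed.

Lemma onemX2_N1 : (1 - 'X^2 : {poly R}).[-1] = 0.
Proof. by rewrite !hornerE; ring. Qed.

(** The difference r of the two sides has degree less than n, as the leading
    terms cancel.  Since p |-> ((1 - X^2) p')' is symmetric, r is orthogonal to
    itself. *)
Lemma legendre_ode n :
  ((1 - 'X^2) * (L n)^`())^`() = - (n%:R * n.+1%:R) *: L n.
Proof.
set A := (1 - 'X^2) * (L n)^`().
apply/eqP; rewrite scaleNr -addr_eq0; apply/eqP.
set r := _ + _.
have sr : (size r <= n)%N.
  apply/leq_sizeP => j nj.
  rewrite coefD coef_deriv coefZ /A mulrBl mul1r coefB coefXnM coef_deriv.
  have -> : (if (j.+1 < 2)%N then 0 else ((L n)^`())`_(j.+1 - 2)) = j%:R * (L n)`_j.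
    case: j {nj} => [|j]; first by rewrite mul0r.
    by rewrite /= subSS subSS subn0 coef_deriv mulr_natl.
  rewrite [(L n)`_j.+2]nth_default; last by rewrite size_legendre; lia.
  have [<-|jn] := eqVneq j n; first by rewrite -mulr_natr; ring.
  rewrite nth_default; first by rewrite !mulr0 mul0rn !sub0r oppr0 mul0rn addr0.
  by rewrite size_legendre; lia.
apply: pint_sqr_eq0; rewrite {2}/r mulrDr pintD -scalerAr pintZ.
rewrite [r * L n]mulrC legendre_orth // mulr0 addr0 pint_by_parts.
rewrite /A !hornerM onemX2_1 onemX2_N1 !(mul0r, mulr0) subrr sub0r.
have -> : r^`() * ((1 - 'X^2) * (L n)^`()) = (r^`() * (1 - 'X^2)) * (L n)^`() by rewrite mulrA.
rewrite pint_by_parts !hornerM onemX2_1 onemX2_N1 !(mul0r, mulr0) subrr sub0r.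
rewrite opprK [X in pint X]mulrC legendre_orth // polyorder.size_deriv.
apply: leq_trans sr.
have [->|r0] := eqVneq r^`() 0; first by rewrite mul0r size_poly0.
have -> : size (r^`() * (1 - 'X^2)) = (size r^`() + 2)%N.
  rewrite size_mul // -?size_poly_eq0; last first.
    by rewrite -opprB size_polyN -polyC1 size_XnsubC.
  by rewrite -opprB size_polyN -polyC1 size_XnsubC // addn3 addn2.
have r0' : size r != 0%N.
  by rewrite size_poly_eq0; apply: contraNneq r0 => ->; rewrite derivC.
by rewrite polyorder.size_deriv addn2 /=; case: (size r) r0'.
Qed.


(** For n > 0, the antiderivative of L_n that vanishes at both ends.  The LGL
    nodes are exactly the zeros of [ileg N], by [ileg_lam]. *)
Definition ileg n : {poly R} := (2 * n%:R + 1)^-1 *: (L n.+1 - L n.-1).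

Lemma two_n1_neq0 n : (2 * n%:R + 1 : R) != 0.
Proof. by rewrite gt_eqF // -natrM natr1 ltr0n. Qed.

Lemma deriv_ileg n : (ileg n)^`() = L n.
Proof.
rewrite /ileg derivZ derivB deriv_legendre_rec addrK scalerA.
by rewrite mulVf ?two_n1_neq0 ?scale1r.
Qed.

Lemma ileg_1 n : (ileg n).[1] = 0.
Proof. by rewrite /ileg hornerZ hornerD hornerN !legendre1 subrr mulr0. Qed.

Lemma ileg_N1 n : (0 < n)%N -> (ileg n).[-1] = 0.
Proof.
case: n => // n _; rewrite /ileg hornerZ hornerD hornerN !legendreN1 /=.
by rewrite !exprS mulrA mulrNN mulr1 mul1r subrr mulr0.
Qed.

(** By the Legendre equation both sides have the same derivative, and both vanish
    at 1. *)
Lemma ileg_lam n : (n%:R * n.+1%:R) *: ileg n = ('X^2 - 1) * (L n)^`().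
Proof.
apply/eqP; rewrite -subr_eq0; apply/eqP; set r := _ - _.
have dr : r^`() = 0.
  rewrite /r derivB derivZ deriv_ileg -[X in (X * _)^`()]opprB mulNr derivN.
  by rewrite legendre_ode opprK scaleNr subrr.
have : antid r^`() = 0 by rewrite dr linear0.
rewrite antid_deriv => /eqP; rewrite subr_eq0 => /eqP rE.
have : r.[1] = 0.
  rewrite /r hornerD hornerN hornerZ hornerM ileg_1 mulr0 sub0r.
  by rewrite -[X in X.[1]]opprB hornerN onemX2_1 oppr0 mul0r oppr0.
by rewrite rE hornerC => ->; rewrite polyC0.
Qed.


Lemma deriv_onemX2 : (1 - 'X^2 : {poly R})^`() = (- 2) *: 'X.
Proof.
by rewrite derivB derivXn -polyC1 derivC sub0r expr1 scaleNr scaler_nat.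
Qed.

Lemma legendre_ode_pt n s :
  (1 - s ^+ 2) * ((L n)^`())^`().[s] =
  2 * s * (L n)^`().[s] - n%:R * n.+1%:R * (L n).[s].
Proof.
have := congr1 (horner^~ s) (legendre_ode n).
rewrite derivM deriv_onemX2 hornerD !hornerM !hornerZ hornerX.
have -> : (1 - 'X^2 : {poly R}).[s] = 1 - s ^+ 2 by rewrite !hornerE.
move: (_.[s]) ((_)^`().[s]) (((L n)^`())^`().[s]) => a b c; lra.
Qed.

Lemma ileg_lam_pt n s :
  n%:R * n.+1%:R * (ileg n).[s] = (s ^+ 2 - 1) * (L n)^`().[s].
Proof.
have := congr1 (horner^~ s) (ileg_lam n).
by rewrite hornerM hornerZ !hornerE => ->.
Qed.

Lemma homo_horner p (a b : R) : a <= b ->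
  (forall s, a <= s <= b -> 0 <= p^`().[s]) -> p.[a] <= p.[b].
Proof.
move=> ab h.
have : {in `[a, b] &, {homo horner p : x y / x <= y}}.
  apply: ler_hornerW => z; rewrite in_itv /= => /andP[/ltW az /ltW zb].
  by rewrite h // az.
by apply; rewrite ?in_itv /= ?lexx ?ab.
Qed.

Lemma antihomo_horner p (a b : R) : a <= b ->
  (forall s, a <= s <= b -> p^`().[s] <= 0) -> p.[b] <= p.[a].
Proof.
move=> ab h; rewrite -lerN2 -!hornerN; apply: homo_horner => // s sab.
by rewrite derivN hornerN oppr_ge0 h.
Qed.

(** Sonin's argument: T = L_n^2 + (1 - t^2) L_n'^2 / (n (n + 1)) satisfies
    T' = 2 t L_n'^2 / (n (n + 1)), so it is maximal at the two ends, where it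
    equals 1. *)
Lemma legendre_le1 n t : -1 <= t <= 1 -> `|(L n).[t]| <= 1.
Proof.
move=> t1; case: n => [|n]; first by rewrite legendre0 hornerC normr1.
set l : R := n.+1%:R * n.+2%:R.
have l0 : 0 < l by rewrite mulr_gt0 ?ltr0n.
pose T := L n.+1 * L n.+1 + l^-1 *: ((1 - 'X^2) * ((L n.+1)^`() * (L n.+1)^`())).
have dT s : T^`().[s] = 2 * l^-1 * s * ((L n.+1)^`().[s] * (L n.+1)^`().[s]).
  have := legendre_ode_pt n.+1 s; rewrite -/l.
  rewrite /T; move: (L n.+1) => P.
  rewrite derivD derivZ !derivM deriv_onemX2.
  rewrite !(hornerD, hornerM, hornerZ) hornerX.
  have -> : (1 : {poly R}).[s] + (- 'X^2).[s] = 1 - s ^+ 2 by rewrite !hornerE.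
  move: P.[s] (P^`().[s]) ((P^`())^`().[s]) => a b c.
  move: (1 - s ^+ 2) => d ode.
  have -> : d * (c * b + b * c) = 2 * b * (d * c) by ring.
  rewrite ode; field; exact: lt0r_neq0.
have Tx s : T.[s] = (L n.+1).[s] ^+ 2 + l^-1 * ((1 - s ^+ 2) * (L n.+1)^`().[s] ^+ 2).
  rewrite /T; move: (L n.+1) => P.
  by rewrite !(hornerD, hornerM, hornerZ) !hornerE.
have T1 : T.[t] <= 1.
  have l0' : 0 <= 2 * l^-1 by rewrite mulr_ge0 // invr_ge0 ltW.
  case: (lerP 0 t) => t0.
    have -> : 1 = T.[1] by rewrite Tx legendre1 !expr1n subrr mul0r mulr0 addr0.
    apply: homo_horner; first lra.
    move=> s st; rewrite dT; apply: mulr_ge0; last exact: sqr_ge0.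
    by apply: mulr_ge0 => //; lra.
  have -> : 1 = T.[-1].
    by rewrite Tx legendreN1 sqrr_sign sqrrN expr1n subrr mul0r mulr0 addr0.
  apply: antihomo_horner; first lra.
  move=> s st; rewrite dT; apply: mulr_le0_ge0; last exact: sqr_ge0.
  by apply: mulr_ge0_le0 => //; lra.
rewrite -(@ler_pXn2r _ 2) ?nnegrE // expr1n real_normK ?num_real //.
apply: le_trans T1; rewrite Tx lerDl mulr_ge0 ?invr_ge0 ?(ltW l0) //.
rewrite mulr_ge0 ?sqr_ge0 // subr_ge0 -(expr1n _ 2) -[t ^+ 2]real_normK ?num_real //.
by rewrite ler_pXn2r ?nnegrE // ler_norml.
Qed.

(** The recurrences at 0 relate degrees of the same parity, so the induction
    carries two consecutive degrees. *)
Lemma legendre_at0 n :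
  (L n.+1)^`().[0] = n.+1%:R * (L n).[0] /\
  (L n.+2).[0] = - (n.+1%:R / n.+2%:R) * (L n).[0].
Proof.
have recd k : (L k.+1)^`().[0] = (2 * k%:R + 1) * (L k).[0] + (L k.-1)^`().[0].
  by rewrite deriv_legendre_rec hornerD hornerZ.
have rec k : (L k.+1).[0] = (L k.-1).[0] - (2 * k%:R + 1) / (k%:R * k.+1%:R) * (L k)^`().[0] \/ k = 0%N.
  case: k => [|k]; [by right | left].
  have := ileg_lam_pt k.+1 0; rewrite /ileg hornerZ hornerD hornerN.
  have h1 := two_n1_neq0 k.+1; have h2 := succr_neq0 k; have h3 := succr_neq0 k.+1.
  rewrite expr0n sub0r mulN1r -![k.+1.-1]/k.
  move: (k.+1%:R : R) (k.+2%:R : R) h1 h2 h3.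
  move=> b c a0 b0 c0 h; have -> : (L k.+1)^`().[0] = - (b * c * ((2 * b + 1)^-1 * ((L k.+2).[0] - (L k).[0]))).
    by rewrite h opprK.
  by field; rewrite a0 b0 c0.
suff H : forall n, ((L n.+1)^`().[0] = n.+1%:R * (L n).[0] /\
  (L n.+2).[0] = - (n.+1%:R / n.+2%:R) * (L n).[0]) /\
  ((L n.+2)^`().[0] = n.+2%:R * (L n.+1).[0] /\
  (L n.+3).[0] = - (n.+2%:R / n.+3%:R) * (L n.+1).[0]) by have [] := H n.
have step k : (L k.+1)^`().[0] = k.+1%:R * (L k).[0] ->
  (L k.+2).[0] = - (k.+1%:R / k.+2%:R) * (L k).[0].
  move=> h; case: (rec k.+1) => // ->; rewrite /= h.
  have h2 := succr_neq0 k; have h3 := succr_neq0 k.+1.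
  rewrite -(natr1 k.+1); rewrite -(natr1 k.+1) in h3.
  move: (k.+1%:R) h2 h3 => b b0 c0; by field; rewrite b0 c0.
have stepd k : (L k.+2).[0] = - (k.+1%:R / k.+2%:R) * (L k).[0] ->
  (L k.+1)^`().[0] = k.+1%:R * (L k).[0] ->
  (L k.+3)^`().[0] = k.+3%:R * (L k.+2).[0].
  move=> h1 h2; rewrite recd /= h2.
  have h3 := succr_neq0 k.+1.
  have -> : (k.+3%:R : R) = k.+1%:R + 2 by rewrite -natrD addn2.
  rewrite mulrDl h1.
  rewrite -(natr1 k.+1); rewrite -(natr1 k.+1) in h3.
  move: (k.+1%:R) h3 => b c0; by field; rewrite c0.
elim=> [|k [[a1 a2] [b1 b2]]]; last first.
  by split; split => //; [apply: stepd|apply: step; apply: stepd].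
have e1 : (L 1)^`().[0] = 1%:R * (L 0).[0].
  by rewrite legendre_1 derivX legendre0 hornerC mulr1.
have e2 : (L 2)^`().[0] = 2%:R * (L 1).[0].
  by rewrite recd /= legendre_1 legendre0 -polyC1 derivC hornerC hornerX !mulr0 addr0.
by split; split => //; apply: step.
Qed.

Lemma legendre_at0_le n : (L n).[0] ^+ 2 <= n.+1%:R^-1.
Proof.
suff H : forall n, (L n).[0] ^+ 2 <= n.+1%:R^-1 /\ (L n.+1).[0] ^+ 2 <= n.+2%:R^-1.
  by have [] := H n.
elim=> [|k [h1 h2]].
  by rewrite legendre0 legendre_1 hornerX hornerC expr1n invr1 lexx expr0n /= invr_ge0 ler0n.
split => //; have [_ ->] := legendre_at0 k.
rewrite exprMn sqrrN.
apply: le_trans (ler_wpM2l _ h1) _; first exact: sqr_ge0.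
have -> : (k.+3%:R : R) = k.+1%:R + 2 by rewrite -natrD addn2.
have -> : (k.+2%:R : R) = k.+1%:R + 1 by rewrite natr1.
have : 0 < k.+1%:R :> R by rewrite ltr0n.
move: (k.+1%:R) => b b0.
rewrite -[leRHS]mul1r ler_pdivlMr; last by lra.
have -> : (b / (b + 1)) ^+ 2 * b^-1 * (b + 2) = (b * (b + 2)) / (b + 1) ^+ 2.
  field; apply/andP; split; lra.
by rewrite ler_pdivrMr ?exprn_gt0 ?mul1r; nra.
Qed.

(** Sonin's argument again: ileg_n^2 + (1 - t^2) L_n^2 / (n (n + 1)) is maximal at
    0, where the recurrences give its size.  The resulting order n^(-3/2), half a
    power better than what |L_n| <= 1 gives, is the source of the half powers in
    all the rates below. *)
Lemma ileg_le n t : (0 < n)%N -> -1 <= t <= 1 ->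
  (ileg n).[t] ^+ 2 <= 2 / n%:R ^+ 3.
Proof.
case: n => // n _ t1.
set l : R := n.+1%:R * n.+2%:R.
have l0 : 0 < l by rewrite mulr_gt0 ?ltr0n.
pose S := ileg n.+1 * ileg n.+1 + l^-1 *: ((1 - 'X^2) * (L n.+1 * L n.+1)).
have dS s : S^`().[s] = - (2 * l^-1 * s * ((L n.+1).[s] * (L n.+1).[s])).
  have := ileg_lam_pt n.+1 s; rewrite -/l.
  rewrite /S; move: (ileg n.+1) (L n.+1) (deriv_ileg n.+1) => P Q PQ.
  rewrite derivD derivZ !derivM deriv_onemX2 PQ.
  rewrite !(hornerD, hornerM, hornerZ) hornerX.
  have -> : (1 : {poly R}).[s] + (- 'X^2).[s] = 1 - s ^+ 2 by rewrite !hornerE.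
  rewrite -opprB mulNr.
  move: P.[s] Q.[s] (Q^`().[s]) => c a b.
  move: (1 - s ^+ 2) => d h.
  have -> : d * (b * a + a * b) = 2 * a * (d * b) by ring.
  have {h}-> : d * b = - (l * c) by lra.
  field; exact: lt0r_neq0.
have Sx s : S.[s] = (ileg n.+1).[s] ^+ 2 + l^-1 * ((1 - s ^+ 2) * (L n.+1).[s] ^+ 2).
  rewrite /S; move: (ileg n.+1) (L n.+1) => P Q.
  by rewrite !(hornerD, hornerM, hornerZ) !hornerE.
have l0' : 0 <= 2 * l^-1 by rewrite mulr_ge0 // invr_ge0 ltW.
have S1 : S.[t] <= S.[0].
  case: (lerP 0 t) => t0.
    apply: antihomo_horner => // s st; rewrite dS oppr_le0.
    by apply: mulr_ge0; [apply: mulr_ge0 => //; lra | exact: sqr_ge0].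
  apply: homo_horner => [|s st]; first lra.
  rewrite dS oppr_ge0; apply: mulr_le0_ge0; last exact: sqr_ge0.
  by apply: mulr_ge0_le0 => //; lra.
apply: le_trans (_ : S.[t] <= _).
  rewrite Sx lerDl mulr_ge0 ?invr_ge0 ?(ltW l0) //.
  rewrite mulr_ge0 ?sqr_ge0 // subr_ge0 -(expr1n _ 2) -[t ^+ 2]real_normK ?num_real //.
  by rewrite ler_pXn2r ?nnegrE // ler_norml.
apply: le_trans S1 _; rewrite Sx expr0n /= subr0 mul1r.
have i0 : (ileg n.+1).[0] = - (L n).[0] / n.+2%:R.
  have := ileg_lam_pt n.+1 0; rewrite (legendre_at0 n).1 expr0n /= sub0r mulN1r.
  have h2 := succr_neq0 n; have h3 := succr_neq0 n.+1.
  move: (n.+1%:R) (n.+2%:R) h2 h3 => a b a0 b0 h.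
  apply: (mulfI (mulf_neq0 a0 b0)); rewrite h; by field; rewrite b0.
rewrite i0 expr_div_n sqrrN.
have := legendre_at0_le n; have := legendre_at0_le n.+1.
move: ((L n).[0] ^+ 2) ((L n.+1).[0] ^+ 2) => e f fe ee.
rewrite /l; apply: le_trans (_ : n.+1%:R^-1 * (n.+2%:R^-1 ^+ 2) + (n.+1%:R * n.+2%:R)^-1 * n.+2%:R^-1 <= _).
  apply: lerD; first by rewrite -exprVn ler_wpM2r // sqr_ge0.
  by rewrite ler_wpM2l // invr_ge0 mulr_ge0 ?ler0n.
have -> : (n.+2%:R : R) = n.+1%:R + 1 by rewrite natr1.
have : 0 < n.+1%:R :> R by rewrite ltr0n.
move: (n.+1%:R) => b b0.
have -> : b^-1 * (b + 1)^-1 ^+ 2 + (b * (b + 1))^-1 / (b + 1) = 2 / (b * (b + 1) ^+ 2).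
  field; apply/andP; split; lra.
rewrite ler_pM2l // lef_pV2 ?posrE ?exprn_gt0 ?mulr_gt0 //; [|lra..].
by rewrite exprS ler_pM2l // !expr2; nra.
Qed.

End Legendre.

(** * Interpolation, differentiation and quadrature at the LGL nodes *)

Section LegendreExpansion.
Variable R : realType.
Implicit Types p q : {poly R}.
Local Notation L := (legendre R).

(** The factor n + 1/2 is the inverse of the squared norm of L_n. *)
Definition lcoef n p : R := (n%:R + 1 / 2) * pint (L n * p).

Lemma legendre_orth_neq i j : i != j -> pint (L i * L j) = 0.
Proof.
case: (ltngtP i j) => // ij _; last by apply: legendre_orth; rewrite size_legendre.
by rewrite mulrC; apply: legendre_orth; rewrite size_legendre.
Qed.

(** The remainder is orthogonal to L_n for all n < K; as these polynomials have
    all degrees below K, it is orthogonal to itself. *)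
Lemma legendre_expansion K p : (size p <= K)%N ->
  p = \sum_(n < K) lcoef n p *: L n.
Proof.
move=> sp; apply/eqP; rewrite -subr_eq0; apply/eqP; set r := _ - _.
have sr : (size r <= K)%N.
  rewrite (leq_trans (size_polyD _ _)) // geq_max sp size_polyN.
  rewrite (leq_trans (size_sum _ _ _)) //; apply/bigmax_leqP => i _.
  by rewrite (leq_trans (size_scale_leq _ _)) // size_legendre.
have rL n : (n < K)%N -> pint (L n * r) = 0.
  move=> nK; rewrite /r mulrBr pintB mulr_sumr.
  have -> : pint (\sum_(i < K) L n * (lcoef i p *: L i)) =
            \sum_(i < K) lcoef i p * pint (L n * L i).
    rewrite linear_sum; apply: eq_bigr => i _; by rewrite /= -scalerAr pintZ.
  rewrite (bigD1 (Ordinal nK)) //= big1 ?addr0 => [|i ni].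
    rewrite /lcoef legendre_norm; have := two_n1_neq0 R n.
    move: (n%:R : R) (pint _) => a b a0; field; by rewrite a0.
  by rewrite legendre_orth_neq ?mulr0 // eq_sym.
suff H k q : (k <= K)%N -> (size q <= k)%N -> pint (q * r) = 0.
  by apply: pint_sqr_eq0; apply: H sr.
elim: k q => [|k IH] q kK sq.
  by move: sq; rewrite leqn0 size_poly_eq0 => /eqP ->; rewrite mul0r linear0.
pose c := q`_k / lead_coef (L k).
have Lk : (L k)`_k = lead_coef (L k) by rewrite lead_coefE size_legendre.
have -> : q * r = (q - c *: L k) * r + c *: (L k * r).
  by rewrite mulrBl scalerAl subrK.
rewrite pintD pintZ rL // mulr0 addr0 IH // ?(ltnW kK) //.
apply/leq_sizeP => j kj; rewrite coefB coefZ.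
case: (ltngtP j k) kj => // [jk|->] _.
  by rewrite !nth_default ?mulr0 ?subr0 // ?size_legendre // (leq_trans sq).
by rewrite Lk divfK ?subrr // lead_coef_eq0 -size_poly_eq0 size_legendre.
Qed.

End LegendreExpansion.

Section LGLTheory.
Variable R : realType.
Implicit Types p q : {poly R}.
Local Notation L := (legendre R).

Lemma rolle_roots p (a : R) s : path <%R a s -> all (root p) (a :: s) ->
  exists s', [/\ size s' = size s, sorted <%R s', all (root p^`()) s' &
    all (fun x => a < x < last a s) s'].
Proof.
elim: s a => [|b s IH] a /=; first by exists [::].
move=> /andP[ab bs] /and3P[/rootP ra /rootP rb rs].
have [|s' [ss' so' r' i']] := IH b bs; first by rewrite /= rs andbT; apply/rootP.
have [c cin c0] := poly_rolle ab (etrans ra (esym rb)).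
move: cin; rewrite in_itv /= => /andP[ac cb].
have bl : b <= last b s.
  case/lastP: (s) bs => [|s1 d] //; rewrite last_rcons.
  rewrite path_sortedE ?all_rcons; last exact: lt_trans.
  by move=> /andP[/andP[/ltW]].
exists (c :: s'); split => //=; first by rewrite ss'.
- rewrite path_sortedE ?so' ?andbT; last exact: lt_trans.
  by apply: sub_all i' => x /andP[bx _]; exact: lt_trans cb bx.
- by rewrite r' andbT; apply/rootP.
- rewrite ac (lt_le_trans cb bl) /=.
  by apply: sub_all i' => x /andP[bx ->]; rewrite (lt_trans ab bx).
Qed.

(** The derivatives of order less than n vanish at both ends, so that Rolle's
    theorem provides one more interior zero at each differentiation. *)
Lemma rodrigues_roots n k : (k <= n)%N -> exists s : seq R,
  [/\ size s = k, sorted <%R s, all (root (('X^2 - 1) ^+ n)^`(k)) s &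
      all (fun x => -1 < x < 1) s].
Proof.
elim: k => [|k IH] kn; first by exists [::].
have [s [ss so rs ins]] := IH (ltnW kn).
have [||s' [ss' so' rs' ins']] := @rolle_roots (('X^2 - 1) ^+ n)^`(k) (-1) (rcons s 1).
- rewrite rcons_path; apply/andP; split.
    rewrite path_sortedE ?so ?andbT; last exact: lt_trans.
    by apply: sub_all ins => x /andP[].
  case: (lastP s) ins => [_|t x]; first by rewrite /=; lra.
  by rewrite last_rcons all_rcons => /andP[/andP[]].
- rewrite /= all_rcons rs andbT; apply/andP; split; apply/rootP.
    exact: derivn_rod_ltN1.
  exact: derivn_rod_lt1.
exists s'; split => //; first by rewrite ss' size_rcons ss.
by move: ins'; rewrite last_rcons.
Qed.

(** L_(n+1) has n + 1 zeros in (-1, 1), hence its derivative has n zeros there.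
    This is its degree: all its real zeros are in (-1, 1). *)
Lemma deriv_legendre_roots n : exists s : seq R,
  [/\ rootsR (L n.+1)^`() = s, size s = n, sorted <%R s &
      all (fun x => -1 < x < 1) s].
Proof.
have [s0 [ss0 so0 rs0 ins0]] := @rodrigues_roots n.+1 n.+1 (leqnn _).
case: s0 ss0 so0 rs0 ins0 => [//|a s0] [ss0] so0 rs0 ins0.
have [|s [ss so rs ins]] := @rolle_roots (L n.+1) a s0 so0.
  apply: sub_all rs0 => x /rootP rx; apply/rootP.
  by rewrite /legendre hornerZ rx mulr0.
have ins1 : all (fun x => -1 < x < 1) s.
  apply: sub_all ins => x /andP[ax xl].
  have /allP H := ins0.
  have /andP[h1 _] := H a (mem_head _ _); have /andP[_ h2] := H _ (mem_last _ _).
  by rewrite (lt_trans h1 ax) (lt_trans xl h2).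
have p0 : (L n.+1)^`() != 0.
  by rewrite -size_poly_eq0 polyorder.size_deriv size_legendre.
have us : uniq s by apply: sorted_uniq so; [exact: lt_trans | exact: ltxx].
have mems x : root (L n.+1)^`() x -> x \in s.
  move=> rx; apply: contraT => xs.
  have := @max_poly_roots _ (L n.+1)^`() (x :: s) p0.
  rewrite /= rx rs xs us /= polyorder.size_deriv size_legendre ss ss0 ltnn.
  by move=> /(_ isT isT).
exists s; split; rewrite ?ss //.
rewrite -(@rootsRP _ _ (-1) 1).
- apply/esym/roots_uniq => // x; apply/andP/idP => [[_ /mems]//|xs].
  rewrite (allP rs) // in_itv /=; split => //; exact: (allP ins1).
- move=> x; rewrite in_itv /= => x1; apply/negP => /mems /(allP ins1); lra.
- move=> x; rewrite in_itv /= => x1; apply/negP => /mems /(allP ins1); lra.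
Qed.

Variable N : nat.
Hypothesis N0 : (0 < N)%N.
Local Notation t := (@node R N).
Local Notation w := (@weight R N).
Local Notation lam := (N%:R * N.+1%:R : R).

Lemma lgl_nodesP : [/\ size (lgl_nodes R N) = N.+1, sorted <%R (lgl_nodes R N),
  (lgl_nodes R N)`_0 = -1, (lgl_nodes R N)`_N = 1 &
  forall x, x \in lgl_nodes R N -> -1 <= x <= 1].
Proof.
case: N N0 => // n _; rewrite /lgl_nodes.
have [s [-> ss so ins]] := deriv_legendre_roots n.
split => //=.
- by rewrite size_rcons ss.
- rewrite rcons_path; apply/andP; split.
    rewrite path_sortedE ?so ?andbT; last exact: lt_trans.
    by apply: sub_all ins => x /andP[].
  case: (lastP s) ins => [_|r x]; first by rewrite /=; lra.
  by rewrite last_rcons all_rcons => /andP[/andP[]].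
- by rewrite nth_rcons ss ltnn eqxx.
- move=> x; rewrite inE mem_rcons inE => /or3P[/eqP->|/eqP->|/(allP ins)]; lra.
Qed.

Lemma node_inj : injective t.
Proof.
have [ss so _ _ _] := lgl_nodesP.
have us : uniq (lgl_nodes R N) by apply: sorted_uniq so; [exact: lt_trans | exact: ltxx].
move=> i j /eqP; rewrite /node nth_uniq ?ss // => /eqP; exact: val_inj.
Qed.

Lemma node0 : t ord0 = -1.
Proof. by have [_ _ h _ _] := lgl_nodesP. Qed.

Lemma node_max : t ord_max = 1.
Proof. by have [_ _ _ h _] := lgl_nodesP. Qed.

Lemma node_itv k : -1 <= t k <= 1.
Proof. by have [ss _ _ _ h] := lgl_nodesP; apply: h; rewrite mem_nth // ss. Qed.

Lemma deriv_legendre_node k : k != ord0 -> k != ord_max -> (L N)^`().[t k] = 0.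
Proof.
case: N N0 k => // n _ k k0 kn; rewrite /node /lgl_nodes.
have [s [sE ss so ins]] := deriv_legendre_roots n; rewrite sE.
case: k k0 kn => [[|k] kl] //= _; rewrite -val_eqE /= => kn.
have kn' : (k < n)%N by lia.
rewrite nth_rcons ss kn'; apply/rootP.
have p0 : (L n.+1)^`() != 0.
  by rewrite -size_poly_eq0 polyorder.size_deriv size_legendre.
have := roots_on_rootsR p0 (s`_k); rewrite sE mem_nth ?ss //.
Qed.

Lemma ileg_node k : (ileg R N).[t k] = 0.
Proof.
have [->|k0] := eqVneq k ord0; first by rewrite node0 ileg_N1.
have [->|k1] := eqVneq k ord_max; first by rewrite node_max ileg_1.
have := ileg_lam_pt N (t k); rewrite deriv_legendre_node // mulr0.
by move/eqP; rewrite !mulf_eq0 !pnatr_eq0 /= -[_ == 0%N]negbK -lt0n N0 /= => /eqP.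
Qed.

Lemma poly_eq_nodes p q : (size p <= N.+1)%N -> (size q <= N.+1)%N ->
  (forall k, p.[t k] = q.[t k]) -> p = q.
Proof.
move=> sp sq pq; apply/eqP; rewrite -subr_eq0; apply: contraT => r0.
have := @max_poly_roots _ (p - q) [seq t k | k <- enum 'I_N.+1] r0.
rewrite size_map size_enum_ord map_inj_uniq ?enum_uniq; last exact: node_inj.
have sr : (size (p - q)%R <= N.+1)%N.
  by rewrite (leq_trans (size_polyD _ _)) // geq_max sp size_polyN.
rewrite ltnNge sr; apply => //; apply/allP => x /mapP[k _ ->]; apply/rootP.
by rewrite hornerD hornerN pq subrr.
Qed.

(** The Lagrange polynomial of the node t_k, multiplied by L_N(t_k). *)
Definition scofac k : {poly R} := ileg R N %/ ('X - (t k)%:P).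

Lemma scofacE k : ileg R N = scofac k * ('X - (t k)%:P).
Proof. by rewrite divpK // dvdp_XsubCl; apply/rootP; exact: ileg_node. Qed.

Lemma size_ileg : size (ileg R N) = N.+2.
Proof.
have : size (ileg R N)^`() = N.+1 by rewrite deriv_ileg size_legendre.
by rewrite polyorder.size_deriv; case: size => //= k ->.
Qed.

Lemma size_scofac k : size (scofac k) = N.+1.
Proof. by rewrite size_divp ?polyXsubC_eq0 // size_XsubC size_ileg subn1. Qed.

Lemma scofac_neq k i : i != k -> (scofac k).[t i] = 0.
Proof.
move=> ik; have := ileg_node i; rewrite (scofacE k) hornerM hornerXsubC.
move/eqP; rewrite mulf_eq0 subr_eq0 (inj_eq node_inj) (negPf ik) orbF.
by move/eqP.
Qed.

Lemma scofac_deriv k : L N = (scofac k)^`() * ('X - (t k)%:P) + scofac k.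
Proof. by rewrite -deriv_ileg {1}(scofacE k) derivM derivXsubC mulr1. Qed.

Lemma scofac_eq k : (scofac k).[t k] = (L N).[t k].
Proof.
by rewrite (scofac_deriv k) hornerD hornerM hornerXsubC subrr mulr0 add0r.
Qed.

Lemma legendre_node_neq0 k : (L N).[t k] != 0.
Proof.
rewrite -scofac_eq; apply/eqP => s0.
have : scofac k = 0.
  apply: poly_eq_nodes; rewrite ?size_scofac ?size_poly0 // => i.
  by rewrite horner0; have [->|ik] := eqVneq i k; rewrite ?s0 ?scofac_neq.
by move/eqP; rewrite -size_poly_eq0 size_scofac.
Qed.

Lemma scofac_interp p : (size p <= N.+1)%N ->
  p = \sum_k (p.[t k] / (L N).[t k]) *: scofac k.
Proof.
move=> sp; apply: poly_eq_nodes => //.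
  rewrite (leq_trans (size_sum _ _ _)) //; apply/bigmax_leqP => i _.
  by rewrite (leq_trans (size_scale_leq _ _)) // size_scofac.
move=> k; rewrite horner_sum (bigD1 k) //= big1 ?addr0 => [|i ik].
  by rewrite hornerZ scofac_eq divfK // legendre_node_neq0.
by rewrite hornerZ scofac_neq ?mulr0 // eq_sym.
Qed.

Lemma interp_node v k : (@interp R N v).[t k] = v 0 k.
Proof.
rewrite /interp horner_sum (bigD1 k) //= [X in _ + X]big1 ?addr0 => [|i ik].
  rewrite hornerZ horner_prod big1 ?mulr1 // => j jk.
  rewrite hornerZ hornerXsubC mulVf // subr_eq0 (inj_eq node_inj).
  by rewrite eq_sym.
rewrite hornerZ horner_prod (bigD1 k) 1?eq_sym //=.
by rewrite hornerZ hornerXsubC subrr mulr0 mul0r mulr0.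
Qed.

Lemma size_interp v : (size (@interp R N v) <= N.+1)%N.
Proof.
rewrite /interp (leq_trans (size_sum _ _ _)) //; apply/bigmax_leqP => i _.
rewrite (leq_trans (size_scale_leq _ _)) // (leq_trans (size_poly_prod_leq _ _)) //.
rewrite leq_subLR -addSnnS.
have -> : #|[pred j | j != i]| = N by rewrite cardC1 card_ord.
rewrite addSn ltnS (leq_trans (_ : _ <= \sum_(j | j != i) 2)%N) //.
  by apply: leq_sum => j _; rewrite (leq_trans (size_scale_leq _ _)) // size_XsubC.
by rewrite sum_nat_const cardC1 card_ord muln2 addnn.
Qed.

Lemma interp_poly p : (size p <= N.+1)%N -> interp (\row_k p.[t k]) = p.
Proof.
move=> sp; apply: poly_eq_nodes => // [|k]; first exact: size_interp.
by rewrite interp_node mxE.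
Qed.

(** The entries of the differentiation matrix are values of derivatives of
    Lagrange polynomials.  For the diagonal, differentiating
    ileg_N = scofac_k (X - t_k) twice gives L_N'(t_k) = 2 scofac_k'(t_k): this is
    0 at an interior node, and the Legendre equation gives it at the ends. *)
Lemma scofac_deriv_diff i k : (scofac k)^`().[t i] / (L N).[t k] = Defs.diffmx R N i k.
Proof.
rewrite /Defs.diffmx mxE; have Lk := legendre_node_neq0 k.
have [ik|] /= := eqVneq i k; last first.
  move=> ik; have := congr1 (horner^~ (t i)) (scofac_deriv k).
  rewrite hornerD hornerM hornerXsubC (scofac_neq ik) addr0 => ->.
  have tik : t i - t k != 0 by rewrite subr_eq0 (inj_eq node_inj).
  by field; rewrite Lk tik.
rewrite ik; have d2 : (L N)^`().[t k] = 2 * (scofac k)^`().[t k].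
  have := congr1 (fun p => p^`().[t k]) (scofac_deriv k).
  rewrite derivD derivM derivXsubC mulr1 !hornerD hornerM hornerXsubC subrr.
  rewrite mulr0 add0r => ->; ring.
have -> : (scofac k)^`().[t k] = (L N)^`().[t k] / 2 by rewrite d2; field.
case: eqVneq => [k0|k0].
  have := legendre_ode_pt N (-1 : R); rewrite sqrrN expr1n subrr mul0r.
  move: Lk; rewrite k0 node0.
  move: ((L N).[-1]) ((L N)^`().[-1]) => a b a0 h.
  have -> : b = - (N%:R * N.+1%:R / 2) * a by lra.
  by field.
case: eqVneq => [k1|k1].
  have := legendre_ode_pt N (1 : R); rewrite expr1n subrr mul0r.
  move: Lk; rewrite k1 node_max.
  move: ((L N).[1]) ((L N)^`().[1]) => a b a0 h.
  have -> : b = (N%:R * N.+1%:R / 2) * a by lra.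
  by field.
by rewrite deriv_legendre_node // !mul0r.
Qed.

Lemma diffmx_poly p : (size p <= N.+1)%N ->
  Defs.diffmx R N *m (\row_k p.[t k])^T = (\row_k p^`().[t k])^T.
Proof.
move=> sp; apply/matrixP => i j; rewrite !mxE [in RHS](scofac_interp sp).
rewrite linear_sum horner_sum; apply: eq_bigr => k _.
by rewrite /= derivZ hornerZ -scofac_deriv_diff !mxE; ring.
Qed.

Lemma diffmx_interp j (v : 'rV[R]_N.+1) :
  Defs.diffmx R N ^+ j *m v^T = (\row_k (derivn j (interp v)).[t k])^T.
Proof.
elim: j => [|j IH].
  rewrite expr0 mul1mx derivn0; apply/matrixP => i k.
  by rewrite !mxE interp_node (ord1 k).
rewrite exprS -mulmxE -mulmxA IH diffmx_poly ?derivnS // size_derivn.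
by rewrite (leq_trans (leq_subr _ _)) // size_interp.
Qed.

Let W k := pint (scofac k) / (L N).[t k].

(** After division by [ileg N], a combination of L_(N+1) and L_(N-1): the quotient
    has degree at most N - 2, so that it contributes nothing to the integral, and
    the remainder is equal to its interpolant. *)
Lemma quadrature_W p : (size p <= N.*2)%N -> \sum_k p.[t k] * W k = pint p.
Proof.
move=> sp; rewrite (divp_eq p (ileg R N)) pintD.
have -> : pint (p %/ ileg R N * ileg R N) = 0.
  have i0 : ileg R N != 0 by rewrite -size_poly_eq0 size_ileg.
  have sq : (size (p %/ ileg R N)%R <= N.-1)%N by rewrite size_divp // size_ileg leq_subLR (leq_trans sp) // -addnn; lia.
  move: (p %/ ileg R N) sq => q sq.
  rewrite mulrC /ileg -scalerAl pintZ mulrBl pintB !legendre_orth ?subrr ?mulr0 //.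
  by rewrite (leq_trans sq) //; lia.
rewrite add0r.
have sm : (size (p %% ileg R N)%R <= N.+1)%N.
  by rewrite -ltnS -size_ileg ltn_modp -size_poly_eq0 size_ileg.
rewrite [in RHS](scofac_interp sm) linear_sum; apply: eq_bigr => k _.
by rewrite hornerD hornerM ileg_node mulr0 add0r /= pintZ /W; ring.
Qed.

(** Exactness on scofac_i L_N, where scofac_i is L_N / (N + 1) up to lower degree,
    shows that L_N(t_i)^2 W_i is a constant c independent of i.  The constant is
    then computed at the node 1. *)
Lemma WE k : W k = w k.
Proof.
pose c := \sum_k (L N).[t k] ^+ 2 * W k / N.+1%:R.
have Wc i : W i = c / (L N).[t i] ^+ 2.
  have [r [sr rE]] : exists r : {poly R}, (size r <= N)%N /\ scofac i = N.+1%:R^-1 *: L N + r.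
    exists (scofac i - N.+1%:R^-1 *: L N); split; last by rewrite addrC subrK.
    apply/leq_sizeP => j Nj; rewrite coefB coefZ.
    case: (ltngtP j N) Nj => // [Nj|->] _.
      by rewrite !nth_default ?mulr0 ?subr0 ?size_legendre ?size_scofac.
    have -> : (L N)`_N = N.+1%:R * (ileg R N)`_N.+1.
      by rewrite -deriv_ileg coef_deriv mulr_natl.
    rewrite mulKf ?pnatr_eq0 //.
    have := congr1 (fun q : {poly R} => q`_N.+1) (scofacE i).
    rewrite mulrBr coefB coefMX /= coefMC => ->.
    by rewrite [(scofac i)`_N.+1]nth_default ?size_scofac // mul0r subr0 subrr.
  have : \sum_k (scofac i * L N).[t k] * W k = (L N).[t i] ^+ 2 * W i.
    rewrite (bigD1 i) //= big1 ?addr0; first by rewrite hornerM scofac_eq.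
    by move=> j ji; rewrite hornerM scofac_neq // !mul0r.
  have -> : \sum_k (scofac i * L N).[t k] * W k = c.
    have -> : \sum_k (scofac i * L N).[t k] * W k =
        c + \sum_k (r * L N).[t k] * W k.
      rewrite /c -big_split /=; apply: eq_bigr => k0 _.
      rewrite rE; move: (L N) (r) => P Q.
      by rewrite mulrDl -scalerAl hornerD hornerZ !hornerM; ring.
    rewrite quadrature_W; first by rewrite mulrC legendre_orth ?addr0.
    rewrite (leq_trans (size_polyMleq _ _)) // size_legendre; lia.
  by move=> ->; rewrite mulrAC mulfV ?mul1r // expf_neq0 // legendre_node_neq0.
have l0 : lam != 0 by rewrite mulf_neq0 // pnatr_eq0 -lt0n.
have c2 : c = 2 / lam.
  have := Wc ord_max; rewrite node_max legendre1 expr1n divr1 => <-.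
  rewrite /W node_max legendre1 divr1.
  have : lam *: scofac ord_max = ('X + 1) * (L N)^`().
    have h : ('X - 1%:P : {poly R}) != 0 by rewrite polyXsubC_eq0.
    have e := scofacE ord_max; rewrite node_max in e.
    by apply: (mulIf h); rewrite -scalerAl -e ileg_lam polyC1; ring.
  have e1 := legendre1 R N; have e2 : pint (L N) = 0.
    by rewrite -[L N]mulr1 legendre_orth // size_poly1.
  move=> /(congr1 (@pint R)); rewrite pintZ; move: (L N) e1 e2 => P e1 e2.
  rewrite pint_by_parts derivD derivX -polyC1 derivC addr0 mul1r e2.
  rewrite !hornerM !hornerD !hornerX !hornerC e1 addNr mul0r mulr1 !subr0 => h.
  by have -> : 2 = (1 + 1 : R) by []; rewrite -h mulrC mulKf.
by rewrite /weight Wc c2.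
Qed.

Lemma quadrature p : (size p <= N.*2)%N -> \sum_k p.[t k] * w k = pint p.
Proof. by move=> sp; rewrite -quadrature_W //; apply: eq_bigr => k _; rewrite WE. Qed.

Lemma weight_ge0 k : 0 <= w k.
Proof.
by rewrite /weight divr_ge0 ?sqr_ge0 // divr_ge0 // mulr_ge0.
Qed.

Lemma sum_weight : \sum_k w k = 2.
Proof.
have : \sum_k (1 : {poly R}).[t k] * w k = pint 1.
  by rewrite quadrature // size_poly1 -muln2; lia.
under eq_bigr do rewrite hornerC mul1r.
move=> ->; rewrite -derivX pint_deriv !hornerX; ring.
Qed.

(** The sum that defines the spectral coefficient is an exact quadrature. *)
Lemma spectral_coefE (m1 n : nat) (v : 'rV[R]_N.+1) :
  (n + size (derivn m1 (interp v)) <= N.*2)%N ->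
  spectral_coef m1 n v = lcoef n (derivn m1 (interp v)).
Proof.
move=> sz; rewrite /spectral_coef /lcoef; congr (_ * _).
rewrite -quadrature; last first.
  by rewrite (leq_trans (size_polyMleq _ _)) // size_legendre addSn.
by apply: eq_bigr => k _; rewrite diffmx_interp hornerM !mxE; ring.
Qed.

End LGLTheory.

(** * Integration on [-1, 1]: primitives and bounded variation *)

Section Integral.
Variable R : realType.
Implicit Types (f g F G y : R -> R) (a b t : R).
Local Notation mu := (@lebesgue_measure R).

Definition integ f := mu.-integrable `[-1, 1] (EFin \o f).
Definition cont f := {within `[-1, 1], continuous f}.
Definition intg a b f : R := \int[mu]_(t in `[a, b]) f t.

Lemma cont_integ f : cont f -> integ f.
Proof.
by move=> cf; apply: continuous_compact_integrable => //; exact: segment_compact.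
Qed.

Lemma cont_bounded f : cont f ->
  exists2 M : R, 0 < M & forall t : R, -1 <= t <= 1 -> `|f t| <= M.
Proof.
move=> cf; have cnf : cont (fun t => `|f t|).
  by move=> x; apply: continuous_comp; [exact: cf|exact: norm_continuous].
have [|c _ cM] := EVT_max _ cnf; first lra.
exists (`|f c| + 1) => [|t t1]; first by rewrite ltr_wpDl.
have := cM t; rewrite in_itv /= => /(_ t1) h; by rewrite (le_trans h) // lerDl.
Qed.

Lemma cont_cst (c : R) : cont (fun=> c).
Proof. by move=> x; exact: cst_continuous. Qed.

Lemma contD f g : cont f -> cont g -> cont (fun t => f t + g t).
Proof. by move=> cf cg x; apply: continuousD; [exact: cf|exact: cg]. Qed.

Lemma contB f g : cont f -> cont g -> cont (fun t => f t - g t).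
Proof. by move=> cf cg x; apply: continuousB; [exact: cf|exact: cg]. Qed.

Lemma contM f g : cont f -> cont g -> cont (fun t => f t * g t).
Proof. by move=> cf cg x; apply: continuousM; [exact: cf|exact: cg]. Qed.

Lemma cont_norm f : cont f -> cont (fun t => `|f t|).
Proof.
by move=> cf x; apply: continuous_comp; [exact: cf|exact: norm_continuous].
Qed.

Lemma cont_horner (p : {poly R}) : cont (horner p).
Proof. by apply: continuous_subspaceT => x; exact: continuous_horner. Qed.

Lemma integ_meas f : integ f -> measurable_fun (`[-1, 1] : set R) f.
Proof. by move=> /integrableP[/measurable_EFinP]. Qed.

Lemma integD f g : integ f -> integ g -> integ (fun t => f t + g t).
Proof.
by move=> fi gi; exact: (integrableD _ fi gi).
Qed.

Lemma integB f g : integ f -> integ g -> integ (fun t => f t - g t).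
Proof.
by move=> fi gi; exact: (integrableB _ fi gi).
Qed.

Lemma integZ c f : integ f -> integ (fun t => c * f t).
Proof.
by move=> fi; exact: (integrableZl _ c fi).
Qed.

Lemma integ_norm f : integ f -> integ (fun t => `|f t|).
Proof.
by move=> fi; exact: (integrable_abse fi).
Qed.

Lemma integM f g : integ f -> cont g -> integ (fun t => f t * g t).
Proof.
move=> fi cg; have [M M0 gM] := cont_bounded cg.
apply: (integrableMl _ fi (integ_meas (cont_integ cg))) => //.
exists M; split => [|x Mx t /=]; first exact: num_real.
by rewrite in_itv /= => t1; rewrite (le_trans (gM _ t1)) // ltW.
Qed.

Lemma eq_integ f g : (forall t, -1 <= t <= 1 -> f t = g t) -> integ f -> integ g.
Proof.
move=> fg; apply: eq_integrable => // t; rewrite inE /= in_itv /= => t1.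
by rewrite fg.
Qed.

Lemma integ_sub f a b : integ f -> -1 <= a -> b <= 1 ->
  mu.-integrable `[a, b] (EFin \o f).
Proof.
move=> fi a1 b1; apply: integrableS fi => //=.
move=> x /=; rewrite !in_itv /= => /andP[ax xb].
by rewrite (le_trans a1 ax) (le_trans xb b1).
Qed.

Lemma intg_split f a b : integ f -> -1 <= a -> a <= b -> b <= 1 ->
  intg (-1) b f - intg (-1) a f = intg a b f.
Proof.
move=> fi a1 ab b1; rewrite /intg Rintegral_itvB //=.
- rewrite Rintegral_itv_obnd_cbnd //.
  by apply: integrableS (integ_sub fi a1 b1) => //=; apply: subset_itvr; rewrite bnd_simp.
- exact: integ_sub.
Qed.

Section sub.
Variables a b : R.
Hypotheses (a1 : -1 <= a) (b1 : b <= 1).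

Lemma eq_intg f g : (forall t, a <= t <= b -> f t = g t) -> intg a b f = intg a b g.
Proof.
by move=> fg; apply: eq_Rintegral => t; rewrite inE /= in_itv /=; exact: fg.
Qed.

Lemma intgD f g : integ f -> integ g ->
  intg a b (fun t => f t + g t) = intg a b f + intg a b g.
Proof. by move=> fi gi; rewrite /intg RintegralD //; apply: integ_sub. Qed.

Lemma intgB f g : integ f -> integ g ->
  intg a b (fun t => f t - g t) = intg a b f - intg a b g.
Proof. by move=> fi gi; rewrite /intg RintegralB //; apply: integ_sub. Qed.

Lemma intgZ c f : integ f -> intg a b (fun t => c * f t) = c * intg a b f.
Proof. by move=> fi; rewrite /intg RintegralZl //; apply: integ_sub. Qed.

Lemma intg_cst (c : R) : a <= b -> intg a b (fun=> c) = c * (b - a).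
Proof.
move=> ab; rewrite /intg Rintegral_cst //= lebesgue_measure_itv /= lte_fin.
case: ltP => // ba; have -> : a = b by apply/eqP; rewrite eq_le ab.
by rewrite subrr.
Qed.

Lemma le_intg f g : integ f -> integ g -> (forall t, a <= t <= b -> f t <= g t) ->
  intg a b f <= intg a b g.
Proof.
move=> fi gi fg; apply: le_Rintegral => //; exact: integ_sub.
Qed.

Lemma intg_ge0 f : (forall t, a <= t <= b -> 0 <= f t) -> 0 <= intg a b f.
Proof.
by move=> f0; apply: Rintegral_ge0 => t /=; rewrite in_itv /=; exact: f0.
Qed.

Lemma intg_norm f : integ f -> `|intg a b f| <= intg a b (fun t => `|f t|).
Proof. by move=> fi; apply: le_normr_Rintegral => //; exact: integ_sub. Qed.

Lemma intg_bound f M : integ f -> a <= b -> (forall t, a <= t <= b -> `|f t| <= M) ->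
  `|intg a b f| <= M * (b - a).
Proof.
move=> fi ab fM; apply: le_trans (intg_norm fi) _.
rewrite -intg_cst //; apply: le_intg => //; first exact: integ_norm.
exact/cont_integ/cont_cst.
Qed.

End sub.

Lemma intg_bound2 f M : integ f -> (forall t, -1 <= t <= 1 -> `|f t| <= M) ->
  `|intg (-1) 1 f| <= M * 2.
Proof.
move=> fi fM; have -> : 2 = 1 - (-1) :> R by ring.
by apply: intg_bound => //; lra.
Qed.

(** Absolutely continuous functions with their density: the common form of
    polynomials and their derivatives, of test functions, and of functions with
    an integrable weak derivative. *)
Definition primitive F f := integ f /\
  forall t, -1 <= t <= 1 -> F t = F (-1) + intg (-1) t f.

Lemma intg_xx f a : intg a a f = 0.
Proof. by rewrite /intg set_itv1 Rintegral_set1. Qed.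

Lemma primitive_intg f c : integ f -> primitive (fun t => c + intg (-1) t f) f.
Proof. by move=> fi; split => // t _; rewrite intg_xx addr0. Qed.

Lemma primitive_sub F f a b : primitive F f -> -1 <= a -> a <= b -> b <= 1 ->
  F b - F a = intg a b f.
Proof.
move=> [fi FE] a1 ab b1; rewrite (FE b) ?(FE a); try (apply/andP; split; lra).
by rewrite opprD addrACA subrr add0r intg_split.
Qed.

Lemma primitive_cont F f : primitive F f -> cont F.
Proof.
move=> [fi FE].
have h : cont (fun t => F (-1) + intg (-1) t f).
  apply: contD; first exact: cont_cst.
  by apply: parameterized_integral_continuous => //; lra.
move: h; apply: subspace_eq_continuous => t; rewrite inE /= in_itv /= => t1.
exact/esym/FE.
Qed.

Lemma eq_cont f g : (forall t, -1 <= t <= 1 -> f t = g t) -> cont f -> cont g.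
Proof.
move=> fg; apply: subspace_eq_continuous => t; rewrite inE /= in_itv /= => t1.
exact: fg.
Qed.

Lemma primitiveD F f G g : primitive F f -> primitive G g ->
  primitive (fun t => F t + G t) (fun t => f t + g t).
Proof.
move=> [fi FE] [gi GE]; split => [|t t1]; first exact: integD.
by rewrite FE // GE // intgD //; [ring | lra].
Qed.

Lemma primitiveB F f G g : primitive F f -> primitive G g ->
  primitive (fun t => F t - G t) (fun t => f t - g t).
Proof.
move=> [fi FE] [gi GE]; split => [|t t1]; first exact: integB.
by rewrite FE // GE // intgB //; [ring | lra].
Qed.

Lemma eq_primitive F f G g : (forall t, -1 <= t <= 1 -> F t = G t) ->
  (forall t, -1 <= t <= 1 -> f t = g t) -> primitive F f -> primitive G g.
Proof.
move=> FG fg [fi FE]; split => [|t t1]; first exact: eq_integ fg fi.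
have m1 : -1 <= (-1 : R) <= 1 by lra.
rewrite -(FG _ t1) -(FG _ m1) (FE _ t1).
by congr (_ + _); apply: eq_intg => s st; apply: fg; lra.
Qed.

(** Halving an interval halves the coefficient K of the second-order term, which
    disappears in the limit.  This replaces Stieltjes integrals and Fubini's
    theorem in the two integrations by parts below. *)
Lemma bisection (e w : R -> R) (S K : R) :
  (forall a b, -1 <= a -> a <= b -> b <= 1 ->
     `|e b - e a| <= (w b - w a) * (S + K * (b - a))) ->
  `|e 1 - e (-1)| <= (w 1 - w (-1)) * S.
Proof.
move=> H.
have Hn n a b : -1 <= a -> a <= b -> b <= 1 ->
    `|e b - e a| <= (w b - w a) * (S + K * (b - a) / 2 ^+ n).
  elim: n a b => [|n IH] a b a1 ab b1; first by rewrite expr0 divr1 H.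
  pose c := (a + b) / 2.
  have -> : e b - e a = (e b - e c) + (e c - e a) by ring.
  apply: le_trans (ler_normD _ _) _.
  have h1 := IH c b; have h2 := IH a c.
  apply: le_trans (lerD (h1 _ _ _) (h2 _ _ _)) _; rewrite /c; try lra.
  rewrite exprS invfM.
  have -> : b - (a + b) / 2 = (b - a) / 2 by lra.
  have -> : (a + b) / 2 - a = (b - a) / 2 by lra.
  rewrite -mulrDl (_ : K * ((b - a) / 2) / 2 ^+ n = K * (b - a) * (2^-1 / 2 ^+ n)).
    by rewrite (_ : _ - _ + _ = w b - w a) //; ring.
  by rewrite !mulrA.
apply/ler_addgt0Pr => eps eps0.
pose d := (w 1 - w (-1)) * (K * 2).
pose n := Num.bound (`|d| / eps).
have dn : d / 2 ^+ n <= eps.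
  rewrite ler_pdivrMr ?exprn_gt0 // (le_trans (ler_norm d)) // mulrC.
  rewrite -ler_pdivrMr // (le_trans (ltW (archi_boundP (_ : 0 <= `|d| / eps)))) //.
    by rewrite divr_ge0 // ltW.
  by rewrite -natrX ler_nat ltnW // ltn_expl.
apply: le_trans (Hn n (-1) 1 _ _ _) _; try lra.
have -> : 1 - -1 = 2 :> R by ring.
rewrite mulrDr lerD2l; apply: le_trans dn.
by rewrite /d -!mulrA.
Qed.


(** The increments of int (F g) + int (f G) - F G are of second order, up to the
    measure of density |f|; by [bisection] they add up to zero. *)
Lemma primitive_by_parts F f G g : primitive F f -> primitive G g -> cont g ->
  intg (-1) 1 (fun t => F t * g t) =
  F 1 * G 1 - F (-1) * G (-1) - intg (-1) 1 (fun t => f t * G t).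
Proof.
move=> Ff Gg cg.
have cF := primitive_cont Ff; have cG := primitive_cont Gg.
have [fi _] := Ff; have gi := cont_integ cg.
have [M M0 gM] := cont_bounded cg.
have Fgi : integ (fun t => F t * g t).
  by apply: cont_integ; apply: contM.
have fGi : integ (fun t => f t * G t) by apply: integM.
pose e t := intg (-1) t (fun t => F t * g t) + intg (-1) t (fun t => f t * G t) - F t * G t.
pose w t := intg (-1) t (fun t => `|f t|).
have nfi := integ_norm fi.
have wi a b : -1 <= a -> a <= b -> b <= 1 -> w b - w a = intg a b (fun t => `|f t|).
  by move=> *; rewrite /w intg_split.
suff : `|e 1 - e (-1)| <= (w 1 - w (-1)) * 0.
  by rewrite mulr0 normr_le0 /e !intg_xx subr_eq0 => /eqP; lra.
apply: (@bisection _ _ 0 (2 * M)) => a b a1 ab b1; rewrite add0r.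
have cst_i c : integ (fun=> c) by apply/cont_integ/cont_cst.
have Gab s t : a <= s -> s <= t -> t <= b -> `|G t - G s| <= M * (b - a).
  move=> sa st tb; rewrite (primitive_sub Gg) //; try lra.
  apply: le_trans (@intg_bound _ _ _ _ g M _ _ _) _ => //; try lra.
    by move=> r rr; apply: gM; lra.
  by rewrite ler_wpM2l //; [exact: ltW | lra].
have Fab t : a <= t -> t <= b -> `|F t - F a| <= w b - w a.
  move=> at' tb; rewrite (primitive_sub Ff) //; try lra.
  apply: le_trans (intg_norm _ _ _) _ => //; try lra.
  rewrite -wi //; try lra.
  suff : w t <= w b by lra.
  rewrite -subr_ge0 wi //; try lra.
  by apply: intg_ge0 => r _.
have eab : e b - e a = intg a b (fun t => (F t - F a) * g t) +
                      intg a b (fun t => f t * (G t - G b)).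
  transitivity (intg a b (fun t => F t * g t) - F a * intg a b g +
                (intg a b (fun t => f t * G t) - G b * intg a b f)).
    rewrite -(primitive_sub Gg) // -(primitive_sub Ff) //.
    rewrite -(intg_split Fgi) // -(intg_split fGi) // /e; ring.
  congr (_ + _).
    rewrite -intgZ // -intgB //; last exact: integZ.
    by apply: eq_intg => t _; ring.
  rewrite -intgZ // -intgB //; last exact: integZ.
  by apply: eq_intg => t _; ring.
have i1 : integ (fun t => (F t - F a) * g t).
  by apply: cont_integ; apply: contM => //; apply: contB => //; exact: cont_cst.
have i2 : integ (fun t => f t * (G t - G b)).
  by apply: integM => //; apply: contB => //; exact: cont_cst.
rewrite eab; apply: le_trans (ler_normD _ _) _.
have -> : (w b - w a) * (2 * M * (b - a)) =
  ((w b - w a) * M) * (b - a) + (M * (b - a)) * (w b - w a) by ring.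
apply: lerD.
  apply: intg_bound => // t tab; rewrite normrM; apply: ler_pM => //.
    by apply: Fab; lra.
  by apply: gM; lra.
apply: le_trans (intg_norm _ _ _) _ => //.
rewrite wi // -intgZ //; apply: le_intg => //; try exact: integZ; try exact: integ_norm.
move=> t tab; rewrite normrM mulrC; apply: ler_wpM2r => //.
by rewrite distrC; apply: Gab; lra.
Qed.

Lemma primitive_poly (p : {poly R}) : primitive (horner p) (horner p^`()).
Proof.
split; first exact/cont_integ/cont_horner.
move=> t /andP[t1 t2]; have [<-|tN1] := eqVneq (-1) t; first by rewrite intg_xx addr0.
have lt1 : -1 < t by rewrite lt_neqAle tN1.
rewrite /intg /Rintegral (@continuous_FTC2 _ _ (horner p)) //=; first by ring.
- by apply: continuous_subspaceT => x; exact: continuous_horner.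
- split.
  + by move=> x _; exact: derivable_horner.
  + by apply: cvg_at_right_filter; exact: continuous_horner.
  + by apply: cvg_at_left_filter; exact: continuous_horner.
- by move=> x _; rewrite derivE.
Qed.

Lemma intg_poly (p : {poly R}) : intg (-1) 1 (horner p) = pint p.
Proof.
have := primitive_sub (primitive_poly (antid p)).
rewrite deriv_antid => <- //; lra.
Qed.

(** Bounded variation in the form in which it is used; v is the variation of y on
    [-1, t], up to a constant. *)
Definition varby y v := forall s t, -1 <= s -> s <= t -> t <= 1 ->
  `|y t - y s| <= v t - v s.

Lemma bv_varby y : bounded_variation (-1) 1 y ->
  exists v, varby y v.
Proof.
move=> bv; exists (fun t => fine (total_variation (-1) t y)) => s t s1 st t1.
have fin r : -1 <= r -> r <= 1 -> total_variation (-1) r y \is a fin_num.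
  move=> r1 r2; apply/bounded_variationP => //; exact: bounded_variationl bv.
have := total_variationD y s1 st.
have ft := fin t (le_trans s1 st) t1; have fs := fin s s1 (le_trans st t1).
have := total_variation_ge y st.
move: (total_variation s t y) => [r| |] + E; rewrite ?lee_fin; last by [].
  by rewrite E fineD //= => h; lra.
by move: ft; rewrite E; case: (total_variation (-1) s y) fs.
Qed.

Lemma varby_bounded y v : varby y v ->
  forall t, -1 <= t <= 1 -> `|y t| <= `|y (-1)| + (v 1 - v (-1)).
Proof.
move=> yv t t1.
have h1 := yv (-1) t; have h2 := yv t 1.
have h3 : `|y t| <= `|y (-1)| + `|y t - y (-1)|.
  by rewrite -{1}(subrK (y (-1)) (y t)) addrC ler_normD.
have := h1 _ _ _; have := h2 _ _ _.
have : 0 <= `|y 1 - y t| by [].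
lra.
Qed.

Lemma varby_integ y v : varby y v -> measurable_fun (`]-1, 1[ : set R) y -> integ y.
Proof.
move=> yv my; apply: measurable_bounded_integrable => //=.
- by rewrite lebesgue_measure_itv /= lte_fin ifT ?ltry //; lra.
- exact: measurable_fun_itv_cc my.
- exists (`|y (-1)| + (v 1 - v (-1))); split; first exact: num_real.
  move=> M hM t /=; rewrite in_itv /= => t1.
  by rewrite (le_trans (varby_bounded yv t1)) // ltW.
Qed.

(** Formally, int (y g) is the opposite of the integral of G against dy.  The
    increments of int (y g) - y G are estimated on small intervals. *)
Lemma varby_intg_le y v G g S : varby y v -> integ y -> primitive G g -> cont g ->
  G 1 = 0 -> G (-1) = 0 -> (forall t, -1 <= t <= 1 -> `|G t| <= S) ->
  `|intg (-1) 1 (fun t => y t * g t)| <= (v 1 - v (-1)) * S.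
Proof.
move=> yv iy Gg cg G1 GN1 GS; have [M M0 gM] := cont_bounded cg.
have gi := cont_integ cg; have ygi := integM iy cg.
pose e t := intg (-1) t (fun t => y t * g t) - y t * G t.
suff : `|e 1 - e (-1)| <= (v 1 - v (-1)) * S.
  by rewrite /e G1 GN1 intg_xx !mulr0 !subr0.
apply: (@bisection _ _ S M) => a b a1 ab b1.
have -> : e b - e a = intg a b (fun t => (y t - y b) * g t) - (y b - y a) * G a.
  transitivity (intg a b (fun t => y t * g t) - y b * intg a b g - (y b - y a) * G a).
    by rewrite -(primitive_sub Gg) // -(intg_split ygi) // /e; ring.
  congr (_ - _); rewrite -intgZ // -intgB //; last exact: integZ.
  by apply: eq_intg => t _; ring.
apply: le_trans (ler_normB _ _) _; rewrite addrC mulrDr; apply: lerD.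
  by rewrite normrM ler_pM // ?yv // GS //; lra.
rewrite mulrA; apply: intg_bound => //.
  apply: integM => //; apply: integB => //; exact/cont_integ/cont_cst.
move=> t tab; rewrite normrM ler_pM //; last by apply: gM; lra.
rewrite distrC; have := yv t b; have := yv a t; have : 0 <= `|y t - y a| by [].
lra.
Qed.

Lemma cont_unif f : cont f -> forall eps : R, 0 < eps ->
  exists2 del : R, 0 < del & forall s t : R, -1 <= s <= 1 -> -1 <= t <= 1 -> `|s - t| < del -> `|f s - f t| < eps.
Proof.
move=> cf eps eps0.
have e2 : 0 < eps / 2 by rewrite divr_gt0.
pose P (d x : R) := -1 <= x <= 1 ->
  forall t : R, -1 <= t <= 1 -> `|x - t| < d -> `|f x - f t| < eps.
have : \forall d \near (0 : R)^'+, (`[-1, 1] : set R) `<=` P d.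
  have /compact_near_coveringP nc := @segment_compact R (-1) 1.
  apply: nc => x xI.
  have /subspace_continuousP/(_ x xI)/cvgrPdist_lt/(_ _ e2) := cf.
  rewrite near_withinE => /nbhs_ballP[eta /= eta0 H].
  have eta2 : 0 < eta / 2 by rewrite divr_gt0.
  exists (ball x (eta / 2), [set d : R | d < eta / 2]).
    split; first exact: nbhsx_ballx.
    exact: nbhs_right_lt.
  move=> [x' d] /= [bx dd] x'I t tI xt.
  have -> : f x' - f t = (f x - f t) - (f x - f x') by ring.
  rewrite (le_lt_trans (ler_normB _ _)) // (splitr eps) ltrD //.
    apply: (H t) => /=; last by rewrite in_itv.
    rewrite /ball /=; move: bx; rewrite /ball /= => bx.
    have -> : x - t = (x - x') + (x' - t) by ring.
    rewrite (le_lt_trans (ler_normD _ _)) // (splitr eta) ltrD //.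
    exact: lt_trans dd.
  apply: (H x') => /=; last by rewrite in_itv.
  by apply: le_ball bx; rewrite ler_pdivrMr //; lra.
move=> [d /= d0 H]; exists (d / 2); first by rewrite divr_gt0.
move=> s t sI tI st; apply: (H (d / 2)) => //=.
- by rewrite sub0r normrN ger0_norm ?ltr_pdivrMr //; lra.
- by rewrite divr_gt0.
Qed.

Lemma cont_intg_eq0 f : cont f -> (forall t, -1 <= t <= 1 -> 0 <= f t) ->
  intg (-1) 1 f = 0 -> forall t, -1 <= t <= 1 -> f t = 0.
Proof.
move=> cf f0 If0.
have fi := cont_integ cf.
have z a b : -1 <= a -> a <= b -> b <= 1 -> intg a b f = 0.
  move=> a1 ab b1; rewrite -intg_split //.
  have h c : -1 <= c -> c <= 1 -> intg (-1) c f = 0.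
    move=> c1 c2; apply/eqP; rewrite eq_le; apply/andP; split.
      rewrite -If0 -subr_ge0 intg_split //; try lra.
      by apply: intg_ge0 => t tc; apply: f0; lra.
    by apply: intg_ge0 => t tc; apply: f0; lra.
  by rewrite !h ?subrr //; lra.
move=> c cI; apply/eqP; apply: contraT => fc.
have fc0 : 0 < f c by rewrite lt_neqAle eq_sym fc f0.
have fc2 : 0 < f c / 2 by rewrite divr_gt0.
have [d d0 H] := cont_unif cf fc2.
have [a [b [a1 ab b1 Hab]]] : exists a b, [/\ -1 <= a, a < b, b <= 1 &
    forall t, a <= t <= b -> `|t - c| < d].
  case: (lerP c 0) => c0.
    exists c, (Num.min 1 (c + d / 2)); split; try lra.
    - by rewrite lt_min; lra.
    - by rewrite ge_min lexx.
    - by move=> t; rewrite le_min => tt; rewrite ger0_norm; lra.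
  exists (Num.max (-1) (c - d / 2)), c; split; try lra.
  - by rewrite le_max lexx.
  - by rewrite gt_max; lra.
  - by move=> t; rewrite ge_max => tt; rewrite ler0_norm; lra.
have : f c / 2 * (b - a) <= intg a b f.
  rewrite -intg_cst //; last exact: ltW.
  apply: le_intg => //; first exact/cont_integ/cont_cst.
  move=> t tab; have tI : -1 <= t <= 1 by lra.
  by have := H t c tI cI (Hab t tab); rewrite ltr_norml; lra.
rewrite z //; last exact: ltW.
by rewrite pmulr_rle0 //; lra.
Qed.

End Integral.

(** * Polynomial approximation: Weierstrass and Legendre series *)

Section Weierstrass.
Variable R : realType.
Implicit Types (f g h : nat -> R).

(** The expectation of g under the binomial law of parameters n and (1 + t) / 2,
    as a polynomial in t; the recursion conditions on the first trial. *)
Fixpoint bern n g : {poly R} :=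
  if n is n'.+1 then
    (2^-1 *: (1 + 'X)) * bern n' (g \o S) + (2^-1 *: (1 - 'X)) * bern n' g
  else (g 0%N)%:P.

Lemma bernS n g t : (bern n.+1 g).[t] =
  (1 + t) / 2 * (bern n (g \o S)).[t] + (1 - t) / 2 * (bern n g).[t].
Proof.
rewrite /= hornerD !hornerM !hornerZ !hornerD hornerN hornerX -polyC1 !hornerC.
by congr (_ * _ + _ * _); rewrite mulrC.
Qed.

Lemma bernB n g h t : (bern n (fun k => g k - h k)).[t] = (bern n g).[t] - (bern n h).[t].
Proof.
elim: n g h => [|n IH] g h; first by rewrite /= !hornerC.
rewrite !bernS (IH g h) (IH (g \o S) (h \o S)); ring.
Qed.

Lemma bernZ n a g t : (bern n (fun k => a * g k)).[t] = a * (bern n g).[t].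
Proof.
elim: n g => [|n IH] g; first by rewrite /= !hornerC.
rewrite !bernS (IH g) (IH (g \o S)); ring.
Qed.

Lemma bern_cst n a t : (bern n (fun=> a)).[t] = a.
Proof.
elim: n => [|n IH]; first by rewrite /= hornerC.
by rewrite bernS !IH; field.
Qed.

(** Variance plus squared bias. *)
Lemma bern_var n a t : (bern n (fun k => (k%:R - a) ^+ 2)).[t] =
  n%:R * ((1 + t) / 2) * ((1 - t) / 2) + (n%:R * ((1 + t) / 2) - a) ^+ 2.
Proof.
elim: n a => [|n IH] a; first by rewrite /= hornerC; ring.
rewrite bernS IH; have -> : (fun k => (k%:R - a) ^+ 2) \o S =
    fun k => (k%:R - (a - 1)) ^+ 2.
  by apply/funext => k /=; rewrite -(natr1 k); congr (_ ^+ 2); ring.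
by rewrite !IH -(natr1 n); move: (n%:R : R) => N; field.
Qed.

Lemma bern_norm n g h t : -1 <= t <= 1 -> (forall k, `|g k| <= h k) ->
  `|(bern n g).[t]| <= (bern n h).[t].
Proof.
move=> t1 gh; elim: n g h gh => [|n IH] g h gh; first by rewrite /= !hornerC.
rewrite !bernS (le_trans (ler_normD _ _)) // (normrM ((1 + t) / 2)) (normrM ((1 - t) / 2)).
rewrite [`|(1 + t) / 2|]ger0_norm; last lra.
rewrite [`|(1 - t) / 2|]ger0_norm; last lra.
apply: lerD; apply: ler_wpM2l; [lra| |lra|exact: IH].
by apply: IH => k; exact: gh.
Qed.

(** Bernstein's proof: by uniform continuity and boundedness,
    |f s - f t| <= eps / 2 + K (s - t)^2, and the expectation of the square is the
    variance, of order 1/n. *)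
Lemma weierstrass (f : R -> R) (eps : R) : cont f -> 0 < eps ->
  exists p : {poly R}, forall t, -1 <= t <= 1 -> `|f t - p.[t]| <= eps.
Proof.
move=> cf eps0; have [M M0 fM] := cont_bounded cf.
have e2 : 0 < eps / 2 by rewrite divr_gt0.
have [d d0 Hd] := cont_unif cf e2.
pose K : R := 2 * M / d ^+ 2.
have K0 : 0 < K by rewrite divr_gt0 ?exprn_gt0 ?mulr_gt0.
have fK (s t : R) : -1 <= s <= 1 -> -1 <= t <= 1 ->
    `|f s - f t| <= eps / 2 + K * (s - t) ^+ 2.
  move=> sI tI; case: (ltrP `|s - t| d) => st.
    by rewrite (le_trans (ltW (Hd s t sI tI st))) // lerDl mulr_ge0 ?sqr_ge0 // ltW.
  have h1 : 1 <= (s - t) ^+ 2 / d ^+ 2.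
    rewrite ler_pdivlMr ?exprn_gt0 // mul1r -[leRHS]real_normK ?num_real //.
    by rewrite ler_pXn2r ?nnegrE // ltW.
  have h2 : `|f s - f t| <= 2 * M.
    rewrite (le_trans (ler_normB _ _)) //; have := fM s sI; have := fM t tI; lra.
  have : 2 * M <= K * (s - t) ^+ 2.
    rewrite /K mulrAC -mulrA -[leLHS]mulr1 ler_pM2l //; lra.
  lra.
pose n := (Num.bound (2 * K / eps)).+1.
have Kn : K / n%:R <= eps / 2.
  rewrite ler_pdivrMr ?ltr0n // mulrC -ler_pdivrMr ?divr_gt0 //.
  rewrite (le_trans (_ : _ <= (Num.bound (2 * K / eps))%:R)) ?ler_nat //.
  rewrite ltW // (le_lt_trans _ (archi_boundP _)) //; first by rewrite invf_div mulrA [2 * K]mulrC.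
  by apply/divr_ge0/ltW => //; apply/mulr_ge0/ltW.
pose g k : R := f (Num.min 1 (2 * k%:R / n%:R - 1)).
exists (bern n g) => t tI.
have n0 : 0 < n%:R :> R by rewrite ltr0n.
rewrite -{1}(bern_cst n (f t) t) -bernB.
apply: le_trans (bern_norm n tI (h := fun k => eps / 2 + K * (4 / n%:R ^+ 2) * (k%:R - n%:R * ((1 + t) / 2)) ^+ 2) _) _.
  move=> k; rewrite /g; set s := 2 * k%:R / n%:R - 1.
  have kI : -1 <= s.
    by rewrite /s lerBrDl subrr divr_ge0 ?mulr_ge0.
  have sI : -1 <= Num.min 1 s <= 1.
    by rewrite le_min ge_min kI lexx /= andbT; lra.
  apply: le_trans (fK t _ tI sI) _; rewrite lerD2l -mulrA ler_pM2l //.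
  have -> : 4 / n%:R ^+ 2 * (k%:R - n%:R * ((1 + t) / 2)) ^+ 2 = (t - s) ^+ 2.
    by rewrite /s; field; rewrite lt0r_neq0.
  by case: (lerP 1 s) => // s1; nra.
have -> : (bern n (fun k => eps / 2 + K * (4 / n%:R ^+ 2) * (k%:R - n%:R * ((1 + t) / 2)) ^+ 2)).[t]
   = eps / 2 + K / n%:R * ((1 + t) * (1 - t)).
  have -> : (fun k => eps / 2 + K * (4 / n%:R ^+ 2) * (k%:R - n%:R * ((1 + t) / 2)) ^+ 2)
    = (fun k => eps / 2 - (- (K * (4 / n%:R ^+ 2)) * (k%:R - n%:R * ((1 + t) / 2)) ^+ 2)).
    by apply/funext => k; rewrite mulNr opprK.
  rewrite bernB bern_cst bernZ bern_var; field; by rewrite lt0r_neq0.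
rewrite [leRHS]splitr lerD2l (le_trans _ Kn) //.
rewrite -[leRHS]mulr1 ler_wpM2l ?divr_ge0 ?(ltW K0) //; nra.
Qed.

End Weierstrass.

Section LegendreSeries.
Variable R : realType.
Implicit Types (f F Y y : R -> R).
Local Notation L := (legendre R).

Definition lmom n f : R := intg (-1) 1 (fun t => f t * (L n).[t]).

(** The Legendre moments of f are O(n^(-k - 1/2)). *)
Definition decay k f := exists C : R, forall n, (0 < n)%N ->
  `|lmom n f| * n%:R ^+ k * Num.sqrt n%:R <= C.

Lemma horner_ileg n t :
  (ileg R n).[t] = (2 * n%:R + 1)^-1 * ((L n.+1).[t] - (L n.-1).[t]).
Proof. by rewrite /ileg hornerZ hornerD hornerN. Qed.

(** By parts, since the antiderivative of L_n is a combination of L_(n+1) and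
    L_(n-1). *)
Lemma lmom_primitive F f n : primitive F f -> (0 < n)%N ->
  lmom n F = (2 * n%:R + 1)^-1 * (lmom n.-1 f - lmom n.+1 f).
Proof.
move=> Ff n0; have [fi _] := Ff.
have Gg := primitive_poly (ileg R n); rewrite deriv_ileg in Gg.
rewrite /lmom (primitive_by_parts Ff Gg (@cont_horner _ _)).
rewrite ileg_1 ileg_N1 // !mulr0 subrr sub0r.
have i k : integ (fun t => f t * (L k).[t]) by apply: integM => //; exact: cont_horner.
rewrite -intgB // -intgZ //; last exact: integB.
rewrite -[LHS]mulN1r -intgZ //; last by apply: integM => //; exact: cont_horner.
apply: eq_intg => t _; rewrite horner_ileg; ring.
Qed.

Lemma decay_primitive k F f : primitive F f -> decay k f -> decay k.+1 F.
Proof.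
move=> Ff [C HC].
have C0 : 0 <= C by apply: le_trans (HC 1%N isT); rewrite !mulr_ge0 ?exprn_ge0 ?sqrtr_ge0.
exists (Num.max (`|lmom 1 F|) (C + 2 ^+ k.+1 * C)) => -[//|[_|n _]].
  by rewrite expr1n sqrtr1 !mulr1 le_max lexx.
rewrite le_max; apply/orP; right.
rewrite (lmom_primitive Ff) // normrM ger0_norm; last first.
  by rewrite invr_ge0 addr_ge0 ?mulr_ge0.
set N := n.+2; have N0 : 0 < N%:R :> R by rewrite ltr0n.
have h1 := HC n.+3 isT; have h2 := HC n.+1 isT.
have s1 : Num.sqrt N%:R <= Num.sqrt n.+3%:R :> R by rewrite ler_sqrt ?ltr0n // ler_nat.
have p1 : N%:R ^+ k <= n.+3%:R ^+ k :> R.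
  by apply: lerXn2r; rewrite ?nnegrE ?ler0n ?ler_nat.
have nn : N%:R <= 2 * n.+1%:R :> R by rewrite -natrM ler_nat /N mul2n -addnn; lia.
have s2 : Num.sqrt N%:R <= 2 * Num.sqrt n.+1%:R :> R.
  rewrite -[leRHS]ger0_norm ?mulr_ge0 ?sqrtr_ge0 // -sqrtr_sqr ler_sqrt ?sqr_ge0 //.
  rewrite exprMn sqr_sqrtr ?ler0n // (le_trans nn) // ler_wpM2r ?ler0n //; lra.
have p2 : N%:R ^+ k <= 2 ^+ k * n.+1%:R ^+ k :> R.
  by rewrite -exprMn; apply: lerXn2r; rewrite ?nnegrE ?mulr_ge0 ?ler0n.
have b1 : `|lmom n.+3 f| * (N%:R ^+ k * Num.sqrt N%:R) <= C.
  apply: le_trans h1; rewrite -[leRHS]mulrA ler_wpM2l //.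
  by rewrite ler_pM ?exprn_ge0 ?sqrtr_ge0.
have b2 : `|lmom n.+1 f| * (N%:R ^+ k * Num.sqrt N%:R) <= 2 ^+ k.+1 * C.
  apply: (@le_trans _ _ (`|lmom n.+1 f| * ((2 ^+ k * n.+1%:R ^+ k) * (2 * Num.sqrt n.+1%:R)))).
    by rewrite ler_wpM2l // ler_pM ?exprn_ge0 ?sqrtr_ge0.
  rewrite exprS [leLHS](_ : _ = 2 * 2 ^+ k * (`|lmom n.+1 f| * n.+1%:R ^+ k * Num.sqrt n.+1%:R)); last by ring.
  by rewrite ler_wpM2l // mulr_ge0 ?exprn_ge0.
rewrite exprS.
have -> : (2 * N%:R + 1)^-1 * `|lmom N.-1 f - lmom N.+1 f| * (N%:R * N%:R ^+ k) * Num.sqrt N%:R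
  = (N%:R / (2 * N%:R + 1)) * (`|lmom N.-1 f - lmom N.+1 f| * (N%:R ^+ k * Num.sqrt N%:R)) by ring.
rewrite -[leRHS]mul1r ler_pM //.
- by clear -N0; rewrite ler_pdivrMr ?mul1r; lra.
apply: le_trans (_ : (`|lmom n.+1 f| + `|lmom n.+3 f|) * (N%:R ^+ k * Num.sqrt N%:R) <= _).
  by rewrite ler_wpM2r ?mulr_ge0 ?exprn_ge0 ?sqrtr_ge0 // ler_normB.
by rewrite mulrDl addrC lerD.
Qed.

(** By parts, against the antiderivative of L_n, whose size is n^(-3/2). *)
Lemma decay_bv y v : varby y v -> integ y -> decay 1 y.
Proof.
move=> yv iy; exists ((v 1 - v (-1)) * Num.sqrt 2) => n n0.
have n0R : 0 < n%:R :> R by rewrite ltr0n.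
have s0 : 0 < Num.sqrt n%:R :> R by rewrite sqrtr_gt0.
have Gg := primitive_poly (ileg R n); rewrite deriv_ileg in Gg.
pose S : R := Num.sqrt 2 / (n%:R * Num.sqrt n%:R).
have := @varby_intg_le _ y v _ _ S yv iy Gg (@cont_horner _ _) (ileg_1 _ _) (ileg_N1 _ n0).
move=> H; rewrite expr1 -mulrA -ler_pdivlMr ?mulr_gt0 // -mulrA; apply: H => t tI.
have S0 : 0 <= S by rewrite /S divr_ge0 ?sqrtr_ge0 ?mulr_ge0 ?(ltW n0R).
rewrite -[leRHS]ger0_norm // -ler_sqr ?nnegrE // -[leLHS]normrX -[leRHS]normrX.
rewrite ger0_norm ?sqr_ge0 // ger0_norm ?sqr_ge0 //.
apply: le_trans (ileg_le n0 tI) _.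
rewrite /S expr_div_n exprMn !sqr_sqrtr ?(ltW n0R) //.
by rewrite [n%:R ^+ 3]exprSr.
Qed.

Definition lser K Y : {poly R} :=
  \sum_(n < K) ((n%:R + 1 / 2) * lmom n Y) *: L n.

Lemma size_lser K Y : (size (lser K Y) <= K)%N.
Proof.
rewrite (leq_trans (size_sum _ _ _)) //; apply/bigmax_leqP => i _.
by rewrite (leq_trans (size_scale_leq _ _)) // size_legendre.
Qed.

Lemma pint_lser K n Y : pint (L n * lser K Y) = if (n < K)%N then lmom n Y else 0.
Proof.
have -> : pint (L n * lser K Y) =
    \sum_(i < K) ((i%:R + 1 / 2) * lmom i Y) * pint (L n * L i).
  rewrite /lser mulr_sumr linear_sum; apply: eq_bigr => i _.
  by rewrite /= -scalerAr pintZ.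
case: ltnP => nK.
  rewrite (bigD1 (Ordinal nK)) //= big1 ?addr0 => [|i ni].
    rewrite legendre_norm; have := two_n1_neq0 R n.
    move: (n%:R : R) (lmom n Y) => a b a0; field; by rewrite a0.
  by rewrite legendre_orth_neq ?mulr0 // eq_sym.
rewrite big1 // => i _; rewrite legendre_orth_neq ?mulr0 //.
by rewrite gtn_eqF // (leq_trans (ltn_ord i)).
Qed.

Lemma lcoef_lser K n Y : (n < K)%N -> lcoef n (lser K Y) = (n%:R + 1 / 2) * lmom n Y.
Proof. by move=> nK; rewrite /lcoef pint_lser nK. Qed.

Lemma lser_orth K Y (q : {poly R}) : cont Y -> (size q <= K)%N ->
  intg (-1) 1 (fun t => (Y t - (lser K Y).[t]) * q.[t]) = 0.
Proof.
move=> cY sq; pose D t := Y t - (lser K Y).[t].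
have cD : cont D by apply: contB => //; exact: cont_horner.
have Di (p : {poly R}) : integ (fun t => D t * p.[t]).
  by apply: integM; [exact: cont_integ | exact: cont_horner].
have lin c (p1 p2 : {poly R}) : intg (-1) 1 (fun t => D t * (c *: p1 + p2).[t]) =
    c * intg (-1) 1 (fun t => D t * p1.[t]) + intg (-1) 1 (fun t => D t * p2.[t]).
  rewrite -intgZ // -intgD //; last exact: integZ.
  by apply: eq_intg => t _; rewrite hornerD hornerZ; ring.
have zero : intg (-1) 1 (fun t => D t * (0 : {poly R}).[t]) = 0.
  have := lin (-1) 0 0; rewrite scaler0 addr0; lra.
have DL n : (n < K)%N -> intg (-1) 1 (fun t => D t * (L n).[t]) = 0.
  move=> nK; have -> : intg (-1) 1 (fun t => D t * (L n).[t]) =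
      lmom n Y - intg (-1) 1 (horner (L n * lser K Y)).
    rewrite /lmom -intgB //; last 2 first.
    - by apply: integM; [exact: cont_integ | exact: cont_horner].
    - exact/cont_integ/cont_horner.
    by apply: eq_intg => t _; rewrite hornerM /D; ring.
  by rewrite intg_poly pint_lser nK subrr.
rewrite (legendre_expansion sq).
elim/big_rec: _ => [|i p _ IH]; first exact: zero.
by rewrite lin IH DL // mulr0 addr0.
Qed.

Section Convergence.
Variables (Y : R -> R) (k : nat) (C : R).
Hypothesis cY : cont Y.
Hypothesis HC : forall n, (0 < n)%N ->
  `|lmom n Y| * n%:R ^+ k.+2 * Num.sqrt n%:R <= C.

Let a n : R := (n%:R + 1 / 2) * lmom n Y.
Let tau K : R := 8 * C / (K%:R ^+ k * Num.sqrt K%:R).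

(** A coefficient is of order n^(-k - 3/2); it is compared with the difference of
    two consecutive values of n^(-1/2), so that tails telescope. *)
Lemma lser_coef_le n K : (0 < K)%N -> (K <= n)%N ->
  `|a n| <= 8 * C / K%:R ^+ k * ((Num.sqrt n%:R)^-1 - (Num.sqrt n.+1%:R)^-1).
Proof.
move=> K0 Kn; have n0 : (0 < n)%N by exact: leq_trans Kn.
have := HC n0.
have nR : 1 <= n%:R :> R by rewrite ler1n.
have KR : 1 <= K%:R :> R by rewrite ler1n.
have KnR : K%:R ^+ k <= n%:R ^+ k :> R.
  by apply: lerXn2r; rewrite ?nnegrE ?ler0n ?ler_nat.
have Kk : 0 < K%:R ^+ k :> R by rewrite exprn_gt0 // ltr0n.
have -> : (n.+1%:R : R) = n%:R + 1 by rewrite natr1.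
rewrite /a normrM [`|_ + 1 / 2|]ger0_norm; last by rewrite addr_ge0.
have s0 : 0 < Num.sqrt n%:R :> R by rewrite sqrtr_gt0 ltr0n.
have s1 : 0 < Num.sqrt (n%:R + 1) :> R by rewrite sqrtr_gt0; lra.
have s2 : Num.sqrt n%:R ^+ 2 = n%:R :> R by rewrite sqr_sqrtr ?ler0n.
have s3 : Num.sqrt (n%:R + 1) ^+ 2 = n%:R + 1 :> R by rewrite sqr_sqrtr // addr_ge0.
have l0 : 0 <= `|lmom n Y| by [].
rewrite [n%:R ^+ k.+2]exprS [n%:R ^+ k.+1]exprS.
move: l0 nR KnR Kk s0 s1 s2 s3.
move: (n%:R : R) (`|lmom n Y| : R) (n%:R ^+ k) (K%:R ^+ k) => N l Nk Kk.
move: (Num.sqrt N : R) (Num.sqrt (N + 1) : R) => s s'.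
clear => l0 N1 KN Kk0 s0 s1 s2 s3 HC.
pose d := s^-1 - s'^-1.
have ss : s < s' by rewrite -ltr_sqr ?nnegrE ?(ltW s0) ?(ltW s1) // s2 s3; lra.
have s32 : s' <= 3 / 2 * s.
  have h : 0 <= 3 / 2 * s by lra.
  by rewrite -ler_sqr ?nnegrE ?(ltW s1) // exprMn s2 s3; lra.
have d0 : 0 <= d by rewrite subr_ge0 lef_pV2 ?posrE // ltW.
have Nsd : 1 <= 4 * (N * s * d).
  have -> : N * s * d = N / (s' * (s' + s)).
    have e1 : (s' - s) * (s' + s) = 1 by nra.
    rewrite /d -[N in RHS]mulr1 -e1; field; apply/and3P; split; lra.
  rewrite mulrA ler_pdivlMr ?mul1r ?mulr_gt0 //; last lra.
  nra.
have lNs : 0 <= l * N ^+ 2 * s.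
  by apply: mulr_ge0 (ltW s0); apply: mulr_ge0 => //; exact: sqr_ge0.
have lC : l * N ^+ 2 * s <= C / Kk.
  rewrite ler_pdivlMr // (le_trans _ HC) //.
  have -> : l * (N * (N * Nk)) * s = l * N ^+ 2 * s * Nk by ring.
  by rewrite ler_wpM2l.
have h1 : (N + 1 / 2) * l <= (3 / 2 * N * l) * (4 * (N * s * d)).
  apply: (@le_trans _ _ (3 / 2 * N * l)); first by rewrite ler_wpM2r //; lra.
  by rewrite -[leLHS]mulr1 ler_wpM2l //; nra.
apply: le_trans h1 _.
have -> : (3 / 2 * N * l) * (4 * (N * s * d)) = 6 * (l * N ^+ 2 * s) * d.
  by move: (d) => e; field.
rewrite ler_wpM2r // (@le_trans _ _ (6 * (C / Kk))) ?ler_wpM2l //.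
have := le_trans lNs lC.
by rewrite -mulrA; lra.
Qed.

Lemma lser_tail K K' : (0 < K)%N -> (K <= K')%N ->
  \sum_(K <= n < K') `|a n| <= tau K.
Proof.
move=> K0 KK'; have C0 : 0 <= C.
  by apply: le_trans (HC (n := 1) isT); apply: mulr_ge0 (sqrtr_ge0 _); apply: mulr_ge0 => //; exact: exprn_ge0.
apply: le_trans (_ : \sum_(K <= n < K') 8 * C / K%:R ^+ k *
    ((Num.sqrt n%:R)^-1 - (Num.sqrt n.+1%:R)^-1) <= _).
  by rewrite ler_sum_nat // => n /andP[Kn _]; exact: lser_coef_le.
rewrite -mulr_sumr (@telescope_sumr_eq _ _ _ (fun n => - (Num.sqrt n%:R)^-1)) //; last first.
  by move=> n _; rewrite opprK addrC.
rewrite opprK /tau invfM mulrA ler_wpM2l //.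
  by rewrite divr_ge0 ?mulr_ge0 ?exprn_ge0.
by rewrite gerDr oppr_le0 invr_ge0 sqrtr_ge0.
Qed.

Lemma lser_nat K : lser K Y = \sum_(0 <= n < K) a n *: L n.
Proof. by rewrite big_mkord. Qed.

Lemma lser_cauchy K K' t : (0 < K)%N -> (K <= K')%N -> -1 <= t <= 1 ->
  `|(lser K' Y).[t] - (lser K Y).[t]| <= tau K.
Proof.
move=> K0 KK' tI; rewrite !lser_nat (@big_cat_nat _ _ _ K) //= hornerD addrAC subrr add0r.
rewrite horner_sum (le_trans (ler_norm_sum _ _ _)) // (le_trans _ (lser_tail K0 KK')) //.
apply: ler_sum => n _; rewrite hornerZ normrM -[leRHS]mulr1 ler_wpM2l //.
exact: legendre_le1.
Qed.

Lemma lser_bounded : exists2 B : R, 0 < B & forall K t, (0 < K)%N -> -1 <= t <= 1 ->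
  `|Y t - (lser K Y).[t]| <= B.
Proof.
have [M M0 YM] := cont_bounded cY.
exists (M + `|a 0%N| + tau 1 + 1).
  have : 0 <= tau 1 by apply: le_trans (lser_tail (K := 1) (K' := 1) isT isT); rewrite big_geq.
  have : 0 <= `|a 0%N| by [].
  lra.
move=> K t K0 tI; have h1 := lser_cauchy (K := 1) (K' := K) isT K0 tI.
have h2 := YM t tI.
have e1 : (lser 1 Y).[t] = a 0%N.
  by rewrite /lser big_ord1 legendre0 hornerZ hornerC mulr1.
have -> : Y t - (lser K Y).[t] = Y t - (lser 1 Y).[t] - ((lser K Y).[t] - (lser 1 Y).[t]) by ring.
rewrite (le_trans (ler_normB _ _)) //.
have := ler_normB (Y t) (lser 1 Y).[t]; rewrite e1; rewrite e1 in h1.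
lra.
Qed.

(** The error is orthogonal to polynomials of degree less than K, among which is
    one that is uniformly close to Y. *)
Lemma lser_mean eps : 0 < eps -> exists K0, forall K, (K0 <= K)%N ->
  intg (-1) 1 (fun t => (Y t - (lser K Y).[t]) ^+ 2) <= eps.
Proof.
move=> eps0; have [B B0 HB] := lser_bounded.
have e0 : 0 < eps / (2 * B) by rewrite divr_gt0 // mulr_gt0.
have [p Hp] := weierstrass cY e0.
exists (size p).+1 => K sK; have K0 : (0 < K)%N by exact: leq_trans sK.
have spl : (size (p - lser K Y)%R <= K)%N.
  by rewrite (leq_trans (size_polyD _ _)) // geq_max size_polyN size_lser (ltnW sK).
have := lser_orth cY spl.
set D := fun t => Y t - (lser K Y).[t].
have cD : cont D by apply: contB => //; exact: cont_horner.
have cE : cont (fun t => Y t - p.[t]) by apply: contB => //; exact: cont_horner.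
move=> orth.
have -> : intg (-1) 1 (fun t => D t ^+ 2) = intg (-1) 1 (fun t => D t * (Y t - p.[t])).
  rewrite -[RHS]addr0 -orth -intgD //; last 2 first.
  - by apply: cont_integ; apply: contM.
  - by apply: cont_integ; apply: contM => //; exact: cont_horner.
  by apply: eq_intg => t _; rewrite /D hornerD hornerN; ring.
apply: le_trans (ler_norm _) _.
apply: le_trans (@intg_bound2 _ _ (B * (eps / (2 * B))) _ _) _.
- by apply: cont_integ; apply: contM.
- by move=> t tI; rewrite normrM ler_pM ?HB ?Hp.
- by rewrite [leLHS](_ : _ = eps) //; field; rewrite lt0r_neq0.
Qed.

(** The partial sums of order at least K are within tau K of S_K, so the positive
    part of |Y - S_K| - tau K is at most |Y - S_K'| for all K' >= K.  The latter
    tends to zero in mean square, hence this positive part vanishes almost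
    everywhere, and everywhere by continuity. *)
Lemma lser_unif K t : (0 < K)%N -> -1 <= t <= 1 -> `|Y t - (lser K Y).[t]| <= tau K.
Proof.
move=> K0.
pose D (s : R) : R := `|Y s - (lser K Y).[s]| - tau K.
pose h (s : R) : R := D s + `|D s|.
have cD : cont D.
  by apply: contB; [apply/cont_norm/contB => //; exact: cont_horner | exact: cont_cst].
have ch : cont h by apply: contD => //; exact: cont_norm.
have ch2 : cont (fun s => h s * h s) by exact: contM.
have h2_0 : intg (-1) 1 (fun s => h s * h s) = 0.
  apply/eqP; rewrite eq_le; apply/andP; split; last first.
    by apply: intg_ge0 => s _; exact: sqr_ge0.
  apply/ler_addgt0Pr => eps eps0; rewrite add0r.
  have e4 : 0 < eps / 4 by rewrite divr_gt0.
  have [K1 HK1] := lser_mean e4.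
  have := HK1 (maxn K K1) (leq_maxr _ _).
  set K2 := maxn K K1 => HK2.
  have -> : eps = 4 * (eps / 4) by field.
  apply: le_trans (_ : 4 * intg (-1) 1 (fun s => (Y s - (lser K2 Y).[s]) ^+ 2) <= _); last first.
    by rewrite ler_wpM2l.
  have cE : cont (fun s => (Y s - (lser K2 Y).[s]) ^+ 2).
    by apply: contM; apply: contB => //; exact: cont_horner.
  rewrite -intgZ //; last exact: cont_integ.
  apply: le_intg => //; try exact: cont_integ; first by apply: integZ; exact: cont_integ.
  move=> s sI; have h1 := lser_cauchy K0 (leq_maxl K K1 : (K <= K2)%N) sI.
  rewrite -[(_ - _) ^+ 2]real_normK ?num_real //.
  have h3 : D s <= `|Y s - (lser K2 Y).[s]|.
    rewrite /D lerBlDr (le_trans _ (lerD (lexx _) h1)) //.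
    by rewrite (le_trans _ (ler_normD _ _)) // addrA subrK.
  have h4 : 0 <= `|Y s - (lser K2 Y).[s]| by [].
  have [D0|D0] := lerP 0 (D s).
    have -> : h s = 2 * D s by rewrite /h ger0_norm //; ring.
    have -> : 2 * D s * (2 * D s) = 4 * D s ^+ 2 by ring.
    by rewrite ler_wpM2l // ler_pXn2r ?nnegrE.
  have -> : h s = 0 by rewrite /h ltr0_norm // addrN.
  by rewrite mulr0 mulr_ge0 ?sqr_ge0.
move=> tI; have := cont_intg_eq0 ch2 (fun s _ => sqr_ge0 (h s)) h2_0 tI.
move/eqP; rewrite mulf_eq0 orbb => /eqP ht.
rewrite -subr_le0 -/(D t); have [|D0] := lerP (D t) 0; first by [].
by move: ht; rewrite /h gtr0_norm // => ht; lra.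
Qed.

End Convergence.

(** The partial sums of the Legendre series approximate at a rate that beats the
    tolerances, while the sum of their coefficients stays bounded in K, as the
    spectral constraint demands. *)
Lemma legendre_approx Y k : cont Y -> decay k.+2 Y -> exists A B : R, forall K,
  (0 < K)%N -> exists p : {poly R}, [/\ (size p <= K)%N,
    forall t, -1 <= t <= 1 -> `|Y t - p.[t]| <= A / (K%:R ^+ k * Num.sqrt K%:R) &
    \sum_(n < K) `|lcoef n p| <= B].
Proof.
move=> cY [C HC].
exists (8 * C), (`|(0%:R + 1 / 2) * lmom 0 Y| + 8 * C / (1%:R ^+ k * Num.sqrt 1%:R)).
move=> K K0; exists (lser K Y); split.
- exact: size_lser.
- by move=> t tI; exact: lser_unif.
- under eq_bigr => n _ do rewrite lcoef_lser //.
  rewrite -(big_mkord xpredT (fun n => `|(n%:R + 1 / 2) * lmom n Y|)).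
  by rewrite big_ltn // lerD2l; exact: lser_tail.
Qed.

End LegendreSeries.

(** * Test functions *)

Section Bump.
Variable R : realType.
Implicit Types (p q : {poly R}) (s t a eps : R).

(** The family p(1/s) exp(-1/s), extended by 0 to the left of 0, is stable under
    differentiation. *)
Definition flat p s : R := if 0 < s then p.[s^-1] * expR (- s^-1) else 0.

(** [flat (dflat p)] is the derivative of [flat p]. *)
Definition dflat p : {poly R} := 'X^2 * (p - p^`()).

Lemma expR_ge_pow n (x : R) : 0 <= x -> x ^+ n <= n`!%:R * expR x.
Proof.
move=> x0; case: n => [|n].
  rewrite expr0 fact0 mul1r; have := expR_ge1Dx x; lra.
have := expR_ge1Dxn n x0.
have f0 : 0 < (n.+1)`!%:R :> R by rewrite ltr0n fact_gt0.
by move=> h; rewrite mulrC -ler_pdivrMr //; lra.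
Qed.

Lemma poly_le_expR p : exists C : R, forall x, 0 <= x -> `|p.[x]| <= C * expR x.
Proof.
exists (\sum_(i < size p) `|p`_i| * i`!%:R) => x x0.
rewrite horner_coef (le_trans (ler_norm_sum _ _ _)) // mulr_suml.
apply: ler_sum => i _; rewrite normrM -mulrA ler_wpM2l //.
by rewrite ger0_norm ?exprn_ge0 // expR_ge_pow.
Qed.

(** The exponential dominates all polynomials; the quadratic bound gives the
    derivative 0 at the origin. *)
Lemma flat_le p : exists C : R, 0 <= C /\ forall s, `|flat p s| <= C * s ^+ 2.
Proof.
have [C HC] := poly_le_expR ('X^2 * p).
have C0 : 0 <= C.
  by have := le_trans (normr_ge0 _) (HC 0 (lexx _)); rewrite expR0 mulr1.
exists C; split => // s; rewrite /flat; case: ifP => s0; last first.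
  by rewrite normr0 mulr_ge0 ?sqr_ge0.
have si : 0 < s^-1 by rewrite invr_gt0.
have := HC s^-1 (ltW si); rewrite hornerM hornerXn normrM.
rewrite [`|_ ^+ 2|]ger0_norm ?sqr_ge0 // normrM [`|expR _|]ger0_norm ?expR_ge0 //.
rewrite expRN ler_pdivrMr ?expR_gt0 // => h.
rewrite -mulrAC -ler_pdivrMr ?exprn_gt0 // mulrC -exprVn //.
Qed.

Lemma is_derive_flat p s : is_derive s 1 (flat p) (flat (dflat p) s).
Proof.
case: (ltgtP s 0) => s0.
- apply: (@near_eq_is_derive _ _ _ (cst 0)); last first.
    by rewrite /flat ltNge (ltW s0); exact: is_derive_cst.
  by near=> z; rewrite /flat ltNge /= ltW //; near: z; exact: lt_nbhsl.
- have e1 : \forall z \near s, p.[z^-1] * expR (- z^-1) = flat p z.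
    by near=> z; rewrite /flat ifT //; near: z; exact: lt_nbhsr.
  apply: (near_eq_is_derive e1).
  rewrite /flat s0 /dflat hornerM hornerXn hornerD hornerN.
  have sN : s != 0 by rewrite gt_eqF.
  have d1 : is_derive s 1 (fun z : R => z^-1) (- s ^- 2).
    by have := @is_deriveV R id s 1 1 sN (is_derive_id _ _); rewrite scaler1.
  have d2 : is_derive s 1 (horner p \o (fun z : R => z^-1)) (p^`().[s^-1] * (- s ^- 2)).
    exact: is_derive1_comp.
  have d3 : is_derive s 1 (expR \o (fun z : R => - z^-1)) (expR (- s^-1) * (- (- s ^- 2))).
    by apply: is_derive1_comp; apply: is_deriveN.
  apply: is_derive_eq (is_deriveM d2 d3) _.
  by rewrite /GRing.scale /= -exprVn; ring.
- rewrite s0; have [C [C0 HC]] := flat_le p.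
  have -> : flat (dflat p) 0 = 0 by rewrite /flat ltxx.
  have f0 : flat p 0 = 0 by rewrite /flat ltxx.
  apply/is_derive1_caratheodory; exists (fun z => flat p z / z); split.
  + by move=> z; rewrite f0 !subr0; have [->|z0] := eqVneq z 0; rewrite ?f0 ?mulr0 ?divfK.
  + apply/cvgrPdist_le => e e0; rewrite f0 mul0r.
    have d0 : 0 < e / (C + 1) by rewrite divr_gt0 // ltr_wpDl.
    near=> z; rewrite sub0r normrN.
    have zd : `|z| < e / (C + 1).
      near: z; apply/nbhs_ballP; exists (e / (C + 1)) => //= y /=.
      by rewrite /ball /= sub0r normrN.
    have [->|z0] := eqVneq z 0; first by rewrite f0 mul0r normr0 ltW.
    rewrite normrM normfV ler_pdivrMr ?normr_gt0 // (le_trans (HC z)) //.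
    rewrite -[z ^+ 2]real_normK ?num_real // expr2 mulrA ler_wpM2r //.
    rewrite (le_trans (ler_wpM2l C0 (ltW zd))) // mulrCA -[leRHS]mulr1 ler_wpM2l ?(ltW e0) //.
    by rewrite ler_pdivrMr; lra.
  + by rewrite f0 mul0r.
Unshelve. all: by end_near. Qed.

(** Finite sums of products of [flat] functions of the distances to the two ends
    of the interval of center a and radius eps: a space that is stable under
    differentiation. *)
Definition bumps a eps (l : seq ({poly R} * {poly R})) t : R :=
  \sum_(pq <- l) flat pq.1 (eps - (t - a)) * flat pq.2 (eps + (t - a)).

Definition dbumps (l : seq ({poly R} * {poly R})) :=
  flatten [seq [:: (- dflat pq.1, pq.2); (pq.1, dflat pq.2)] | pq <- l].

Lemma flatN p s : flat (- p) s = - flat p s.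
Proof. by rewrite /flat hornerN; case: ifP => _; rewrite ?oppr0 ?mulNr. Qed.

Lemma is_derive_bumps a eps l t :
  is_derive t 1 (bumps a eps l) (bumps a eps (dbumps l) t).
Proof.
elim: l => [|[p q] l IH].
  rewrite /dbumps /= (_ : bumps a eps [::] = cst 0); last first.
    by apply/funext => z; rewrite /bumps big_nil.
  exact: is_derive_cst.
have -> : bumps a eps ((p, q) :: l) =
   ((flat p \o (fun t => eps - (t - a))) * (flat q \o (fun t => eps + (t - a)))) + bumps a eps l.
  by apply/funext => z; rewrite /bumps big_cons.
have -> : bumps a eps (dbumps ((p, q) :: l)) t =
  (flat p (eps - (t - a)) *: (flat (dflat q) (eps + (t - a)) * 1) +
   flat q (eps + (t - a)) *: (flat (dflat p) (eps - (t - a)) * -1)) + bumps a eps (dbumps l) t.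
  rewrite /bumps /dbumps /= !big_cons /= flatN /GRing.scale /=; ring.
have d1 : is_derive t 1 (fun t => eps - (t - a)) (- 1).
  have := is_deriveB (is_derive_cst eps t 1) (is_deriveB (is_derive_id t 1) (is_derive_cst a t 1)).
  by rewrite subr0 sub0r.
have d2 : is_derive t 1 (fun t => eps + (t - a)) 1.
  have := is_deriveD (is_derive_cst eps t 1) (is_deriveB (is_derive_id t 1) (is_derive_cst a t 1)).
  by rewrite subr0 add0r.
apply: is_deriveD; apply: is_deriveM; apply: is_derive1_comp => //; exact: is_derive_flat.
Qed.

Lemma derive1n_bumps a eps n l :
  derive1n n (bumps a eps l) = bumps a eps (iter n dbumps l).
Proof.
elim: n => [//|n IH]; rewrite derive1nS IH iterS; apply/funext => t.
by rewrite derive1E; apply/derive_val/is_derive_bumps.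
Qed.

Definition smooth_bump a eps := bumps a eps [:: (1, 1)].

Lemma smooth_bumpE a eps t : smooth_bump a eps t =
  flat 1 (eps - (t - a)) * flat 1 (eps + (t - a)).
Proof. by rewrite /smooth_bump /bumps big_seq1. Qed.

Lemma flat1_ge0 s : 0 <= flat 1 s.
Proof. by rewrite /flat; case: ifP => // _; rewrite hornerC mul1r expR_ge0. Qed.

Lemma flat1_gt0 s : 0 < s -> 0 < flat 1 s.
Proof. by move=> s0; rewrite /flat s0 hornerC mul1r expR_gt0. Qed.

Lemma smooth_bump_ge0 a eps t : 0 <= smooth_bump a eps t.
Proof. by rewrite smooth_bumpE mulr_ge0 ?flat1_ge0. Qed.

Lemma smooth_bump_gt0 a eps : 0 < eps -> 0 < smooth_bump a eps a.
Proof. by move=> e0; rewrite smooth_bumpE mulr_gt0 // flat1_gt0 // subrr ?subr0 ?addr0. Qed.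

Lemma smooth_bump_out a eps t : eps <= `|t - a| -> smooth_bump a eps t = 0.
Proof.
have f0 s : s <= 0 -> flat 1 s = 0 by rewrite /flat ltNge => ->.
move=> h; have [h1|h1] : eps - (t - a) <= 0 \/ eps + (t - a) <= 0.
- have [ta|ta] := lerP 0 (t - a); [left|right]; move: h.
    by rewrite ger0_norm //; lra.
  by rewrite ltr0_norm //; lra.
- by rewrite smooth_bumpE f0 ?mul0r.
- by rewrite smooth_bumpE (f0 _ h1) mulr0.
Qed.

Lemma test_smooth_bump a eps : `|a| + eps < 1 -> test_function (smooth_bump a eps).
Proof.
move=> ae; split=> [n t|]; last first.
  exists (`|a| + eps) => // t ct; apply: smooth_bump_out.
  have := ler_normD (t - a) a; rewrite subrK; lra.
by rewrite derive1n_bumps; have [] := is_derive_bumps a eps (iter n dbumps [:: (1, 1)]) t.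
Qed.

End Bump.

Section TestFunctions.
Variable R : realType.
Implicit Types (phi psi w x y : R -> R) (p : {poly R}).

Lemma test_zero phi : test_function phi ->
  exists2 c : R, 0 <= c < 1 & forall t, c < `|t| -> phi t = 0.
Proof.
move=> [_ [c c1 h]]; exists (Num.max c 0).
  by rewrite le_max lexx orbT gt_max c1 ltr01.
by move=> t; rewrite gt_max => /andP[/h].
Qed.

Lemma test_ends phi : test_function phi -> phi 1 = 0 /\ phi (-1) = 0.
Proof.
move=> /test_zero[c /andP[_ c1] h].
by split; apply: h; rewrite ?normrN normr1.
Qed.

Lemma test_derivable phi t : test_function phi -> derivable phi t 1.
Proof. by move=> [/(_ 0%N t)]. Qed.

Lemma derive1n_derive1 n phi : derive1n n (derive1 phi) = derive1n n.+1 phi.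
Proof. by rewrite /derive1n -iterSr. Qed.

Lemma derive1_near0 phi t : (\forall z \near t, phi z = 0) -> derivable phi t 1 /\ derive1 phi t = 0.
Proof.
move=> h; have e : \forall z \near t, (cst 0 : R -> R) z = phi z.
  by near=> z; apply/esym; near: z.
have [d v] : is_derive t 1 phi 0 by apply: (near_eq_is_derive e); exact: is_derive_cst.
by split => //; rewrite derive1E v.
Unshelve. all: by end_near. Qed.

Lemma near_gt_norm (c t : R) : c < `|t| -> \forall z \near t, c < `|z|.
Proof.
move=> ct; have := @norm_continuous _ R t.
by move=> /(_ [set r | c < r]); apply; exact: lt_nbhsr.
Qed.

Lemma test_derive1 phi : test_function phi -> test_function (derive1 phi).
Proof.
move=> [d [c c1 h]]; split=> [n t|]; first by rewrite derive1n_derive1; exact: d.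
exists c => // t ct; apply: (derive1_near0 _).2.
by near=> z; apply: h; near: z; exact: near_gt_norm.
Unshelve. all: by end_near. Qed.

Lemma test_derive1n n phi : test_function phi -> test_function (derive1n n phi).
Proof.
by move=> tphi; elim: n => [//|n IH]; rewrite derive1nS; exact: test_derive1.
Qed.

Lemma test_continuous phi : test_function phi -> continuous phi.
Proof.
by move=> tphi t; apply/differentiable_continuous/derivable1_diffP/test_derivable.
Qed.

Lemma test_cont phi : test_function phi -> cont phi.
Proof. by move=> tphi; apply: continuous_subspaceT => t; exact: test_continuous. Qed.

Lemma test_lin phi psi (k : R) : test_function phi -> test_function psi ->
  test_function (fun t => phi t - k * psi t) /\
  forall n, derive1n n (fun t => phi t - k * psi t) =
            (fun t => derive1n n phi t - k * derive1n n psi t).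
Proof.
move=> tphi tpsi.
have H n : derive1n n (fun t => phi t - k * psi t) =
            (fun t => derive1n n phi t - k * derive1n n psi t).
  elim: n => [//|n IH]; rewrite !derive1nS IH; apply/funext => t.
  have d1 := @test_derivable _ t (test_derive1n n tphi).
  have d2 := @test_derivable _ t (test_derive1n n tpsi).
  rewrite derive1E; apply: derive_val.
  have := is_deriveB (derivableP d1) (is_deriveZ k (derivableP d2)).
  by rewrite -!derive1E.
split => //; split => [n t|].
  rewrite H; apply: derivableB; first exact/test_derivable/test_derive1n.
  by apply: derivableZ; exact/test_derivable/test_derive1n.
have [c /andP[_ c1] h] := test_zero tphi; have [c' /andP[_ c'1] h'] := test_zero tpsi.
exists (Num.max c c'); first by rewrite gt_max c1.
by move=> t; rewrite gt_max => /andP[/h -> /h' ->]; rewrite mulr0 subrr.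
Qed.

Lemma primitive_derive1 phi : (forall t, derivable phi t 1) -> continuous (derive1 phi) ->
  primitive phi (derive1 phi).
Proof.
move=> dphi cphi; have cp : continuous phi.
  by move=> t; apply/differentiable_continuous/derivable1_diffP.
split; first by apply: cont_integ; apply: continuous_subspaceT => t; exact: cphi.
move=> t /andP[t1 t2]; have [<-|tN1] := eqVneq (-1) t; first by rewrite intg_xx addr0.
have lt1 : -1 < t by rewrite lt_neqAle tN1.
rewrite /intg /Rintegral (@continuous_FTC2 _ (derive1 phi) phi (-1) t lt1).
- by rewrite -EFinB /= [RHS]addrC subrK.
- by apply: continuous_subspaceT => z; exact: cphi.
- split.
  + by move=> z _; exact: dphi.
  + by apply: cvg_at_right_filter; exact: cp.
  + by apply: cvg_at_left_filter; exact: cp.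
- by [].
Qed.

Lemma primitive_test phi : test_function phi -> primitive phi (derive1 phi).
Proof.
move=> tphi; apply: primitive_derive1 => [t|]; first exact: test_derivable.
exact/test_continuous/test_derive1.
Qed.

Lemma test_by_parts F f phi : primitive F f -> test_function phi ->
  intg (-1) 1 (fun t => F t * derive1 phi t) = - intg (-1) 1 (fun t => f t * phi t).
Proof.
move=> Ff tphi; rewrite (primitive_by_parts Ff (primitive_test tphi)).
  by have [-> ->] := test_ends tphi; rewrite !mulr0 subrr sub0r.
exact/test_cont/test_derive1.
Qed.

(** The antiderivative of psi is 0 to the left of the support of psi, and equal to
    the integral of psi, that is 0, to the right. *)
Lemma test_antiderivative psi : test_function psi -> intg (-1) 1 psi = 0 ->
  exists2 phi, test_function phi & derive1 phi = psi.
Proof.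
move=> tpsi I0; have [c /andP[c0 c1] h] := test_zero tpsi.
have psi_i := cont_integ (test_cont tpsi).
have z a b : -1 <= a -> a <= b -> b <= 1 -> (b < - c) \/ (c < a) -> intg a b psi = 0.
  move=> a1 ab b1 out.
  rewrite (@eq_intg _ _ _ _ (fun=> 0)) ?intg_cst ?mul0r // => t tab.
  apply: h; case: out => o; first by rewrite ltr0_norm; lra.
  by rewrite gtr0_norm; lra.
pose phi (t : R) := if -1 <= t <= 1 then intg (-1) t psi else 0.
have phi0 t : c < `|t| -> phi t = 0.
  rewrite /phi; case: ifP => // tI ct; have [t0|t0] := lerP 0 t.
    rewrite ger0_norm // in ct.
    have := intg_split psi_i (a := t) (b := 1); rewrite I0 (z t 1); try lra.
  by rewrite ltr0_norm // in ct; rewrite z; try lra; left; lra.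
have dphi t : derivable phi t 1 /\ derive1 phi t = psi t.
  case: (ltrP c `|t|) => ct.
    have [|d ->] := @derive1_near0 phi t; last by rewrite h.
    by near=> s; apply: phi0; near: s; exact: near_gt_norm.
  have t1 : -1 < t < 1 by rewrite -ltr_norml (le_lt_trans ct).
  have /andP[t1l t1r] := t1.
  have [d v] := continuous_FTC1_closed t1r psi_i t1l (test_continuous tpsi (x := t)).
  have e : \forall s \near t, intg (-1) s psi = phi s.
    near=> s; rewrite /phi ifT //; apply/andP; split; apply: ltW; near: s.
      exact: lt_nbhsr.
    exact: lt_nbhsl.
  have D := near_eq_is_derive e (DeriveDef d (esym (derive1E _ _))).
  by case: D => D1 D2; split => //; rewrite derive1E D2 v.
have phiE : derive1 phi = psi by apply/funext => t; exact: (dphi t).2.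
exists phi => //; split; last by exists c.
case=> [|n] t; first exact: (dphi t).1.
rewrite -derive1n_derive1 phiE; exact/test_derivable/test_derive1n.
Unshelve. all: by end_near. Qed.

End TestFunctions.

(** * Weak derivatives and iterated primitives *)

Section Weak.
Variable R : realType.
Implicit Types (phi psi w x y v F f : R -> R) (p : {poly R}).
Local Notation mu := (@lebesgue_measure R).

(** If w were positive at a point of [-1, 1], it would be positive on a small
    interval inside (-1, 1), and a bump supported there would contradict the
    hypothesis. *)
Lemma test_separates_le w : cont w ->
  (forall phi, test_function phi -> intg (-1) 1 (fun t => w t * phi t) = 0) ->
  forall t, -1 <= t <= 1 -> w t <= 0.
Proof.
move=> cw w0 c cI; rewrite leNgt; apply/negP => wc.
have wc2 : 0 < w c / 2 by rewrite divr_gt0.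
have [d d0 H] := cont_unif cw wc2.
have [a [r [r0 [ar Har]]]] : exists a r : R, 0 < r /\ `|a| + r < 1 /\
    forall t, `|t - a| < r -> -1 <= t <= 1 /\ `|t - c| < d.
  pose r := Num.min d 1 / 4.
  have dm : 0 < Num.min d 1 by rewrite lt_min d0 ltr01.
  have m1 : Num.min d 1 <= 1 by rewrite ge_min lexx orbT.
  have md : Num.min d 1 <= d by rewrite ge_min lexx.
  have [r0 r4 rd] : [/\ 0 < r, r <= 1 / 4 & 4 * r <= d] by rewrite /r; split; lra.
  have [c0|c0] := lerP 0 c.
    exists (c - 2 * r), r; split => //; split.
      by rewrite -ltrBrDr ltr_norml; lra.
    by move=> t; rewrite !ltr_norml; lra.
  exists (c + 2 * r), r; split => //; split.
    by rewrite -ltrBrDr ltr_norml; lra.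
  by move=> t; rewrite !ltr_norml; lra.
have tb := test_smooth_bump ar; have cb := test_cont tb.
have aI : -1 <= a <= 1 by have [|] := Har a; rewrite ?subrr ?normr0.
have pos t : `|t - a| < r -> 0 < w t.
  move=> /Har[tI tc]; have := H t c tI cI tc; rewrite ltr_norml; lra.
have := cont_intg_eq0 (contM cw cb) _ (w0 _ tb) aI.
move=> /(_ _)/eqP; rewrite mulf_eq0 !gt_eqF ?smooth_bump_gt0 ?pos ?subrr ?normr0 //=.
move=> h; apply: notF; apply: h => t tI; case: (ltrP `|t - a| r) => tr.
  by rewrite mulr_ge0 ?smooth_bump_ge0 // ltW // pos.
by rewrite smooth_bump_out ?mulr0.
Qed.

Lemma test_separates w : cont w ->
  (forall phi, test_function phi -> intg (-1) 1 (fun t => w t * phi t) = 0) ->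
  forall t, -1 <= t <= 1 -> w t = 0.
Proof.
move=> cw w0 t tI; apply/eqP; rewrite eq_le (test_separates_le cw w0 tI) /=.
rewrite -oppr_le0 -mulN1r.
apply: (@test_separates_le (fun t => -1 * w t)) => //.
  by apply: contM => //; exact: cont_cst.
move=> phi tphi.
rewrite (@eq_intg _ _ _ _ (fun t => -1 * (w t * phi t))) => [|s _]; last by rewrite mulrA.
by rewrite intgZ ?w0 ?mulr0 //; apply/cont_integ/contM => //; exact: test_cont.
Qed.

Lemma poly_test_by_parts p m phi : test_function phi ->
  intg (-1) 1 (fun t => p.[t] * derive1n m phi t) =
  (-1) ^+ m * intg (-1) 1 (fun t => (derivn m p).[t] * phi t).
Proof.
elim: m p phi => [|m IH] p phi tphi; first by rewrite expr0 mul1r derivn0.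
rewrite derive1nS (test_by_parts (primitive_poly p) (test_derive1n m tphi)).
by rewrite IH // derivSn exprS mulN1r mulNr.
Qed.

Lemma derivn_Xm m : derivn m ('X^m : {poly R}) = m`!%:R%:P.
Proof. by rewrite derivnXn subnn expr0 ffactnn polyC_natr. Qed.

(** A bump th of non-zero integral turns every test function phi into a derivative
    phi - k th, which shows that the m-th weak derivative of w is a constant kap.
    Subtracting a multiple of X^m removes this constant, and the order decreases. *)
Lemma weak_poly m w : cont w ->
  (forall phi, test_function phi -> intg (-1) 1 (fun t => w t * derive1n m phi t) = 0) ->
  exists p : {poly R}, (size p <= m)%N /\ forall t, -1 <= t <= 1 -> w t = p.[t].
Proof.
elim: m w => [|m IH] w cw w0.
  exists 0; split; first by rewrite size_poly0.
  by move=> t tI; rewrite horner0; exact: test_separates tI.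
have r1 : `|0 : R| + 1 / 2 < 1 by rewrite normr0; lra.
have tth := test_smooth_bump r1; set th := smooth_bump 0 (1 / 2) in tth.
pose I0 := intg (-1) 1 th.
have I0_neq : I0 != 0.
  apply/eqP => I00; have := cont_intg_eq0 (test_cont tth) (fun t _ => smooth_bump_ge0 _ _ t) I00.
  move=> /(_ 0); have := @smooth_bump_gt0 R 0 (1 / 2); rewrite -/th => h1 h2.
  have /h1 : 0 < 1 / 2 :> R by lra.
  by rewrite h2 ?ltxx //; lra.
pose kap := intg (-1) 1 (fun t => w t * derive1n m th t) / I0.
have kapE phi : test_function phi ->
    intg (-1) 1 (fun t => w t * derive1n m phi t) = kap * intg (-1) 1 phi.
  move=> tphi; pose k := intg (-1) 1 phi / I0.
  have [tl dl] := test_lin k tphi tth.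
  have [|Phi tPhi PhiE] := test_antiderivative tl.
    rewrite intgB //; try (apply/cont_integ; exact: test_cont); last first.
      by apply/integZ/cont_integ; exact: test_cont.
    by rewrite intgZ //; [rewrite /k divfK ?subrr | apply/cont_integ; exact: test_cont].
  have := w0 _ tPhi; rewrite -derive1n_derive1 PhiE dl.
  have ci psi : test_function psi -> integ (fun t => w t * derive1n m psi t).
    by move=> tpsi; apply/cont_integ/contM => //; exact/test_cont/test_derive1n.
  rewrite (@eq_intg _ _ _ _ (fun t => w t * derive1n m phi t - k * (w t * derive1n m th t))).
    rewrite intgB ?intgZ //; try exact: ci; last by apply: integZ; exact: ci.
    by move/eqP; rewrite subr_eq0 => /eqP ->; rewrite /k /kap; field.
  by move=> t _; ring.
pose k' := kap * (-1) ^+ m / m`!%:R.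
have cX : cont (fun t => k' * t ^+ m).
  apply: (@eq_cont _ (horner (k' *: 'X^m))); last exact: cont_horner.
  by move=> t _; rewrite hornerZ hornerXn.
have [||p [sp pE]] := IH (fun t => w t - k' * t ^+ m).
- exact: contB.
- move=> phi tphi.
  have cphi := test_cont (test_derive1n m tphi).
  rewrite (@eq_intg _ _ _ _ (fun t => w t * derive1n m phi t - (k' *: 'X^m).[t] * derive1n m phi t)); last first.
    by move=> t _; rewrite hornerZ hornerXn; ring.
  rewrite intgB //; try (by apply/cont_integ/contM => //; exact: cont_horner).
  rewrite kapE // poly_test_by_parts // derivnZ derivn_Xm.
  rewrite (@eq_intg _ _ _ (fun t => (k' *: (m`!%:R)%:P).[t] * phi t) (fun t => k' * m`!%:R * phi t)).
    rewrite intgZ //; last exact/cont_integ/test_cont.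
    rewrite /k' divfK ?factr_neq0 //.
    have e : (-1) ^+ m * (-1) ^+ m = 1 :> R by rewrite -exprMn mulrNN mulr1 expr1n.
    move: ((-1) ^+ m : R) (intg (-1) 1 phi) e => s I e.
    by rewrite -[kap * I]mul1r -e; ring.
  by move=> t _; rewrite hornerZ hornerC.
exists (p + k' *: 'X^m); split.
  rewrite (leq_trans (size_polyD _ _)) // geq_max (leqW sp) /=.
  by rewrite (leq_trans (size_scale_leq _ _)) // size_polyXn.
by move=> t tI; rewrite hornerD hornerZ hornerXn -pE // subrK.
Qed.

Fixpoint iprim y j : R -> R :=
  if j is j'.+1 then fun t => intg (-1) t (iprim y j') else y.

Lemma primitive_intg0 f : integ f -> primitive (fun t => intg (-1) t f) f.
Proof.
move=> fi; apply: eq_primitive (primitive_intg 0 fi) => // t _; by rewrite add0r.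
Qed.

Lemma integ_iprim y j : integ y -> integ (iprim y j).
Proof.
move=> iy; elim: j => // j IH.
exact/cont_integ/(primitive_cont (primitive_intg0 IH)).
Qed.

Lemma primitive_iprim y j : integ y -> primitive (iprim y j.+1) (iprim y j).
Proof. by move=> iy; exact/primitive_intg0/integ_iprim. Qed.

Lemma chain_by_parts (X : nat -> R -> R) m phi :
  (forall i, (i < m)%N -> primitive (X i) (X i.+1)) -> test_function phi ->
  forall j, (j <= m)%N -> intg (-1) 1 (fun t => X 0%N t * derive1n j phi t) =
  (-1) ^+ j * intg (-1) 1 (fun t => X j t * phi t).
Proof.
move=> HX tphi j jm.
suff H i : (i <= j)%N -> intg (-1) 1 (fun t => X 0%N t * derive1n j phi t) =
    (-1) ^+ i * intg (-1) 1 (fun t => X i t * derive1n (j - i) phi t).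
  by rewrite (H j) // subnn.
elim: i => [|i IH] ij; first by rewrite expr0 mul1r subn0.
rewrite IH ?(ltnW ij) //.
have -> : (j - i = (j - i.+1).+1)%N by rewrite subnSK.
rewrite derive1nS (test_by_parts (HX i _) (test_derive1n _ tphi)); last exact: leq_trans jm.
by rewrite exprS mulN1r mulNr mulrN.
Qed.

(** The difference of x and of the m-fold primitive of y has a vanishing m-th weak
    derivative, so it is a polynomial of degree less than m. *)
Lemma weak_chain m x y : (0 < m)%N -> cont x -> integ y ->
  (forall phi, test_function phi -> intg (-1) 1 (fun t => x t * derive1n m phi t) =
      (-1) ^+ m * intg (-1) 1 (fun t => y t * phi t)) ->
  exists X : nat -> R -> R, [/\ forall t, -1 <= t <= 1 -> X 0%N t = x t, X m = y &
    forall i, (i < m)%N -> primitive (X i) (X i.+1)].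
Proof.
move=> m0 cx iy Hw; pose V i := iprim y (m - i).
have VV i : (i < m)%N -> primitive (V i) (V i.+1).
  by move=> im; rewrite /V -subnSK //; exact: primitive_iprim.
have cV : cont (V 0%N) by apply/primitive_cont/VV.
have [|phi tphi|p [sp pE]] := @weak_poly m (fun t => x t - V 0%N t).
- exact: contB.
- have cphi := test_cont (test_derive1n m tphi).
  rewrite (@eq_intg _ _ _ _ (fun t => x t * derive1n m phi t - V 0%N t * derive1n m phi t)).
    rewrite intgB //; try (by apply/cont_integ/contM).
    by rewrite Hw // (chain_by_parts VV tphi (leqnn m)) /V subnn subrr.
  by move=> t _; ring.
exists (fun i t => (derivn i p).[t] + V i t); split.
- by move=> t tI; rewrite derivn0 -pE // subrK.
- apply/funext => t; rewrite /V subnn.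
  by rewrite (_ : derivn m p = 0) ?horner0 ?add0r //; exact: derivn_poly0.
- move=> i im; apply: primitiveD (VV i im); rewrite derivnS; exact: primitive_poly.
Qed.

(** The primitive of v has a vanishing weak derivative, so it is constant, and
    v is almost everywhere its derivative. *)
Lemma ae_zero v : integ v ->
  (forall phi, test_function phi -> intg (-1) 1 (fun t => v t * phi t) = 0) ->
  {ae mu, forall t, -1 < t < 1 -> v t = 0}.
Proof.
move=> iv v0; pose V t := intg (-1) t v.
have pV : primitive V v by exact: primitive_intg0.
have [phi tphi|p [sp pE]] := @weak_poly 1 V (primitive_cont pV).
  by rewrite derive1n1 (test_by_parts pV tphi) v0 ?oppr0.
have V0 t : -1 <= t <= 1 -> V t = 0.
  have -> : (0 : R) = V (-1) by rewrite /V intg_xx.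
  move=> tI; rewrite !pE //; last lra.
  by rewrite (size1_polyC sp) !hornerC.
pose f := v \_ (`[-1, 1] : set R).
have fiT : mu.-integrable setT (EFin \o f).
  rewrite /f -restrict_EFin; apply/integrable_restrict => //=.
  by rewrite setTI.
have fi (y : R) : mu.-integrable (`[-1, y] : set R) (EFin \o f).
  exact: integrableS fiT.
have lf : locally_integrable (setT : set R) f.
  apply: open_integrable_locally; [exact: openT | exact: fiT].
have := FTC1 fi lf; apply: filterS; first exact: (ae_filter_ringOfSetsType mu).
move=> t Ht /andP[t1 t2].
have [d e] := Ht t1.
have ft : f t = v t by rewrite /f patchE ifT // inE /= in_itv /= !ltW.
rewrite -ft -e; apply: (derive1_near0 _).2.
near=> s.
have [s1 s2] : -1 < s /\ s < 1.
  by split; near: s; [exact: lt_nbhsr | exact: lt_nbhsl].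
rewrite -(V0 s) ?ltW // /V /intg; apply: eq_Rintegral => z.
rewrite inE /= in_itv /= => /andP[z1 z2].
by rewrite /f patchE ifT // inE /= in_itv /= z1 (le_trans z2) // ltW.
Unshelve. all: by end_near. Qed.

End Weak.

(** * Chains of primitives and their approximation *)

Section WeakDerivn.
Variable R : realType.
Implicit Types (phi x y f : R -> R) (p : {poly R}).
Local Notation mu := (@lebesgue_measure R).

Lemma intg_open f : integ f -> \int[mu]_(t in `]-1, 1[) f t = intg (-1) 1 f.
Proof.
move=> fi; have fo (a b : bool) : mu.-integrable [set` Interval (BSide a (-1)) (BSide b 1)] (EFin \o f).
  apply: integrableS fi => //= t /=; rewrite !in_itv /=.
  by case: a; case: b => /= /andP[h1 h2]; apply/andP; split; lra.
rewrite /intg -Rintegral_itv_obnd_cbnd; last exact: (fo false false).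
by rewrite Rintegral_itv_bndo_bndc //; exact: (fo false true).
Qed.

Lemma weak_derivn_intg n x y phi : weak_derivn n x y -> integ x -> integ y ->
  test_function phi -> intg (-1) 1 (fun t => x t * derive1n n phi t) =
  (-1) ^+ n * intg (-1) 1 (fun t => y t * phi t).
Proof.
move=> [_ _ H] ix iy tphi; have := H phi tphi.
rewrite intg_open; last by apply: integM => //; exact/test_cont/test_derive1n.
by rewrite intg_open //; apply: integM => //; exact/test_cont.
Qed.

Lemma integ_locally f : integ f -> locally_integrable `]-1, 1[ f.
Proof.
move=> fi; apply: open_integrable_locally => //.
apply: integrableS fi => //= t /=; rewrite !in_itv /=.
by move=> /andP[h1 h2]; apply/andP; split; lra.
Qed.

Lemma chain_weak_derivn (X : nat -> R -> R) j x y : cont x -> integ y ->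
  (forall i, (i < j)%N -> primitive (X i) (X i.+1)) ->
  (forall t, -1 <= t <= 1 -> X 0%N t = x t) ->
  (forall t, -1 <= t <= 1 -> X j t = y t) -> weak_derivn j x y.
Proof.
move=> cx iy HX X0 Xj; split; try exact: integ_locally.
  exact/integ_locally/cont_integ.
move=> phi tphi; rewrite intg_open; last first.
  by apply: integM; [exact: cont_integ | exact/test_cont/test_derive1n].
rewrite intg_open; last by apply: integM => //; exact/test_cont.
have := chain_by_parts HX tphi (leqnn j).
rewrite (@eq_intg _ _ _ _ (fun t => x t * derive1n j phi t)) => [->|t /X0 -> //].
by congr (_ * _); apply: eq_intg => t /Xj ->.
Qed.

Lemma varby_locally_integ y v : varby y v -> locally_integrable `]-1, 1[ y -> integ y.
Proof. by move=> yv [my _ _]; exact: varby_integ yv my. Qed.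

Lemma varby_bv y v : varby y v -> bounded_variation (-1) 1 y.
Proof.
move=> yv; exists (v 1 - v (-1)) => _ [s ps <-].
suff H a : itv_partition a 1 s -> -1 <= a -> variation a 1 y s <= v 1 - v a.
  by apply: H.
elim: s a {ps} => [|c s IH] a ps a1.
  rewrite (itv_partition_nil ps) /variation big_nil subrr //.
have pcs := itv_partition_cons ps.
have ac : a < c by case: ps => /= /andP[].
have c1 : c <= 1 := itv_partition_le pcs.
have := IH c pcs; rewrite variation_zip // variation_zip //= big_cons /= => h.
have := yv a c a1 (ltW ac) c1; have := h (le_trans a1 (ltW ac)); lra.
Qed.

Lemma primitive_varby F f : primitive F f ->
  varby F (fun t => intg (-1) t (fun s => `|f s|)).
Proof.
move=> Ff s t s1 st t1; have [fi _] := Ff.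
rewrite (primitive_sub Ff) // intg_split //; last exact: integ_norm.
exact: intg_norm.
Qed.

Lemma cont_nbhs f : (forall (c : R) (eps : R), -1 <= c <= 1 -> 0 < eps ->
    exists2 d : R, 0 < d & forall t, -1 <= t <= 1 -> `|t - c| < d -> `|f t - f c| <= eps) ->
  cont f.
Proof.
move=> H; apply/subspace_continuousP => c; rewrite /= in_itv /= => cI.
apply/cvgrPdist_le => eps eps0; have [d d0 Hd] := H c eps cI eps0.
rewrite near_withinE; apply/nbhs_ballP; exists d => //= t ct.
by rewrite in_itv /= => tI; rewrite distrC Hd // distrC.
Qed.

Lemma primitive_lip F f (M s t : R) : primitive F f ->
  (forall r : R, -1 <= r <= 1 -> `|f r| <= M) -> -1 <= s -> s <= t -> t <= 1 ->
  `|F t - F s| <= M * (t - s).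
Proof.
move=> Ff fM s1 st t1; rewrite (primitive_sub Ff) //; have [fi _] := Ff.
by apply: (intg_bound s1 t1 fi st) => r rst; apply: fM; lra.
Qed.

(** K integrations, from the exact initial values; each of them at most doubles
    the error, the interval having length 2. *)
Lemma lift_approx K (Z : nat -> R -> R) (S : {poly R}) (eps : R) :
  (forall i, (i < K)%N -> primitive (Z i) (Z i.+1)) ->
  (forall t, -1 <= t <= 1 -> `|Z K t - S.[t]| <= eps) ->
  exists Q : {poly R}, [/\ (size Q <= size S + K)%N, derivn K Q = S,
    forall i t, (i <= K)%N -> -1 <= t <= 1 ->
      `|Z i t - (derivn i Q).[t]| <= 2 ^+ K * eps &
    forall i, (i < K)%N -> (derivn i Q).[-1] = Z i (-1)].
Proof.
elim: K Z => [|K IH] Z HZ HS.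
  exists S; split => //; first by rewrite addn0.
  by move=> i t; rewrite leqn0 => /eqP -> tI; rewrite derivn0 expr0 mul1r HS.
have [|Q [sQ dQ QZ Qi]] := IH (fun i => Z i.+1) _ HS.
  by move=> i iK; exact: HZ.
have eps0 : 0 <= eps by apply: le_trans (HS 0 _) => //; lra.
pose Q1 := antid Q + (Z 0%N (-1) - (antid Q).[-1])%:P.
have dQ1 : Q1^`() = Q by rewrite /Q1 derivD derivC addr0 deriv_antid.
have Q1m : Q1.[-1] = Z 0%N (-1) by rewrite /Q1 hornerD hornerC; ring.
have e0 : 0 <= 2 ^+ K * eps by rewrite mulr_ge0 // exprn_ge0.
exists Q1; split.
- rewrite (leq_trans (size_polyD _ _)) // geq_max; apply/andP; split.
    by rewrite (leq_trans (size_antid _)) // addnS ltnS.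
  by rewrite (leq_trans (size_polyC_leq1 _)) // addnS.
- by rewrite derivSn dQ1.
- case=> [|i] t iK tI; last first.
    by rewrite derivSn dQ1 (le_trans (QZ i t iK tI)) // exprS; lra.
  rewrite derivn0; have pZ := HZ 0%N isT; have pQ := primitive_poly Q1.
  rewrite dQ1 in pQ; have pD := primitiveB pZ pQ.
  have := primitive_lip pD (QZ 0%N ^~ isT) (lexx _) (_ : -1 <= t) (_ : t <= 1).
  rewrite Q1m subrr subr0 exprS; have h : t - -1 <= 2 by lra.
  have := ler_wpM2l e0 h => h1 h2; apply: le_trans (h2 _ _) _; lra.
- case=> [|i] iK; first by rewrite derivn0.
  by rewrite derivSn dQ1 Qi.
Qed.

End WeakDerivn.

Section QuadratureConvergence.
Variable R : realType.

(** The quadrature is exact on a polynomial uniformly close to f, and the weights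
    are nonnegative of sum 2. *)
Lemma quadrature_cvg (f : R -> R) (eps : R) : cont f -> 0 < eps -> exists N0, forall N, (N0 <= N)%N ->
  `|\sum_(k < N.+1) f (@node R N k) * @weight R N k - intg (-1) 1 f| <= eps.
Proof.
move=> cf eps0; have e4 : 0 < eps / 4 by rewrite divr_gt0.
have [p Hp] := weierstrass cf e4.
exists (size p).+1 => N sN; have N0 : (0 < N)%N by exact: leq_trans sN.
have qp : \sum_(k < N.+1) p.[@node R N k] * @weight R N k = intg (-1) 1 (horner p).
  by rewrite intg_poly quadrature // (leq_trans (ltnW sN)) // -addnn leq_addr.
have -> : \sum_(k < N.+1) f (@node R N k) * @weight R N k - intg (-1) 1 f =
  \sum_(k < N.+1) (f (@node R N k) - p.[@node R N k]) * @weight R N k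
    - intg (-1) 1 (fun t => f t - p.[t]).
  rewrite intgB //; [|exact: cont_integ|exact/cont_integ/cont_horner].
  by rewrite -qp; under [in RHS]eq_bigr do rewrite mulrBl; rewrite sumrB; ring.
apply: le_trans (ler_normB _ _) _.
have -> : eps = eps / 4 * 2 + eps / 4 * 2 by field.
apply: lerD; last first.
  by apply: intg_bound2 => //; apply: integB; apply: cont_integ => //; exact: cont_horner.
rewrite -(sum_weight R N0) mulr_sumr (le_trans (ler_norm_sum _ _ _)) //.
apply: ler_sum => k _; rewrite normrM [`|weight _ _|]ger0_norm ?weight_ge0 //.
by rewrite ler_wpM2r ?weight_ge0 // Hp // node_itv.
Qed.

End QuadratureConvergence.

(** * Trajectories, controls and costs *)

Section Lipschitz.
Variable R : realType.

Lemma cV_norm_leP n (v : 'cV[R]_n) (c : R) : 0 <= c ->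
  `|v| <= c <-> forall i, `|v i 0| <= c.
Proof.
move=> c0; rewrite [`|v|]mx_normrE; split=> [H i|H].
  by apply: le_trans H; exact: (le_bigmax _ (fun ij : 'I_n * 'I_1 => `|v ij.1 ij.2|) (i, 0)).
by apply/bigmax_leP; split => // -[i j] _ /=; rewrite ord1.
Qed.

Lemma lipschitz_coord (V : normedModType R) n (f : V -> 'cV[R]_n) i :
  lipschitz f -> lipschitz (fun a => f a i 0).
Proof.
move=> [M [rM HM]]; exists M; split => // K MK [a b] ab /=.
apply: le_trans (HM K MK (a, b) ab) => /=; have := (cV_norm_leP (f a - f b) (normr_ge0 _)).1 (lexx _) i.
by rewrite !mxE.
Qed.

Lemma lipschitz_const (V W : normedModType R) (f : V -> W) : lipschitz f ->
  exists2 K : R, 0 < K & forall a b, `|f a - f b| <= K * `|a - b|.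
Proof.
move=> [M [_ HM]]; pose K := Num.max (M + 1) 1.
have K1 : M < K by rewrite /K lt_max; apply/orP; left; lra.
have K0 : 0 < K by rewrite /K lt_max; apply/orP; right.
exists K => // a b; exact: (HM _ K1 (a, b)).
Qed.

Lemma cont_lipschitz (V : normedModType R) (f : V -> R) (w : R -> V) : lipschitz f ->
  {within `[-1, 1], continuous w} -> cont (f \o w).
Proof.
move=> /lipschitz_const[K K0 HK] cw; apply/subspace_continuousP => c cI.
apply/cvgrPdist_le => e e0; have eK : 0 < e / K by rewrite divr_gt0.
move/subspace_continuousP: cw => /(_ c cI)/cvgrPdist_le/(_ _ eK).
apply: filterS => t h /=; rewrite (le_trans (HK _ _)) //.
by rewrite mulrC -ler_pdivlMr.
Qed.

Lemma cont_col n (Z : nat -> R -> R) : (forall i : 'I_n, cont (Z i)) ->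
  {within `[-1, 1], continuous (fun t => \col_(i < n) Z i t : 'cV[R]_n)}.
Proof.
move=> cZ; apply/subspace_continuousP => c cI.
apply/cvgrPdist_le => e e0.
have h : \forall t \near within (`[-1, 1] : set R) (nbhs c), forall i : 'I_n, `|Z i c - Z i t| <= e.
  apply: filter_forall => i.
  by move/subspace_continuousP: (cZ i) => /(_ c cI)/cvgrPdist_le/(_ e e0).
apply: filterS h => t h /=; apply/cV_norm_leP; first exact: ltW.
by move=> i; rewrite !mxE h.
Qed.

Lemma cont_pair (V W : normedModType R) (v : R -> V) (w : R -> W) :
  {within `[-1, 1], continuous v} -> {within `[-1, 1], continuous w} ->
  {within `[-1, 1], continuous (fun t => (v t, w t))}.
Proof. by move=> cv cw x; apply: cvg_pair; [exact: cv|exact: cw]. Qed.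

Lemma cont_inv (f : R -> R) : cont f -> (forall t, f t != 0) -> cont (fun t => (f t)^-1).
Proof. by move=> cf f0 x; apply: continuousV; [exact: f0|exact: cf]. Qed.

End Lipschitz.

Section Trajectory.
Variables (R : realType) (q Ne Nh : nat) (P : problemB R q Ne Nh).
Implicit Types (Z Y : nat -> R -> R) (Q : {poly R}).

Definition state Z t : 'cV[R]_q.+1 := \col_(i < q.+1) Z i t.
(** A trajectory Z lists the components of the state, x_(i+1) = Z i, followed by
    the derivative Z q.+1 of the last one; the last state equation then
    determines the control. *)
Definition ctrl Z t : R := (Z q.+1 t - dynf P (state Z t)) / dyng P (state Z t).
Definition conts Z := forall i, (i <= q.+1)%N -> cont (Z i).
Definition unifclose (eps : R) Z Y :=
  forall i (t : R), (i <= q.+1)%N -> -1 <= t <= 1 -> `|Z i t - Y i t| <= eps.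

Lemma cont_state Z : conts Z -> {within `[-1, 1], continuous (state Z)}.
Proof. by move=> cZ; apply: cont_col => i; apply: cZ; rewrite ltnW. Qed.

Lemma cont_ctrl Z : conts Z -> cont (ctrl Z).
Proof.
move=> cZ; apply: contM.
  apply: contB; first exact: cZ.
  exact: (cont_lipschitz (dynf_lip P) (cont_state cZ)).
apply: (cont_inv (cont_lipschitz (dyng_lip P) (cont_state cZ))) => t.
exact: dyng_neq0.
Qed.

Lemma cont_point (G : 'cV[R]_q.+1 * R -> R) Z : lipschitz G -> conts Z ->
  cont (fun t => G (state Z t, ctrl Z t)).
Proof.
move=> lG cZ; apply: (cont_lipschitz lG).
by apply: cont_pair; [exact: cont_state|exact: cont_ctrl].
Qed.

Lemma close_state Z Y eps : unifclose eps Z Y -> forall t : R, -1 <= t <= 1 ->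
  `|state Z t - state Y t| <= eps.
Proof.
move=> H t tI; have e0 : 0 <= eps := le_trans (normr_ge0 _) (H 0%N t isT tI).
by apply/cV_norm_leP => // i; rewrite !mxE H // ltnW.
Qed.

(** By compactness, g is bounded away from 0 along Y, hence also along the
    trajectories close to Y. *)
Lemma close_ctrl Y : conts Y -> exists C del : R, [/\ 0 < C, 0 < del &
  forall Z eps, eps <= del -> unifclose eps Z Y -> forall t : R, -1 <= t <= 1 ->
  `|ctrl Z t - ctrl Y t| <= C * eps].
Proof.
move=> cY.
have [Kf Kf0 HKf] := lipschitz_const (dynf_lip P).
have [Kg Kg0 HKg] := lipschitz_const (dyng_lip P).
have cg := cont_lipschitz (dyng_lip P) (cont_state cY).
have N11 : (-1 : R) <= 1 by lra.
have [c cI Hc] := EVT_min N11 (cont_norm cg).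
pose gam := `|dyng P (state Y c)|.
have gam0 : 0 < gam by rewrite normr_gt0 dyng_neq0.
have gmin t : -1 <= t <= 1 -> gam <= `|dyng P (state Y t)|.
  by move=> tI; apply: Hc; rewrite in_itv.
have cn : cont (fun t => Y q.+1 t - dynf P (state Y t)).
  apply: contB; first exact: cY.
  exact: (cont_lipschitz (dynf_lip P) (cont_state cY)).
have [M M0 HM] := cont_bounded cn.
exists ((1 + Kf + M * Kg / gam) * (2 / gam)), (gam / 2 / Kg); split.
- by rewrite mulr_gt0 ?divr_gt0 // addr_gt0 ?divr_gt0 ?mulr_gt0 // addr_gt0.
- by rewrite !divr_gt0.
move=> Z eps ed HZ t tI.
have sZ := close_state HZ tI.
have e0 : 0 <= eps := le_trans (normr_ge0 _) sZ.
have hf : `|dynf P (state Z t) - dynf P (state Y t)| <= Kf * eps.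
  by rewrite (le_trans (HKf _ _)) // ler_pM2l.
have hg : `|dyng P (state Z t) - dyng P (state Y t)| <= Kg * eps.
  by rewrite (le_trans (HKg _ _)) // ler_pM2l.
have hn := HM t tI; have hz := HZ q.+1 t (leqnn _) tI.
have g1 := gmin t tI; rewrite /ctrl.
have nz := dyng_neq0 P (state Z t); have ny := dyng_neq0 P (state Y t).
have hK : Kg * eps <= gam / 2 by rewrite mulrC -ler_pdivlMr.
move: (dynf P (state Z t)) (dynf P (state Y t)) (dyng P (state Z t)) (dyng P (state Y t))
  (Z q.+1 t) (Y q.+1 t) hf hg hn hz g1 nz ny {sZ HZ ed HM Hc cn}.
move=> a b g h z y hf hg hn hz g1 nz ny.
have gg : gam / 2 <= `|g|.
  have : `|h| <= `|g| + `|g - h|.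
    by rewrite -[in leLHS](subKr g h) (le_trans (ler_normB _ _)).
  lra.
have -> : (z - a) / g - (y - b) / h = ((z - y) - (a - b) - (y - b) / h * (g - h)) / g.
  by field; rewrite nz ny.
rewrite normrM normfV [leRHS]mulrAC; apply: ler_pM => //.
- rewrite [leRHS]mulrDl (le_trans (ler_normB _ _)) // lerD //.
    by rewrite (le_trans (ler_normB _ _)) // [leRHS]mulrDl mul1r lerD.
  have -> : M * Kg / gam * eps = M / gam * (Kg * eps) by rewrite -!mulrA; congr (_ * _); ring.
  rewrite normrM; apply: ler_pM => //; rewrite normrM normfV.
  by apply: ler_pM => //; rewrite ?invr_ge0 // lef_pV2 // posrE // normr_gt0.
- rewrite -[2 / gam]invf_div lef_pV2 // posrE ?normr_gt0 //.
  by rewrite divr_gt0.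
Qed.

Lemma close_point (W : normedModType R) (G : 'cV[R]_q.+1 * R -> W) Y : lipschitz G -> conts Y ->
  exists C del : R, [/\ 0 < C, 0 < del &
  forall Z eps, eps <= del -> unifclose eps Z Y -> forall t : R, -1 <= t <= 1 ->
  `|G (state Z t, ctrl Z t) - G (state Y t, ctrl Y t)| <= C * eps].
Proof.
move=> /lipschitz_const[K K0 HK] cY; have [C [del [C0 del0 H]]] := close_ctrl cY.
exists (K * (1 + C)), del; split => //; first by rewrite mulr_gt0 // addr_gt0.
move=> Z eps ed ZY t tI; rewrite (le_trans (HK _ _)) // -mulrA ler_pM2l //.
have h := H Z eps ed ZY t tI; have s := close_state ZY tI.
have e0 : 0 <= eps := le_trans (normr_ge0 _) s.
have Ce : 0 <= C * eps := le_trans (normr_ge0 _) h.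
rewrite prod_normE /= ge_max mulrDl mul1r; apply/andP; split; lra.
Qed.

Lemma close_ends (W : normedModType R) (G : 'cV[R]_q.+1 * 'cV[R]_q.+1 -> W) : lipschitz G ->
  exists2 C : R, 0 < C & forall Y Z eps, unifclose eps Z Y ->
  `|G (state Z (-1), state Z 1) - G (state Y (-1), state Y 1)| <= C * eps.
Proof.
move=> /lipschitz_const[K K0 HK]; exists K => // Y Z eps ZY.
rewrite (le_trans (HK _ _)) // ler_pM2l // prod_normE /= ge_max.
by apply/andP; split; apply: close_state ZY _ _; lra.
Qed.

Definition costN N Z : R :=
  \sum_(k < N.+1) costF P (state Z (@node R N k), ctrl Z (@node R N k)) * @weight R N k
  + costE P (state Z (-1), state Z 1).

Definition costZ Z : R := costJ P (state Z) (ctrl Z).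

Lemma costZE Z : costZ Z = intg (-1) 1 (fun t => costF P (state Z t, ctrl Z t))
  + costE P (state Z (-1), state Z 1).
Proof. by []. Qed.

Lemma quadrature_bound N (f : R -> R) (c : R) : (0 < N)%N -> 
  (forall t : R, -1 <= t <= 1 -> `|f t| <= c) ->
  `|\sum_(k < N.+1) f (@node R N k) * @weight R N k| <= c * 2.
Proof.
move=> N0 fc; rewrite -(sum_weight R N0) mulr_sumr (le_trans (ler_norm_sum _ _ _)) //.
apply: ler_sum => k _; rewrite normrM [`|weight _ _|]ger0_norm ?weight_ge0 //.
by rewrite ler_wpM2r ?weight_ge0 // fc // node_itv.
Qed.

(** The error splits into the variation of the integrand, which the nonnegative
    weights of sum 2 control uniformly in N, the quadrature error for the fixed
    trajectory Y, and the variation of the endpoint cost. *)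
Lemma cost_close Y (eta : R) : conts Y -> 0 < eta -> exists del (N0 : nat), 0 < del /\
  forall Z N, (N0 <= N)%N -> conts Z -> unifclose del Z Y ->
  `|costN N Z - costZ Y| <= eta /\ `|costZ Z - costZ Y| <= eta.
Proof.
move=> cY eta0.
have [C [del [C0 del0 HC]]] := close_point (costF_lip P) cY.
have [K K0 HK] := close_ends (costE_lip P).
have cF := cont_point (costF_lip P) cY.
have e4 : 0 < eta / 2 by rewrite divr_gt0.
have [N0 HN] := quadrature_cvg cF e4.
pose S := C * 2 + K; have S0 : 0 < S by rewrite addr_gt0 // mulr_gt0.
pose d := Num.min del (eta / 2 / S).
have d0 : 0 < d by rewrite lt_min del0 !divr_gt0.
have dS : C * d * 2 + K * d <= eta / 2.
  have : d <= eta / 2 / S by rewrite ge_min lexx orbT.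
  by rewrite ler_pdivlMr // /S; lra.
exists d, N0.+1; split => // Z N N0N cZ ZY.
have dd : d <= del by rewrite ge_min lexx.
have Hp := fun t tI => HC Z d dd ZY t tI.
have He := HK Y Z d ZY.
have cZF := cont_point (costF_lip P) cZ.
have NN : (0 < N)%N by exact: leq_trans N0N.
pose f W t := costF P (state W t, ctrl W t).
pose e W := costE P (state W (-1), state W 1).
pose Q (h : R -> R) := \sum_(k < N.+1) h (@node R N k) * @weight R N k.
split.
  have h1 : `|Q (f Y) - intg (-1) 1 (f Y)| <= eta / 2 := HN N (ltnW N0N).
  have h2 : `|Q (fun t => f Z t - f Y t)| <= C * d * 2 := quadrature_bound NN Hp.
  have -> : costN N Z - costZ Y = Q (fun t => f Z t - f Y t)
      + (Q (f Y) - intg (-1) 1 (f Y)) + (e Z - e Y).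
    rewrite {1}/Q; under eq_bigr do rewrite mulrBl.
    by rewrite sumrB costZE /costN /Q /f /e; ring.
  rewrite (le_trans (ler_normD _ _)) //.
  have := ler_normD (Q (fun t => f Z t - f Y t)) (Q (f Y) - intg (-1) 1 (f Y)).
  rewrite -/(e Z) -/(e Y) in He; lra.
have h2 := intg_bound2 (integB (cont_integ cZF) (cont_integ cF)) Hp.
rewrite !costZE; rewrite intgB in h2; try exact: cont_integ; try lra.
have := ler_normD (intg (-1) 1 (f Z) - intg (-1) 1 (f Y)) (e Z - e Y).
rewrite [in leLHS]addrACA -opprD /f /e; lra.
Qed.

End Trajectory.

(** * Discrete trajectories as polynomials *)

Section Discrete.
Variables (R : realType) (q Ne Nh : nat) (P : problemB R q Ne Nh).
Implicit Types (Q : {poly R}).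

Lemma derivn_derivn i j Q : derivn j (derivn i Q) = derivn (i + j) Q.
Proof. by rewrite /derivn -iterD addnC. Qed.

Definition traj Q : nat -> R -> R := fun i t => (derivn i Q).[t].

Lemma traj_cont Q i : cont (traj Q i).
Proof. exact: cont_horner. Qed.

Lemma traj_primitive Q i : primitive (traj Q i) (traj Q i.+1).
Proof. by rewrite /traj derivnS; exact: primitive_poly. Qed.

Definition sample_state N Q : 'M[R]_(q.+1, N.+1) := \matrix_(i, k) traj Q i (@node R N k).
Definition sample_ctrl N Q : 'rV[R]_N.+1 := \row_k ctrl P (traj Q) (@node R N k).

(** The constraints of the discrete problem, for the trajectory made of the
    successive derivatives of Q. *)
Definition feasible_poly (m1 : nat) (beta : R) (b : bounds R q) N Q : Prop :=
  [/\ (size Q <= N.+1)%N,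
      `|cone P (state q (traj Q) (-1), state q (traj Q) 1)| <= tolerance q N beta /\
      (forall (k : 'I_N.+1) i, conh P (state q (traj Q) (@node R N k), ctrl P (traj Q) (@node R N k)) i 0
        <= tolerance q N beta),
      forall k : 'I_N.+1,
        (forall i : 'I_q.+1, (box_lo b).1 i 0 <= traj Q i (@node R N k) <= (box_hi b).1 i 0) /\
        (box_lo b).2 <= ctrl P (traj Q) (@node R N k) <= (box_hi b).2,
      forall j, (0 < j < m1)%N -> der_lo b j <= traj Q (q + j) (-1) <= der_hi b j &
      \sum_(n < N.+2 - (q.+1 + m1)) `|lcoef n (derivn (q + m1) Q)| <= coef_hi b].

Section Nodes.
Variables (N : nat) (m1 : nat) (beta : R) (b : bounds R q).
Hypotheses (N0 : (0 < N)%N) (m10 : (0 < m1)%N).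

Lemma spectral_coef_derivn (v : 'rV[R]_N.+1) Q n : (size Q <= N.+1)%N ->
  interp v = derivn q Q -> (n < N.+2 - (q.+1 + m1))%N ->
  spectral_coef m1 n v = lcoef n (derivn (q + m1) Q).
Proof.
move=> sQ vQ nN; have dQ : derivn m1 (interp v) = derivn (q + m1) Q.
  by rewrite vQ derivn_derivn.
rewrite spectral_coefE // dQ // size_derivn; lia.
Qed.

Lemma col_sample_state Q k : col k (sample_state N Q) = state q (traj Q) (@node R N k).
Proof. by apply/matrixP => i j; rewrite !mxE. Qed.

Lemma row_sample_state Q i : (size Q <= N.+1)%N -> interp (row i (sample_state N Q)) = derivn i Q.
Proof.
move=> sQ; rewrite -[RHS](interp_poly N0); last by rewrite size_derivn (leq_trans (leq_subr _ _)).
by congr interp; apply/matrixP => a k; rewrite !mxE.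
Qed.

Lemma sample_feasible Q : feasible_poly m1 beta b N Q ->
  feasibleBN P m1 beta b (sample_state N Q) (sample_ctrl N Q) /\
  costJN P (sample_state N Q) (sample_ctrl N Q) = costN P N (traj Q).
Proof.
move=> [sQ [hc hh] hb hd hs].
have c0 : col ord0 (sample_state N Q) = state q (traj Q) (-1) by rewrite col_sample_state node0.
have c1 : col ord_max (sample_state N Q) = state q (traj Q) 1 by rewrite col_sample_state node_max.
split; last first.
  rewrite /costJN /costN c0 c1; congr (_ + _); apply: eq_bigr => k _.
  by rewrite col_sample_state mxE.
have D i : Defs.diffmx R N *m (row i (sample_state N Q))^T = (\row_k (derivn i.+1 Q).[@node R N k])^T.
  by have := diffmx_interp N0 1 (row i (sample_state N Q)); rewrite expr1 row_sample_state // -derivn1.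
split.
- split=> [i j ij|k].
    by rewrite D; apply/matrixP => a k; rewrite !mxE ij.
  rewrite D !mxE col_sample_state /ctrl mulrC divfK ?dyng_neq0 //; rewrite /traj; ring.
- rewrite c0 c1; split=> // k i; rewrite col_sample_state mxE; exact: hh.
- by move=> k; have [h1 h2] := hb k; rewrite !mxE; split => // i; rewrite mxE.
- move=> j jm; rewrite (diffmx_interp N0) row_sample_state // !mxE (node0 _ N0) derivn_derivn.
  exact: hd.
- apply: le_trans hs; apply: ler_sum => n _.
  by rewrite (@spectral_coef_derivn _ Q) // row_sample_state.
Qed.

(** By the discrete state equations the interpolants of the components of the state
    are the successive derivatives of a single polynomial. *)
Lemma feasible_is_sample (xb : 'M[R]_(q.+1, N.+1)) ub : feasibleBN P m1 beta b xb ub ->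
  exists Q, [/\ feasible_poly m1 beta b N Q, costJN P xb ub = costN P N (traj Q),
    interp_state xb = state q (traj Q) & interp_control P xb = ctrl P (traj Q)].
Proof.
move=> [[hx hu] [hc hh] hb hd hs]; pose Q := interp (row ord0 xb).
have sQ : (size Q <= N.+1)%N := size_interp _.
have D i : Defs.diffmx R N *m (row i xb)^T = (\row_k ((interp (row i xb))^`()).[@node R N k])^T.
  by have := diffmx_interp N0 1 (row i xb); rewrite expr1 -derivn1.
have IQ (i : 'I_q.+1) : interp (row i xb) = derivn i Q.
  case: i => i; elim: i => [|i IH] hi.
    by rewrite derivn0 /Q; congr (interp (row _ _)); exact/val_inj.
  rewrite derivnS -(IH (ltnW hi)); apply: (poly_eq_nodes N0).
  - exact: size_interp.
  - by rewrite -derivn1 size_derivn (leq_trans (leq_subr _ _)) // size_interp.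
  move=> k; rewrite interp_node //.
  have := hx (Ordinal (ltnW hi)) (Ordinal hi) (erefl _).
  by rewrite D => /matrixP/(_ k 0); rewrite !mxE => ->.
have xk i k : xb i k = traj Q i (@node R N k).
  by rewrite /traj -IQ interp_node // mxE.
have ck k : col k xb = state q (traj Q) (@node R N k).
  by apply/matrixP => i j; rewrite !mxE xk.
have uk k : ub 0 k = ctrl P (traj Q) (@node R N k).
  have := hu k; rewrite D !mxE IQ -derivnS ck /ctrl /traj => ->.
  by rewrite addrC addKr mulrC mulKf ?dyng_neq0.
have c0 : col ord0 xb = state q (traj Q) (-1) by rewrite ck node0.
have c1 : col ord_max xb = state q (traj Q) 1 by rewrite ck node_max.
have sE t : interp_state xb t = state q (traj Q) t.
  by apply/matrixP => i j; rewrite !mxE IQ.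
exists Q; split.
- split => //.
  + rewrite -c0 -c1; split=> // k i; rewrite -ck -uk; exact: hh.
  + move=> k; have [h1 h2] := hb k; rewrite -uk; split=> // i; rewrite -xk; exact: h1.
  + move=> j jm; have := hd j jm; rewrite (diffmx_interp N0) IQ !mxE (node0 _ N0) derivn_derivn; apply.
  + apply: le_trans hs; apply: ler_sum => n _.
    by rewrite (@spectral_coef_derivn _ Q) // IQ.
- rewrite /costJN /costN c0 c1; congr (_ + _); apply: eq_bigr => k _.
  by rewrite ck uk.
- exact/funext.
- by apply/funext => t; rewrite /interp_control /ctrl sE IQ -derivnS.
Qed.

End Nodes.
End Discrete.

(** * Compactness of equi-Lipschitz sequences *)

Section Compactness.
Variable R : realType.

(** Tychonoff's theorem, for pointwise convergence. *)
Lemma bounded_cluster (X : nat -> nat * R -> R) (M : R) :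
  (forall n p, `|X n p| <= M) -> exists Z : nat * R -> R,
  forall (s : seq (nat * R)) (eps : R) n0, 0 < eps ->
  exists2 n, (n0 <= n)%N & forall p, p \in s -> `|X n p - Z p| < eps.
Proof.
move=> XM.
pose T := fun _ : (nat * R)%type => R : topologicalType.
have cA := @tychonoff _ T (fun _ => `[- M, M]%classic) (fun _ => @segment_compact R (- M) M).
pose F : set_system (forall p, T p) := fmap (X : nat -> forall p, T p) \oo.
have [] := cA F _ _.
  by exists 0%N => // n _ p /=; rewrite in_itv /= -ler_norml XM.
move=> Z [_ cZ]; exists Z => s eps n0 eps0.
pose B := [set f : forall p, T p | forall p, p \in s -> `|f p - Z p| < eps].
have nB : nbhs (Z : prod_topology T) B.
  rewrite /B; elim: s {B} => [|p s IH].
    by apply: filterS filterT => f _ p; rewrite in_nil.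
  have h : nbhs (Z : prod_topology T) [set f | `|f p - Z p| < eps].
    have := @proj_continuous _ T p Z [set r : R | `|r - Z p| < eps]; apply.
    by apply/nbhs_ballP; exists eps => //= r; rewrite /ball /= distrC.
  apply: filterS (filterI h IH) => f [/= h1 h2] r; rewrite inE => /orP[/eqP ->//|].
  exact: h2.
have FA : F (X @` [set n | (n0 <= n)%N]).
  by exists n0 => // n nn; exists n.
have [f [[n nn <-] Bn]] := cZ _ _ FA nB.
by exists n.
Qed.

Lemma grid_cover (h : R) n (t : R) : 0 <= h -> -1 <= t <= -1 + h * n%:R ->
  exists2 k, (k <= n)%N & `|t - (-1 + h * k%:R)| <= h.
Proof.
move=> h0; elim: n => [|n IH] tI.
  by exists 0%N => //; rewrite ler_norml; apply/andP; split; lra.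
have [tn|tn] := leP t (-1 + h * n%:R).
  by have [|k kn hk] := IH; [lra | exists k => //; exact: leqW].
exists n.+1 => //; move: tI; rewrite -(natr1 n) ler_norml => /andP[t1 t2].
apply/andP; split; lra.
Qed.

(** A pointwise cluster point inherits the Lipschitz constant; closeness at the
    points of a fine grid then implies uniform closeness. *)
Lemma ascoli (I : nat) (X : nat -> nat -> R -> R) (M L : R) :
  (forall n i t, (i <= I)%N -> -1 <= t <= 1 -> `|X n i t| <= M) ->
  (forall n i (s t : R), (i <= I)%N -> -1 <= s -> s <= t -> t <= 1 ->
    `|X n i t - X n i s| <= L * (t - s)) ->
  exists (Z : nat -> R -> R),
    (forall i (s t : R), (i <= I)%N -> -1 <= s -> s <= t -> t <= 1 ->
      `|Z i t - Z i s| <= L * (t - s)) /\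
    forall (eps : R) n0, 0 < eps -> exists2 n, (n0 <= n)%N &
      forall i (t : R), (i <= I)%N -> -1 <= t <= 1 -> `|X n i t - Z i t| <= eps.
Proof.
move=> XM XL.
have L0 : 0 <= L.
  have := XL 0%N 0%N (-1) 1 isT _ _ _; have := normr_ge0 (X 0%N 0%N 1 - X 0%N 0%N (-1)).
  move=> h1 h2; have : 0 <= L * (1 - -1) by apply: le_trans h1 (h2 _ _ _); lra.
  lra.
pose X' n (p : nat * R) := if (p.1 <= I)%N && (-1 <= p.2 <= 1) then X n p.1 p.2 else 0.
have X'E n i t : (i <= I)%N -> -1 <= t <= 1 -> X' n (i, t) = X n i t.
  by rewrite /X' /= => -> ->.
have X'M n p : `|X' n p| <= M.
  rewrite /X'; case: ifP => [/andP[h1 h2]|_]; first exact: XM.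
  by rewrite normr0 (le_trans (normr_ge0 _) (XM 0%N 0%N 0 isT _)) //; lra.
have [Z' HZ] := bounded_cluster X'M; pose Z i t := Z' (i, t).
have ZL i (s t : R) : (i <= I)%N -> -1 <= s -> s <= t -> t <= 1 ->
    `|Z i t - Z i s| <= L * (t - s).
  move=> iI s1 st t1; apply/ler_addgt0Pr => e e0.
  have e2 : 0 < e / 2 by rewrite divr_gt0.
  have [n _ Hn] := HZ [:: (i, s); (i, t)] (e / 2) 0%N e2.
  have hs := Hn (i, s); have ht := Hn (i, t).
  rewrite !inE !eqxx ?orbT !X'E // in hs ht; try (apply/andP; split; lra).
  have {}hs := hs isT; have {}ht := ht isT.
  have hX := XL n i s t iI s1 st t1.
  have -> : Z i t - Z i s = (X n i t - X n i s) - (X n i t - Z i t) + (X n i s - Z i s) by ring.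
  rewrite (le_trans (ler_normD _ _)) //.
  have := ler_normB (X n i t - X n i s) (X n i t - Z i t); lra.
exists Z; split=> // eps n0 eps0.
pose m := (Num.bound (8 * (L + 1) / eps)).+1; pose h : R := 2 / m%:R.
have m0 : 0 < m%:R :> R by rewrite ltr0n.
have L1 : 0 < L + 1 by rewrite ltr_wpDl.
have h0 : 0 < h by rewrite divr_gt0.
have hL : L * h <= eps / 4.
  have : 8 * (L + 1) / eps <= m%:R.
    rewrite ltW // (lt_trans (archi_boundP _)) ?ltr_nat //.
    by rewrite divr_ge0 ?mulr_ge0 // ltW.
  rewrite ler_pdivrMr // => H; rewrite /h mulrA ler_pdivrMr //; lra.
have hm : h * m%:R = 2 by rewrite /h divfK // gt_eqF.
pose s := [seq (i, -1 + h * k%:R) | i <- iota 0 I.+1, k <- iota 0 m.+1].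
have e2 : 0 < eps / 2 by rewrite divr_gt0.
have [n nn Hn] := HZ s (eps / 2) n0 e2; exists n => // i t iI tI.
have [|k km tg] := @grid_cover h m t (ltW h0); first by rewrite hm; lra.
set g := -1 + h * k%:R in tg.
have gI : -1 <= g <= 1.
  have k0 : 0 <= h * k%:R by rewrite mulr_ge0 // ltW.
  have : h * k%:R <= h * m%:R by rewrite ler_pM2l // ler_nat.
  by rewrite hm /g => k2; apply/andP; split; lra.
have sg : (i, g) \in s by apply: allpairs_f; rewrite mem_iota.
have := Hn _ sg; rewrite X'E // => /ltW hg.
have lip (Y : R -> R) : (forall s t : R, -1 <= s -> s <= t -> t <= 1 -> `|Y t - Y s| <= L * (t - s)) ->
    `|Y t - Y g| <= eps / 4.
  move=> HY; apply: le_trans hL; have := tg; rewrite ler_norml => /andP[d1 d2].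
  have [tg'|tg'] := leP t g.
    by rewrite distrC (le_trans (HY t g _ _ _)) ?ler_wpM2l //; clear -gI tI d1 d2 tg'; lra.
  by rewrite (le_trans (HY g t _ _ _)) ?ler_wpM2l //; clear -gI tI d1 d2 tg'; lra.
have hX := lip (X n i) (fun s t => XL n i s t iI).
have hZ := lip (Z i) (fun s t => ZL i s t iI).
have -> : X n i t - Z i t = (X n i t - X n i g) - (Z i t - Z i g) + (X n i g - Z i g) by ring.
rewrite (le_trans (ler_normD _ _)) //.
have := ler_normB (X n i t - X n i g) (Z i t - Z i g); rewrite /Z in hZ *; lra.
Qed.

Lemma subsequence (I : nat) (X : nat -> nat -> R -> R) (Z : nat -> R -> R) (N1 : nat) :
  (forall (eps : R) n0, 0 < eps -> exists2 n, (n0 <= n)%N &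
      forall i (t : R), (i <= I)%N -> -1 <= t <= 1 -> `|X n i t - Z i t| <= eps) ->
  exists Nj : nat -> nat, [/\ forall j, (N1 <= Nj j)%N, {homo Nj : i j / (i < j)%N} &
    forall j i (t : R), (i <= I)%N -> -1 <= t <= 1 -> `|X (Nj j) i t - Z i t| <= j.+1%:R^-1].
Proof.
move=> H.
pose C (p : nat * nat) n := (p.2 <= n)%N /\
  forall i (t : R), (i <= I)%N -> -1 <= t <= 1 -> `|X n i t - Z i t| <= p.1.+1%:R^-1.
have [|g Hg] := @choice _ _ C.
  move=> [j n0].
  have [|n nn Hn] := H (j.+1%:R^-1) n0; first by rewrite invr_gt0 ltr0n.
  by exists n.
pose Nj := fix f j := if j is k.+1 then g (j, (f k).+1) else g (0%N, N1).
have inc j : (Nj j < Nj j.+1)%N by have [] := Hg (j.+1, (Nj j).+1).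
have mono : {homo Nj : i j / (i < j)%N} by apply: homo_ltn inc => a b c; exact: ltn_trans.
exists Nj; split => //.
- elim=> [|j IH]; first by have [] := Hg (0%N, N1).
  exact: leq_trans IH (ltnW (inc j)).
- case=> [|j] i t iI tI; first by have [_] := Hg (0%N, N1); apply.
  by have [_] := Hg (j.+1, (Nj j).+1); apply.
Qed.

End Compactness.

(** * A priori bounds and limits of discrete trajectories *)

Section Limit.
Variables (R : realType) (q Ne Nh : nat) (P : problemB R q Ne Nh).
Implicit Types (Q : {poly R}) (Z : nat -> R -> R).

Lemma itv_norm_le (l x h : R) : l <= x <= h -> `|x| <= `|l| + `|h|.
Proof.
move=> /andP[lx xh]; rewrite ler_norml.
have h1 := ler_norm h; have h2 := ler_norm (- l); rewrite normrN in h2.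
have h3 := normr_ge0 l; have h4 := normr_ge0 h.
by apply/andP; split; lra.
Qed.

Lemma le_term_sum n (F : nat -> R) i : (forall j, 0 <= F j) -> (i < n)%N ->
  F i <= \sum_(j < n) F j.
Proof.
move=> F0 iN; rewrite (bigD1 (Ordinal iN)) //= lerDl sumr_ge0 //.
Qed.

(** As |L_n| <= 1, the bound on the spectral coefficients bounds the derivative of
    order q + m1.  The box and the bounds on derivatives control the initial
    values of all the lower orders, and each integration from -1 multiplies the
    bound by at most 3. *)
Lemma feasible_bounded m1 beta (b : bounds R q) : exists M, forall N Q, (0 < N)%N ->
  feasible_poly P m1 beta b N Q ->
  forall i (t : R), (i <= q + m1)%N -> -1 <= t <= 1 -> `|traj Q i t| <= M.
Proof.
pose bx i := `|(box_lo b).1 (inord i) 0| + `|(box_hi b).1 (inord i) 0|.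
pose dr j := `|der_lo b j| + `|der_hi b j|.
pose B := coef_hi b + \sum_(i < q.+1) bx i + \sum_(j < m1) dr j.
exists (3 ^+ (q + m1) * B) => N Q N0 [sQ _ hb hd hs].
have bx0 i : 0 <= bx i by rewrite addr_ge0.
have dr0 i : 0 <= dr i by rewrite addr_ge0.
have d0 : 0 <= coef_hi b by apply: le_trans hs; rewrite sumr_ge0.
have s1 : 0 <= \sum_(i < q.+1) bx i by rewrite sumr_ge0.
have s2 : 0 <= \sum_(i < m1) dr i by rewrite sumr_ge0.
have B0 : 0 <= B by rewrite !addr_ge0.
have init i : (i < q + m1)%N -> `|traj Q i (-1)| <= B.
  move=> im; have [iq|qi] := leqP i q.
    have [h _] := hb ord0; have := h (inord i).
    rewrite inordK // node0 // => /itv_norm_le h1; rewrite (le_trans h1) //.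
    by have := le_term_sum bx0 (iq : (i < q.+1)%N); rewrite /bx /B; lra.
  have jm : (0 < i - q < m1)%N by lia.
  have := hd _ jm; rewrite subnKC 1?ltnW // => /itv_norm_le h1; rewrite (le_trans h1) //.
  have /andP[_ jm1] := jm.
  by have := le_term_sum dr0 jm1; rewrite /dr /B; lra.
have top (t : R) : -1 <= t <= 1 -> `|traj Q (q + m1) t| <= B.
  move=> tI; have sp : (size (derivn (q + m1) Q) <= N.+2 - (q.+1 + m1))%N.
    by rewrite size_derivn; lia.
  rewrite /traj [in X in `|X.[_]|](legendre_expansion sp) horner_sum.
  have hB : coef_hi b <= B by rewrite /B -addrA lerDl addr_ge0.
  apply: le_trans hB; apply: le_trans hs.
  rewrite (le_trans (ler_norm_sum _ _ _)) //; apply: ler_sum => n _.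
  by rewrite hornerZ normrM ler_piMr // legendre_le1.
have desc l (t : R) : (l <= q + m1)%N -> -1 <= t <= 1 ->
    `|traj Q (q + m1 - l) t| <= 3 ^+ l * B.
  elim: l t => [|l IH] t lm tI; first by rewrite subn0 expr0 mul1r top.
  have e : (q + m1 - l = (q + m1 - l.+1).+1)%N by lia.
  have := init (q + m1 - l.+1)%N _; have -> : (q + m1 - l.+1 < q + m1)%N by lia.
  move=> /(_ isT) h1.
  have := traj_primitive Q (q + m1 - l.+1); rewrite -e => pr.
  have := primitive_lip pr (fun r rI => IH r (ltnW lm) rI) (lexx _) (_ : -1 <= t) (_ : t <= 1).
  have [t1 t2] : -1 <= t /\ t <= 1 by lra.
  move=> /(_ t1 t2) h2.
  have B3 : B <= 3 ^+ l * B by rewrite ler_peMl // exprn_ege1 // ler1n.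
  have h3 : 3 ^+ l * B * (t - -1) <= 3 ^+ l * B * 2 by rewrite ler_wpM2l ?(le_trans B0 B3) //; lra.
  have -> : traj Q (q + m1 - l.+1) t = traj Q (q + m1 - l.+1) (-1) + (traj Q (q + m1 - l.+1) t - traj Q (q + m1 - l.+1) (-1)) by ring.
  rewrite (le_trans (ler_normD _ _)) // exprS; lra.
move=> i t im tI; have := desc (q + m1 - i)%N t (leq_subr _ _) tI; rewrite subKn // => h.
by rewrite (le_trans h) // ler_wpM2r // ler_weXn2l ?ler1n // leq_subr.
Qed.

Lemma tolerance_small (beta eps : R) : 0 < beta -> 0 < eps ->
  exists N0, forall N, (N0 <= N)%N -> tolerance q N beta <= eps.
Proof.
move=> b0 e0; pose x0 := (eps^-1) `^ (beta^-1).
have x00 : 0 < x0 by rewrite powR_gt0 // invr_gt0.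
exists (Num.bound x0 + q.+2)%N => N NN.
have h : x0 <= N%:R - q.+1%:R - 1.
  have h1 := archi_boundP (ltW x00).
  have : (Num.bound x0 + q.+2)%:R <= N%:R :> R by rewrite ler_nat.
  by rewrite natrD -[q.+2%:R](natr1 q.+1); lra.
rewrite /tolerance powRN invf_ple ?posrE ?powR_gt0 //; last exact: lt_le_trans h.
have -> : eps^-1 = x0 `^ beta.
  by rewrite /x0 -powRrM mulVf ?gt_eqF // powRr1 // invr_ge0 ltW.
by apply: ge0_ler_powR => //; rewrite ?nnegrE ltW // (lt_le_trans _ h).
Qed.

Lemma chain_feasible Z : conts q Z ->
  (forall i, (i <= q)%N -> primitive (Z i) (Z i.+1)) ->
  cone P (state q Z (-1), state q Z 1) = 0 ->
  (forall t : R, -1 <= t <= 1 -> forall i, conh P (state q Z t, ctrl P Z t) i 0 <= 0) ->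
  feasibleB P (state q Z) (ctrl P Z).
Proof.
move=> cZ HZ hc hh.
have W (i : nat) (x y : R -> R) : (i <= q)%N -> (forall t, x t = Z i t) -> (forall t, y t = Z i.+1 t) ->
    weak_derivn 1 x y.
  move=> iq /funext -> /funext ->.
  apply: (@chain_weak_derivn R (fun k => Z (i + k)%N)).
  - by apply: cZ; exact: leqW.
  - by apply/cont_integ/cZ.
  - by case=> // _; rewrite addn0 addn1; exact: HZ.
  - by move=> t _; rewrite addn0.
  - by move=> t _; rewrite addn1.
split => //.
- by split; [exact: cont_state | exact/cont_integ/cont_ctrl].
- move=> i j ij; apply: (W i); first by rewrite -ltnS.
    by move=> t; rewrite mxE.
  by move=> t; rewrite mxE ij.
- apply: (W q) => // t; first by rewrite mxE.
  by rewrite /ctrl mulrC divfK ?dyng_neq0 //; ring.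
- by apply: aeW => t; rewrite in_itv /= => tI; exact: hh.
Qed.

(** Uniform limits commute with the integral. *)
Lemma primitive_limit (F f : R -> R) : cont f ->
  (forall eps : R, 0 < eps -> exists G g, [/\ cont g, primitive G g &
    forall t : R, -1 <= t <= 1 -> `|G t - F t| <= eps /\ `|g t - f t| <= eps]) ->
  primitive F f.
Proof.
move=> cf H; split=> [|t tI]; first exact: cont_integ.
apply/eqP; rewrite -subr_eq0 -normr_le0; apply/ler_addgt0Pr => e e0; rewrite add0r.
have e4 : 0 < e / 4 by rewrite divr_gt0.
have [G [g [cg Gg HG]]] := H _ e4.
have [h1 _] := HG t tI; have [|h2 _] := HG (-1); first by lra.
have pd := primitive_intg 0 (integB (cont_integ cg) (cont_integ cf)).
have h3 := primitive_lip pd (fun r rI => (HG r rI).2) (lexx _).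
have /andP[t1 t2] := tI; have {h3} := h3 _ t1 t2.
rewrite intg_xx !add0r subr0 intgB //; try exact: cont_integ.
have [_ Gt] := Gg; have := Gt t tI => {}Gt.
have h4 : e / 4 * (t - -1) <= e / 4 * 2 by rewrite ler_pM2l //; lra.
move=> h3; have -> : F t - (F (-1) + intg (-1) t f) =
  (G (-1) - F (-1)) - (G t - F t) + (intg (-1) t g - intg (-1) t f) by rewrite Gt; ring.
rewrite (le_trans (ler_normD _ _)) //.
have := ler_normB (G (-1) - F (-1)) (G t - F t); lra.
Qed.

Lemma lipschitz_cont (F : R -> R) (L : R) : (forall s t : R, -1 <= s -> s <= t -> t <= 1 ->
    `|F t - F s| <= L * (t - s)) -> cont F.
Proof.
move=> H; apply: cont_nbhs => c eps cI eps0.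
have L0 : 0 <= L.
  have h := H (-1) 1; have : 0 <= L * (1 - -1) by apply: le_trans (normr_ge0 _) (h _ _ _); lra.
  lra.
have L1 : 0 < L + 1 by lra.
have de : (L + 1) * (eps / (L + 1)) = eps by rewrite mulrC divfK // gt_eqF.
exists (eps / (L + 1)); first by rewrite divr_gt0.
move=> t tI; rewrite ltr_norml => /andP[h1 h2].
have [tc|ct] := leP t c.
  rewrite distrC (le_trans (H t c _ _ _)) //; [lra|lra|].
  rewrite -[leRHS]de; apply: ler_pM; lra.
rewrite (le_trans (H c t _ _ _)) //; [lra|lra|lra|].
rewrite -[leRHS]de; apply: ler_pM; lra.
Qed.

(** The tolerances tend to 0.  As the constraint h <= 0 is only controlled at the
    nodes, it is the integral of the positive part of h that is shown to vanish,
    as a limit of quadratures. *)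
Lemma limit_feasible m1 beta (b : bounds R q) Z (Nj : nat -> nat) (Qj : nat -> {poly R}) :
  0 < beta -> conts q Z -> (forall j, (0 < Nj j)%N) -> {homo Nj : i j / (i < j)%N} ->
  (forall j, feasible_poly P m1 beta b (Nj j) (Qj j)) ->
  (forall j, unifclose q j.+1%:R^-1 (traj (Qj j)) Z) ->
  feasibleB P (state q Z) (ctrl P Z).
Proof.
move=> b0 cZ Nj0 Njm HQ HZ.
have Nge j : (j <= Nj j)%N.
  by elim: j => // j IH; apply: leq_ltn_trans IH (Njm _ _ (ltnSn j)).
have small (eps : R) n0 : 0 < eps -> exists j, (n0 <= j)%N /\ unifclose q eps (traj (Qj j)) Z.
  move=> e0; pose j := (n0 + Num.bound eps^-1)%N; exists j; split; first exact: leq_addr.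
  move=> i t iq tI; rewrite (le_trans (HZ j i t iq tI)) // invf_ple ?posrE // ltW //.
  have ei : 0 <= eps^-1 by rewrite invr_ge0 ltW.
  by rewrite (lt_le_trans (archi_boundP ei)) // ler_nat leqW // leq_addl.
apply: chain_feasible => //.
- move=> i iq; apply: primitive_limit; first exact: cZ.
  move=> eps e0; have [j [_ cj]] := small eps 0%N e0.
  exists (traj (Qj j) i), (traj (Qj j) i.+1); split.
  + exact: traj_cont.
  + exact: traj_primitive.
  + by move=> t tI; split; apply: cj => //; exact: leqW.
- apply/eqP; rewrite -normr_le0; apply/ler_addgt0Pr => e e0; rewrite add0r.
  have [K K0 HK] := close_ends (cone_lip P).
  have [N0 HN] := tolerance_small b0 (divr_gt0 e0 (ltr0n _ 2)).
  have [|j [jN cj]] := small (e / 2 / K) N0; first by rewrite !divr_gt0.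
  have [_ [h1 _] _ _ _] := HQ j.
  have h2 := HK _ _ _ cj; have h3 := HN (Nj j) (leq_trans jN (Nge j)).
  have h4 : K * (e / 2 / K) = e / 2 by rewrite mulrC divfK // gt_eqF.
  rewrite h4 in h2.
  set c1 := cone P (state q (traj _) _, _) in h1 h2; set c2 := cone P _ in h2 *.
  have -> : c2 = c1 - (c1 - c2) by rewrite subKr.
  rewrite (le_trans (ler_normB _ _)) //; lra.
- move=> t tI i.
  pose H := fun a => conh P a i 0; have lH : lipschitz H := lipschitz_coord i (conh_lip P).
  have cH := cont_point (P := P) lH cZ.
  pose f s := Num.max (H (state q Z s, ctrl P Z s)) 0.
  have fE s : f s = (H (state q Z s, ctrl P Z s) + `|H (state q Z s, ctrl P Z s)|) / 2.
    by rewrite /f maxr_absE subr0 addr0.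
  have cf : cont f.
    have h := contM (contD cH (cont_norm cH)) (@cont_cst R 2^-1).
    by apply: eq_cont h => s _; rewrite fE.
  have f0 s : 0 <= f s by rewrite /f le_max lexx orbT.
  suff : f t = 0 by rewrite /f => h; rewrite -[leRHS]h le_max lexx.
  apply: (cont_intg_eq0 cf) => //; apply/eqP; rewrite eq_le; apply/andP; split; last first.
    by apply: intg_ge0.
  apply/ler_addgt0Pr => e e0; rewrite add0r.
  have e4 : 0 < e / 8 by rewrite divr_gt0.
  have [C [del [C0 del0 HC]]] := close_point P lH cZ.
  have [N0 HN] := tolerance_small b0 e4.
  have [N1 HN1] := quadrature_cvg cf e4.
  have dd0 : 0 < Num.min del (e / 8 / C) by rewrite lt_min del0 !divr_gt0.
  have [j [jN cj]] := small _ (maxn N0 N1) dd0.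
  have [_ [_ h1] _ _ _] := HQ j.
  rewrite geq_max in jN; have /andP[jN0 jN1] := jN.
  have h2 := HN (Nj j) (leq_trans jN0 (Nge j)).
  have h3 := HN1 (Nj j) (leq_trans jN1 (Nge j)).
  have hdel : Num.min del (e / 8 / C) <= del by rewrite ge_min lexx.
  have h4 : C * Num.min del (e / 8 / C) <= e / 8.
    by rewrite mulrC -ler_pdivlMr // ge_min lexx orbT.
  have h5 : \sum_(k < (Nj j).+1) f (@node R (Nj j) k) * @weight R (Nj j) k <= e / 4 * 2.
    rewrite -(sum_weight R (Nj0 j)) mulr_sumr; apply: ler_sum => k _.
    rewrite ler_wpM2r ?weight_ge0 // /f ge_max; apply/andP; split; last by lra.
    have := HC _ _ hdel cj (@node R (Nj j) k) (node_itv _ (Nj0 j) k).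
    have := h1 k i; rewrite -/(H _) ler_norml => h6 /andP[h7 _]; lra.
  move: h3; rewrite ler_norml => /andP[h3 _]; lra.
Qed.

End Limit.

(** * Almost everywhere arguments and comparison of rates *)

Section Measurability.
Variable R : realType.
Local Notation mu := (@lebesgue_measure R).

(** G(w, u) is the supremum, over the rationals r, of the measurable functions
    G(w, r) - K |u - r|. *)
Lemma measurable_lipschitz (V : normedModType R) (G : V * R -> R) (w : R -> V) (u : R -> R) :
  lipschitz G -> {within `[-1, 1], continuous w} ->
  measurable_fun (`[-1, 1] : set R) u -> measurable_fun (`[-1, 1] : set R) (fun t => G (w t, u t)).
Proof.
move=> lG cw mu_; have [K K0 HK] := lipschitz_const lG.
have Kd t v v' : `|G (w t, v) - G (w t, v')| <= K * `|v - v'|.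
  by rewrite (le_trans (HK _ _)) // ler_pM2l // prod_normE /= subrr normr0 ge_max lexx normr_ge0.
pose h (r : rat) (t : R) := G (w t, ratr r) - K * `|u t - ratr r|.
have mh r : measurable_fun (`[-1, 1] : set R) (h r).
  apply: measurable_funB.
    apply: integ_meas; apply: cont_integ; apply: (cont_lipschitz lG).
    by apply: cont_pair => //; apply: continuous_subspaceT => x; exact: cst_continuous.
  apply: measurable_funM; first exact: measurable_cst.
  apply: measurableT_comp; first exact: normr_measurable.
  by apply: measurable_funB => //; exact: measurable_cst.
move=> mD; apply: (measurability _ (RGenOInfty.measurableE R)) => //.
move=> /= _ [_ [a ->] <-]; rewrite preimage_itvoy.
rewrite [X in measurable X](_ : _ = \bigcup_(r : rat) (`[-1, 1] `&` [set t | a < h r t])).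
  apply: bigcupT_measurable_rat => r.
  by rewrite -preimage_itvoy; apply: mh => //; exact: measurable_itv.
apply/seteqP; split=> t /= => [[tI at_]|[r _ [tI ar]]]; last first.
  split=> //; have := Kd t (u t) (ratr r); rewrite ler_norml => /andP[h1 _].
  by move: ar; rewrite /h /=; lra.
pose d := (G (w t, u t) - a) / (2 * K).
have d0 : 0 < d by rewrite divr_gt0 ?mulr_gt0 // subr_gt0.
have [r] := @rat_in_itvoo R (u t) (u t + d) ltac:(by rewrite ltrDl).
rewrite in_itv /= => /andP[r1 r2]; exists r => //; split=> //=; rewrite /h.
have e : `|u t - ratr r| < d by rewrite ltr_norml; apply/andP; split; lra.
have := Kd t (u t) (ratr r); rewrite ler_norml => /andP[_ h2].
have : K * `|u t - ratr r| * 2 < G (w t, u t) - a.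
  have : K * `|u t - ratr r| < K * d by rewrite ltr_pM2l.
  have -> : K * d = (G (w t, u t) - a) / 2 by rewrite /d; field; rewrite gt_eqF.
  lra.
lra.
Qed.

Lemma ae_neq (a : R) : {ae mu, forall t, t != a}.
Proof.
exists [set a]; split => //; first exact: lebesgue_measure_set1.
by move=> t /= /negP; rewrite negbK => /eqP.
Qed.

Lemma ae_closed (Q : R -> Prop) : {ae mu, forall t, -1 < t < 1 -> Q t} ->
  {ae mu, forall t, t \in `[-1, 1] -> Q t}.
Proof.
move=> H; have n1 := ae_neq (-1); have n2 := ae_neq 1.
have FF := ae_filter_ringOfSetsType mu.
apply: filterS (filterI H (filterI n1 n2)) => t [h [m1 m2]]; rewrite in_itv /= => /andP[t1 t2]; apply: h.
by rewrite !lt_neqAle t1 t2 m2 eq_sym m1.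
Qed.

Lemma ae_eq_intg (f g : R -> R) : measurable_fun (`[-1, 1] : set R) f -> measurable_fun (`[-1, 1] : set R) g ->
  {ae mu, forall t, t \in `[-1, 1] -> f t = g t} -> intg (-1) 1 f = intg (-1) 1 g.
Proof.
move=> mf mg fg; rewrite /intg /Rintegral; congr fine; apply: ae_eq_integral => //.
- exact/measurable_EFinP.
- exact/measurable_EFinP.
- by have FF := ae_filter_ringOfSetsType mu; apply: filterS fg => t h tI /=; rewrite h // inE.
Qed.

Lemma ae_le0_cont (f : R -> R) : cont f -> {ae mu, forall t, t \in `[-1, 1] -> f t <= 0} ->
  forall t : R, -1 <= t <= 1 -> f t <= 0.
Proof.
move=> cf fae t tI; pose g s := (f s + `|f s|) / 2.
have cg : cont g := contM (contD cf (cont_norm cf)) (@cont_cst R 2^-1).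
have g0 s : 0 <= g s.
  by rewrite /g divr_ge0 //; have := ler_norm (- f s); rewrite normrN; lra.
have := cont_intg_eq0 cg (fun s _ => g0 s) _ tI; rewrite /g => h.
have {}h : (f t + `|f t|) / 2 = 0.
  apply: h; rewrite (@ae_eq_intg _ (fun=> 0)).
  - by rewrite intg_cst ?mul0r //; lra.
  - exact: integ_meas (cont_integ cg).
  - exact: measurable_cst.
  - by have FF := ae_filter_ringOfSetsType mu; apply: filterS fae => s hs sI; rewrite ler0_norm ?hs // subrr mul0r.
have := normr_ge0 (f t); lra.
Qed.

End Measurability.

Section Rate.
Variable R : realType.

(** The number K of spectral coefficients is at least half of the base of the
    tolerance, and k + 1/2 > beta. *)
Lemma rate_tolerance (q k m1 : nat) (beta C : R) : 0 < beta -> beta < k%:R + 1 / 2 -> 0 < C ->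
  exists N0, forall N, (N0 <= N)%N -> (0 < N.+2 - (q.+1 + m1))%N /\
    C / ((N.+2 - (q.+1 + m1))%:R ^+ k * Num.sqrt (N.+2 - (q.+1 + m1))%:R) <= tolerance q N beta.
Proof.
move=> b0 bk C0; pose s : R := k%:R + 2^-1; pose gam := s - beta.
have s0 : 0 <= s by rewrite addr_ge0.
have g0 : 0 < gam by rewrite /gam /s subr_gt0; lra.
pose c2 : R := 2^-1 `^ s; have c20 : 0 < c2 by rewrite powR_gt0.
pose x0 := (C / c2) `^ gam^-1.
have x00 : 0 < x0 by rewrite powR_gt0 // divr_gt0.
exists (Num.bound x0 + q.+2 + (m1 + m1).+2)%N => N NN.
have h : x0 <= N%:R - q.+1%:R - 1.
  have h1 := archi_boundP (ltW x00).
  have : (Num.bound x0 + q.+2)%:R <= N%:R :> R by rewrite ler_nat; lia.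
  by rewrite natrD -[q.+2%:R](natr1 q.+1); lra.
rewrite /tolerance; set M := N%:R - _ - 1 in h *; set K := (N.+2 - _)%N.
have K0 : (0 < K)%N by rewrite /K; lia.
have M0 : 0 < M := lt_le_trans x00 h.
have MK : M / 2 <= K%:R.
  have : (N <= K * 2 + q.+2)%N by rewrite /K; lia.
  by rewrite -(ler_nat R) natrD natrM -[q.+2%:R](natr1 q.+1) /M; lra.
split=> //; have -> : K%:R ^+ k * Num.sqrt K%:R = K%:R `^ s :> R.
  rewrite /s powRD; last by rewrite pnatr_eq0 -lt0n K0 implybT.
  by rewrite powR_mulrn // powR12_sqrt.
have h1 : c2 * M `^ s <= K%:R `^ s.
  rewrite /c2 -powRM ?invr_ge0 // ?(ltW M0) // [_^-1 * _]mulrC.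
  by apply: ge0_ler_powR => //; rewrite nnegrE // divr_ge0 // ltW.
have h2 : C / c2 <= M `^ gam.
  have -> : C / c2 = x0 `^ gam.
    by rewrite /x0 -powRrM mulVf ?gt_eqF // powRr1 // divr_ge0 // ltW.
  by apply: ge0_ler_powR; rewrite ?nnegrE // ltW.
have sE : M `^ s = M `^ gam * M `^ beta.
  have nM : M != 0 by rewrite gt_eqF.
  by rewrite -powRD ?nM ?implybT // /gam subrK.
rewrite powRN ler_pdivrMr ?powR_gt0 ?ltr0n // mulrC ler_pdivlMr ?powR_gt0 //.
apply: le_trans h1; rewrite sE mulrA ler_pM2r ?powR_gt0 //.
by rewrite mulrC -ler_pdivrMr.
Qed.
End Rate.

(** * Discrete trajectories near the given optimal solution *)

Section Regular.
Variables (R : realType) (q Ne Nh : nat) (P : problemB R q Ne Nh).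
Implicit Types (Q : {poly R}) (Z : nat -> R -> R) (x : R -> 'cV[R]_q.+1) (u : R -> R).
Local Notation mu := (@lebesgue_measure R).

Lemma cont_coord n (w : R -> 'cV[R]_n) i : {within `[-1, 1], continuous w} ->
  cont (fun t => w t i 0).
Proof.
apply: (@cont_lipschitz _ _ (fun v : 'cV[R]_n => v i 0)).
apply: (@lipschitz_coord _ _ _ id); apply: (@klipschitzW _ _ _ 1).
  exact: (@globally_properfilter _ _ (0, 0)).
exact: lipschitz_id.
Qed.
Arguments cont_coord {n w} i _.

Definition represents Z x := forall (i : 'I_q.+1) (t : R), -1 <= t <= 1 -> Z i t = x t i 0.

Lemma represents_state Z x (t : R) : represents Z x -> -1 <= t <= 1 -> state q Z t = x t.
Proof. by move=> H tI; apply/matrixP => i j; rewrite mxE ord1 H. Qed.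

(** The first state equations link the components of the state by primitives, and
    the m weak derivatives of x_r continue this chain. *)
Lemma regular_chain m x u y : (0 < m)%N -> feasibleB P x u ->
  weak_derivn m (fun t => x t ord_max 0) y -> integ y ->
  exists Z, [/\ represents Z x, Z (q + m)%N = y &
    forall i, (i < q + m)%N -> primitive (Z i) (Z i.+1)].
Proof.
move=> m0 [[cx iu] wx _ _ _] wy iy.
have cr := cont_coord ord_max cx.
have [X [X0 Xm pX]] := weak_chain m0 cr iy (fun phi => weak_derivn_intg wy (cont_integ cr) iy).
pose Z i := if (i < q)%N then (fun t => x t (inord i) 0) else X (i - q)%N.
have Zx : represents Z x.
  move=> i t tI; rewrite /Z; case: ltnP => [iq|qi]; first by rewrite inord_val.
  have iq : i = ord_max by apply/val_inj => /=; have := ltn_ord i; lia.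
  by rewrite iq subnn X0.
exists Z; split=> // [|i im].
  by rewrite /Z ltnNge leq_addr /= addKn.
have [qi|iq] := leqP q i.
  by rewrite /Z !ltnNge qi (leq_trans qi) //= subSn //; apply: pX; lia.
have i1 : (i < q.+1)%N by exact: leqW.
have w1 := wx (inord i) (inord i.+1) _; rewrite !inordK // in w1; have {}w1 := w1 erefl.
have ci := cont_coord (inord i) cx; have cj := cont_coord (inord i.+1) cx.
have [X' [X'0 X'1 pX']] := weak_chain (ltn0Sn 0) ci (cont_integ cj)
  (fun phi => weak_derivn_intg w1 (cont_integ ci) (cont_integ cj)).
apply: eq_primitive (pX' 0%N isT) => t tI.
  by rewrite X'0 // -(Zx (inord i)) // inordK.
by rewrite X'1 // -(Zx (inord i.+1)) // inordK.
Qed.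

(** The last state equation and the chain give two densities of x_r, which agree
    almost everywhere; g being nonzero, so do the controls. *)
Lemma control_ae Z x u : feasibleB P x u -> represents Z x -> conts q Z ->
  primitive (Z q) (Z q.+1) -> {ae mu, forall t, t \in `[-1, 1] -> u t = ctrl P Z t}.
Proof.
move=> [[cx iu] _ wr _ _] Zx cZ pZ.
pose d t := dynf P (x t) + dyng P (x t) * u t.
have id : integ d.
  apply: integD; first exact/cont_integ/(cont_lipschitz (dynf_lip P)).
  have := integM iu (cont_lipschitz (dyng_lip P) cx).
  by apply: eq_integ => t _; rewrite mulrC.
have cr := cont_coord ord_max cx.
have c1 : cont (Z q.+1) by exact: cZ.
have w2 : weak_derivn 1 (fun t => x t ord_max 0) (Z q.+1).
  apply: (@chain_weak_derivn R (fun k => Z (q + k)%N)) => //.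
  - exact: cont_integ.
  - by case=> // _; rewrite addn0 addn1.
  - by move=> t tI; rewrite addn0 -Zx.
  - by move=> t tI; rewrite addn1.
have id1 : integ (fun t => d t - Z q.+1 t) by apply: integB => //; exact: cont_integ.
have za : {ae mu, forall t, -1 < t < 1 -> d t - Z q.+1 t = 0}.
  apply: ae_zero id1 _ => phi tphi; have cphi := test_cont tphi.
  have e1 := weak_derivn_intg wr (cont_integ cr) id tphi.
  have e2 := weak_derivn_intg w2 (cont_integ cr) (cont_integ c1) tphi.
  under eq_intg do rewrite mulrBl.
  rewrite intgB //; [|exact: integM|apply: integM => //; exact: cont_integ].
  by move: e1; rewrite e2 /d !expr1 !mulN1r => /oppr_inj ->; rewrite subrr.
have FF := ae_filter_ringOfSetsType mu.
apply: filterS (ae_closed za) => t h tI; have /eqP := h tI.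
rewrite subr_eq0 /d /ctrl => /eqP <-.
rewrite in_itv /= in tI; rewrite (represents_state Zx) //.
by rewrite addrC addKr mulrC mulKf ?dyng_neq0.
Qed.

(** The continuous control of the chain has the same cost as u, and by continuity
    it satisfies the constraint everywhere. *)
Lemma feasible_pointwise Z x u : feasibleB P x u -> represents Z x -> conts q Z ->
  {ae mu, forall t, t \in `[-1, 1] -> u t = ctrl P Z t} ->
  [/\ costJ P x u = costZ P Z, cone P (state q Z (-1), state q Z 1) = 0 &
    forall t : R, -1 <= t <= 1 -> forall i, conh P (state q Z t, ctrl P Z t) i 0 <= 0].
Proof.
move=> [[cx iu] _ _ hc hh] Zx cZ uZ; have FF := ae_filter_ringOfSetsType mu.
have N1I : -1 <= (-1 : R) <= 1 by lra.
have P1I : -1 <= (1 : R) <= 1 by lra.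
split.
- rewrite costZE /costJ !(represents_state Zx) //; congr (_ + _).
  apply: ae_eq_intg.
  + by apply: (measurable_lipschitz (costF_lip P) cx); exact: integ_meas.
  + by apply: integ_meas; apply: cont_integ; apply: (cont_point (costF_lip P)).
  + apply: filterS uZ => t ut tI; rewrite ut //.
    by rewrite (represents_state Zx) //; rewrite in_itv /= in tI.
- by rewrite !(represents_state Zx).
- move=> t tI i.
  have cH := cont_point (P := P) (lipschitz_coord i (conh_lip P)) cZ.
  apply: (ae_le0_cont cH) => //; apply: filterS (filterI uZ hh) => s [us hs] sI.
  rewrite -us // (represents_state Zx); first exact: hs.
  by rewrite in_itv /= in sI.
Qed.

(** The approximation error of the derivative of order q + m1 is lifted to the
    whole trajectory.  It is eventually smaller than the tolerance divided by the
    Lipschitz constants of the constraints, which hold exactly along Z; the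
    margin 1 in the bounds absorbs it. *)
Lemma approx_feasible m1 k beta (b : bounds R q) Z (A Bl B d : R) :
  (1 < m1)%N -> 0 < beta -> beta < k%:R + 1 / 2 -> 0 < d ->
  (forall i, (i < q + m1)%N -> primitive (Z i) (Z i.+1)) -> conts q Z ->
  cone P (state q Z (-1), state q Z 1) = 0 ->
  (forall t : R, -1 <= t <= 1 -> forall i, conh P (state q Z t, ctrl P Z t) i 0 <= 0) ->
  (forall K, (0 < K)%N -> exists p : {poly R}, [/\ (size p <= K)%N,
    forall t : R, -1 <= t <= 1 ->
      `|Z (q + m1)%N t - p.[t]| <= A / (K%:R ^+ k * Num.sqrt K%:R) &
    \sum_(n < K) `|lcoef n p| <= Bl]) ->
  (forall i (t : R), (i < q + m1)%N -> -1 <= t <= 1 -> `|Z i t| <= B) ->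
  (forall t : R, -1 <= t <= 1 -> `|ctrl P Z t| <= B) ->
  beyond m1 (Bounds (\col__ - (B + 1), - (B + 1)) (\col__ (B + 1), B + 1)
    (fun=> - (B + 1)) (fun=> B + 1) Bl) b ->
  exists N0, forall N, (N0 <= N)%N -> exists2 Q, feasible_poly P m1 beta b N Q &
    unifclose q d (traj Q) Z.
Proof.
move=> m11 b0 bk d0 pZ cZ hc hh Happ ZB uB [bx bu bd bs].
have N1I : -1 <= (-1 : R) <= 1 by lra.
have [Ke Ke0 HKe] := close_ends (cone_lip P).
have [Ch [dh [Ch0 dh0 HCh]]] := close_point P (conh_lip P) cZ.
have [Cu [du [Cu0 du0 HCu]]] := close_ctrl P cZ.
pose A' := `|A| + 1; have A'0 : 0 < A' by rewrite ltr_wpDl.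
pose c := 2 ^+ (q + m1) * A'; have c0 : 0 < c by rewrite mulr_gt0 // exprn_gt0.
pose S := 1 + Ke + Ch; have S0 : 0 < S by rewrite !addr_gt0.
pose dd := Num.min (Num.min d dh) (Num.min (Num.min 1 du) Cu^-1).
have dd0 : 0 < dd by rewrite !lt_min d0 dh0 du0 ltr01 invr_gt0 Cu0.
have [N1 HN1] := rate_tolerance q m1 b0 bk (mulr_gt0 S0 c0).
have [N2 HN2] := @tolerance_small R q beta dd b0 dd0.
exists (maxn N1 N2).+1 => N; rewrite gtn_max => /andP[NN1 NN2].
have [K0 HK] := HN1 N (ltnW NN1); have tol := HN2 N (ltnW NN2).
have N0 : (0 < N)%N by exact: leq_ltn_trans NN1.
have KN : (N.+2 - (q.+1 + m1) + (q + m1) <= N.+1)%N by clear -K0; lia.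
set K := (N.+2 - _)%N in K0 HK KN; have [p [sp pZe ps]] := Happ K K0.
have [Q [sQ dQ QZ Qi]] := lift_approx pZ pZe.
set r := K%:R ^+ k * _ in HK pZe QZ.
have r0 : 0 < r by rewrite mulr_gt0 ?exprn_gt0 ?sqrtr_gt0 ?ltr0n.
pose err := c / r; have err0 : 0 <= err by rewrite divr_ge0 // ltW.
have errE : S * err <= tolerance q N beta by rewrite /err mulrA.
have [e1 [e2 e3]] : err <= tolerance q N beta /\ Ke * err <= tolerance q N beta /\ Ch * err <= tolerance q N beta.
  have h1 : 0 <= Ke * err by rewrite mulr_ge0 // ltW.
  have h2 : 0 <= Ch * err by rewrite mulr_ge0 // ltW.
  by move: errE; rewrite /S !mulrDl mul1r; clear -h1 h2 err0 => h3; lra.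
have ed : err <= dd := le_trans e1 tol.
have [[ed1 ed2] [[ed3 ed4] ed5]] : (err <= d /\ err <= dh) /\ ((err <= 1 /\ err <= du) /\ err <= Cu^-1).
  by move: ed; rewrite !le_min => /andP[/andP[-> ->] /andP[/andP[-> ->] ->]].
have Qerr i (t : R) : (i <= q + m1)%N -> -1 <= t <= 1 -> `|traj Q i t - Z i t| <= err.
  move=> im tI; rewrite distrC (le_trans (QZ i t im tI)) // /err /c -mulrA ler_pM2l ?exprn_gt0 //.
  by rewrite ler_pM2r ?invr_gt0 // /A' (le_trans (ler_norm _)) // lerDl.
have cl : unifclose q err (traj Q) Z.
  by move=> i t iq tI; apply: Qerr => //; rewrite (leq_trans iq) // -addn1 leq_add2l ltnW.
exists Q; last by move=> i t iq tI; apply: le_trans ed1; exact: cl.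
split.
- by rewrite (leq_trans sQ) // (leq_trans (leq_add sp (leqnn _))).
- split.
    by have := HKe _ _ _ cl; rewrite hc subr0 => h; exact: le_trans h e2.
  move=> j i; have tI : -1 <= @node R N j <= 1 by exact: node_itv.
  have h1 := hh _ tI i; have := HCh _ _ ed2 cl _ tI.
  have Ce0 : 0 <= Ch * err by rewrite mulr_ge0 // ltW.
  move/(cV_norm_leP _ Ce0)/(_ i); rewrite !mxE ler_norml => /andP[_ h2]; clear -h1 h2 e3; lra.
- move=> j; have tI : -1 <= @node R N j <= 1 by exact: node_itv.
  split=> [i|].
    have iq : (i < q + m1)%N by apply: leq_trans (ltn_ord i) _; rewrite -addn1 leq_add2l ltnW.
    have [] := bx i; rewrite /= !mxE => l1 l2.
    have := ZB i _ iq tI; have := Qerr i _ (ltnW iq) tI.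
    rewrite !ler_norml => /andP[h1 h2] /andP[h3 h4]; clear - h1 h2 h3 h4 l1 l2 ed3; apply/andP; split; lra.
  move: bu => /= [l1 l2].
  have h : Cu * err <= 1 by rewrite mulrC -ler_pdivlMr // div1r.
  have := uB _ tI; have := HCu _ _ ed4 cl _ tI.
  rewrite !ler_norml => /andP[h1 h2] /andP[h3 h4]; clear - h h1 h2 h3 h4 l1 l2; apply/andP; split; lra.
- move=> j jm; have [/= l1 l2] := bd j jm.
  have jq : (q + j < q + m1)%N by rewrite ltn_add2l; case/andP: jm.
  have := ZB (q + j)%N (-1) jq; rewrite /traj Qi // ler_norml => H.
  have /andP[h1 h2] := H N1I; clear -h1 h2 l1 l2; apply/andP; split; lra.
- by rewrite dQ (le_trans ps) // ltW.
Qed.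

End Regular.

(** * Convergence of discrete optimal solutions *)

Section Convergence.
Variable R : realType.

Lemma uniform_cvg_seq (V : normedModType R) (F : nat -> R -> V) (f : R -> V) :
  (forall eps : R, 0 < eps -> exists j0, forall j, (j0 <= j)%N ->
     forall t : R, -1 <= t <= 1 -> `|F j t - f t| <= eps) ->
  {uniform `[-1, 1], F @ \oo --> f}.
Proof.
move=> H A /uniform_nbhs[E [entE EA]].
move: entE; rewrite -entourage_from_ballE => -[e /= e0 eE].
have [|j0 Hj] := H (e / 2); first by rewrite divr_gt0.
exists j0 => // j /= jj; apply: EA => t; rewrite /= in_itv /= => tI; apply: eE => /=.
rewrite -ball_normE /= distrC (le_lt_trans (Hj j jj t tI)) //.
by rewrite ltr_pdivrMr // ltr_pMr // ltr1n.
Qed.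

Lemma small_inv (eps : R) : 0 < eps -> exists j0, forall j, (j0 <= j)%N -> j.+1%:R^-1 <= eps.
Proof.
move=> e0; have ei : 0 <= eps^-1 by rewrite invr_ge0 ltW.
exists (Num.bound eps^-1) => j jj; rewrite invf_ple ?posrE //.
by rewrite (le_trans (ltW (archi_boundP ei))) // ler_nat leqW.
Qed.

Lemma bounded_family (Z : nat -> R -> R) n : (forall i, (i < n)%N -> cont (Z i)) ->
  exists2 B : R, 0 < B & forall i (t : R), (i < n)%N -> -1 <= t <= 1 -> `|Z i t| <= B.
Proof.
elim: n => [|n IH] H; first by exists 1.
have [i im|B B0 HB] := IH; first by apply: H; exact: leqW.
have [M M0 HM] := cont_bounded (H n (ltnSn n)).
exists (B + M) => [|i t]; first exact: addr_gt0.
rewrite ltnS leq_eqVlt => /orP[/eqP ->|iN] tI.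
  by rewrite (le_trans (HM t tI)) // lerDr ltW.
by rewrite (le_trans (HB i t iN tI)) // lerDl ltW.
Qed.

Lemma chain_decay (Z : nat -> R -> R) n : (forall i, (i < n)%N -> primitive (Z i) (Z i.+1)) ->
  decay 1 (Z n) -> forall l, (l <= n)%N -> decay l.+1 (Z (n - l)%N).
Proof.
move=> pZ dZ; elim=> [|l IH] ln; first by rewrite subn0.
have pl := pZ (n - l.+1)%N; rewrite subnSK // in pl.
by apply: decay_primitive (pl _) (IH (ltnW ln)); rewrite leq_subr.
Qed.

End Convergence.

Section Sequence.
Variables (R : realType) (q Ne Nh : nat) (P : problemB R q Ne Nh).

(** Because m1 >= 2, derivatives up to order q + 2 are bounded, which makes the
    state and the derivative of its last component equi-Lipschitz. *)
Lemma feasible_subsequence m1 beta (b : bounds R q) (N1 : nat) (Qf : nat -> {poly R}) :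
  (1 < m1)%N -> 0 < beta -> (0 < N1)%N ->
  (forall n, feasible_poly P m1 beta b (N1 + n) (Qf n)) ->
  exists (nj : nat -> nat) (Z : nat -> R -> R),
    [/\ {homo nj : i j / (i < j)%N}, conts q Z,
      feasibleB P (state q Z) (ctrl P Z) &
      forall j, unifclose q j.+1%:R^-1 (traj (Qf (nj j))) Z].
Proof.
move=> m11 b0 N10 HQ; have [M HM] := feasible_bounded P m1 beta b.
pose X n := traj (Qf n).
have XM n i (t : R) : (i <= q + m1)%N -> -1 <= t <= 1 -> `|X n i t| <= M.
  by apply: (HM (N1 + n)%N) => //; rewrite (leq_trans N10) // leq_addr.
have i2 i : (i <= q.+1)%N -> (i < q + m1)%N.
  by move=> iq; apply: (@leq_trans q.+2) => //; rewrite -addn2 leq_add2l.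
have [|n i s t iq s1 st t1|Z [ZL HZ]] := @ascoli R q.+1 X M M.
- by move=> n i t /i2/ltnW; exact: XM.
- by apply: (primitive_lip (traj_primitive (Qf n) i) _ s1 st t1) => r; exact: XM (i2 i iq).
have [nj [_ nm HN]] := subsequence 0 HZ.
have cZ : conts q Z by move=> i iq; apply: lipschitz_cont (fun s t => ZL i s t iq).
exists nj, Z; split=> //.
apply: (@limit_feasible _ _ _ _ P m1 beta b Z (fun j => N1 + nj j)%N (fun j => Qf (nj j))) => //.
- by move=> j; rewrite (leq_trans N10) // leq_addr.
- by move=> i j ij; rewrite ltn_add2l nm.
Qed.

End Sequence.

Section Threshold.
Variables (R : realType) (q Ne Nh : nat) (P : problemB R q Ne Nh).
Local Notation mu := (@lebesgue_measure R).

Lemma varby_chain (Z : nat -> R -> R) n i v : (forall i, (i < n)%N -> primitive (Z i) (Z i.+1)) ->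
  varby (Z n) v -> (i <= n)%N -> exists w, varby (Z i) w.
Proof.
move=> pZ nv; rewrite leq_eqVlt => /orP[/eqP ->|iN]; first by exists v.
by eexists; exact: (primitive_varby (pZ i iN)).
Qed.

(** The margin 1 leaves room for the approximating trajectories. *)
Definition threshold (B d : R) : bounds R q :=
  Bounds (\col__ - (B + 1), - (B + 1)) (\col__ (B + 1), B + 1)
    (fun=> - (B + 1)) (fun=> B + 1) d.

Lemma threshold_encloses m1 n Z x u (B d U : R) v : represents Z x ->
  (forall i, (i < n)%N -> primitive (Z i) (Z i.+1)) ->
  {ae mu, forall t, t \in `[-1, 1] -> u t = ctrl P Z t} ->
  (q + m1 < n)%N -> (0 < m1)%N ->
  (forall i (t : R), (i < q + m1)%N -> -1 <= t <= 1 -> `|Z i t| <= B) ->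
  (forall t : R, -1 <= t <= 1 -> `|ctrl P Z t| <= B) ->
  varby (Z (q + m1).+1) v -> integ (Z (q + m1).+1) ->
  (forall t : R, -1 <= t <= 1 -> `|Z (q + m1).+1 t| <= U) ->
  6 / Num.sqrt pi * (U + fine (total_variation (-1) 1 (Z (q + m1).+1))) * zeta (3 / 2) < d ->
  encloses m1 (threshold B d) x u.
Proof.
move=> Zx pZ uZ mn m10 ZB uB Zv Zi ZU Ud.
have FF := ae_filter_ringOfSetsType mu.
have cq : cont (Z q) by apply: primitive_cont (pZ q _); lia.
have W j : (q + j <= n)%N -> integ (Z (q + j)%N) -> weak_derivn j (fun t => x t ord_max 0) (Z (q + j)%N).
  move=> jn ij; apply: (@chain_weak_derivn R (fun k => Z (q + k)%N)) => //.
  - by apply: eq_cont cq => t tI; rewrite -Zx.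
  - by move=> i ij'; rewrite addnS; apply: pZ; lia.
  - by move=> t tI; rewrite addn0 -Zx.
split.
- move=> t; rewrite in_itv /= => tI i; rewrite !mxE -Zx //.
  have iq : (i < q + m1)%N by have := ltn_ord i; lia.
  have := ZB i t iq tI; rewrite ler_norml => /andP[h1 h2]; clear -h1 h2; apply/andP; split; lra.
- apply: filterS uZ => t ut tI; rewrite ut //=; rewrite in_itv /= in tI.
  have := uB t tI; rewrite ler_norml => /andP[h1 h2]; clear -h1 h2; apply/andP; split; lra.
- move=> j /andP[j0 jm]; exists (Z (q + j)%N).
  have cj : cont (Z (q + j)%N) by apply: primitive_cont (pZ _ _); lia.
  split=> //; first by apply: W; [lia | exact: cont_integ].
  move=> t; rewrite in_itv /= => tI.
  have jq : (q + j < q + m1)%N by rewrite ltn_add2l.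
  have := ZB _ t jq tI; rewrite ler_norml => /andP[h1 h2]; clear -h1 h2; apply/andP; split; lra.
- exists (Z (q + m1).+1), U; split=> //.
  + by have := W m1.+1; rewrite addnS; apply.
  + exact: varby_bv Zv.
Qed.

End Threshold.

Theorem theorem4 (R : realType) (q Ne Nh : nat) (P : problemB R q Ne Nh)
    (x : R -> 'cV[R]_q.+1) (u : R -> R) (m m1 : nat) :
  optimalB P x u ->
  (3 <= m)%N ->
  (exists2 y : R -> R, weak_derivn m (fun t => x t ord_max 0) y &
     bounded_variation (-1) 1 y) ->
  (2 <= m1 <= m - 1)%N ->
  exists2 T : bounds R q, encloses m1 T x u &
  forall (beta : R) (b : bounds R q),
  0 < beta < (m%:R - m1%:R) - 3 / 4 ->
  beyond m1 T b ->
  forall (N1 : nat)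
    (xb : forall N : nat, 'M[R]_(q.+1, N.+1)) (ub : forall N : nat, 'rV[R]_N.+1),
  (q.+1 + 1 < N1)%N ->
  (forall N, (N1 <= N)%N -> optimalBN P m1 beta b (xb N) (ub N)) ->
  exists (Nj : nat -> nat) (xs : R -> 'cV[R]_q.+1) (us : R -> R),
    [/\ (forall j, (N1 <= Nj j)%N) /\ {homo Nj : i j / (i < j)%N},
        optimalB P xs us,
        {uniform `[-1, 1], (fun j => interp_state (xb (Nj j))) @ \oo --> xs} /\
        {uniform `[-1, 1], (fun j => interp_control P (xb (Nj j))) @ \oo --> us},
        costJN P (xb (Nj j)) (ub (Nj j)) @[j --> \oo] --> costJ P xs us &
        costJ P (interp_state (xb (Nj j))) (interp_control P (xb (Nj j)))
          @[j --> \oo] --> costJ P xs us].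
Proof.
move=> [xf xopt] m3 [y wy bvy] /andP[m12 m1m].
have [v yv] := bv_varby bvy.
have iy : integ y by case: wy => _ ly _; exact: varby_locally_integ yv ly.
have m0 : (0 < m)%N by exact: leq_trans m3.
have m1lt : (m1 < m)%N by lia.
have [Z [Zx Zm pZ]] := regular_chain m0 xf wy iy.
have qm1 : (q + m1 < q + m)%N by rewrite ltn_add2l.
have cZi i : (i < q + m)%N -> cont (Z i) by move=> im; exact: primitive_cont (pZ i im).
have cZ : conts q Z.
  by move=> i iq; apply: cZi; apply: leq_ltn_trans iq _; lia.
have uZ : {ae @lebesgue_measure R, forall t, t \in `[-1, 1] -> u t = ctrl P Z t}.
  by apply: (control_ae xf Zx cZ); apply: pZ; rewrite -{1}(addn0 q) ltn_add2l.
have [JE hc hh] := feasible_pointwise xf Zx cZ uZ.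
have [B1 B10 ZB1] := bounded_family (fun i im => cZi i (ltn_trans im qm1)).
have [B2 B20 uB2] := cont_bounded (cont_ctrl (P := P) cZ).
pose B := B1 + B2.
have ZB i (t : R) : (i < q + m1)%N -> -1 <= t <= 1 -> `|Z i t| <= B.
  by move=> im tI; rewrite (le_trans (ZB1 i t im tI)) // lerDl ltW.
have uB (t : R) : -1 <= t <= 1 -> `|ctrl P Z t| <= B.
  by move=> tI; rewrite (le_trans (uB2 t tI)) // lerDr ltW.
(* The highest derivative, of bounded variation, is m - m1 = k + 1 integrations
   away from the derivative of order m1. *)
pose k := (m - m1.+1)%N.
have dY : decay k.+2 (Z (q + m1)%N).
  have dm : decay 1 (Z (q + m)%N) by rewrite Zm; exact: decay_bv yv iy.
  have lm : (m - m1 <= q + m)%N by rewrite (leq_trans (leq_subr _ _)) // leq_addl.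
  have e : (q + m - (m - m1) = q + m1)%N by clear -m1lt; lia.
  by have := chain_decay pZ dm lm; rewrite e /k subnSK.
have [A [Bl Happ]] := legendre_approx (cZi _ qm1) dY.
have [w Zw] : exists w, varby (Z (q + m1).+1) w.
  apply: varby_chain pZ _ qm1; rewrite Zm; exact: yv.
have iw : integ (Z (q + m1).+1).
  by have [] := pZ _ qm1.
pose U := `|Z (q + m1).+1 (-1)| + (w 1 - w (-1)).
pose last := 6 / Num.sqrt pi * (U + fine (total_variation (-1) 1 (Z (q + m1).+1))) * zeta (3 / 2).
(* [Bl] bounds the coefficients of the approximations, [last] is the explicit
   constant that the threshold on d has to exceed. *)
exists (threshold q B (Num.max Bl (last + 1))).
  apply: (threshold_encloses Zx pZ uZ qm1 _ ZB uB Zw iw (varby_bounded Zw)).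
    exact: ltnW m12.
  by rewrite lt_max; apply/orP; right; rewrite ltrDl.
move=> beta b /andP[b0 bk] [bx bu bd bs] N1 xb ub qN1 Hopt.
have {}bk : beta < k%:R + 1 / 2.
  have e : (m = m1 + 1 + k)%N by rewrite /k addn1 subnKC.
  by move: bk; rewrite e !natrD; lra.
have {bs}bB : beyond m1 (threshold q B Bl) b.
  by split=> //; apply: le_lt_trans bs; rewrite /= le_max lexx.
have N10 : (0 < N1)%N by exact: leq_ltn_trans qN1.
have exQ n : exists Q, [/\ feasible_poly P m1 beta b (N1 + n) Q,
    costJN P (xb (N1 + n)%N) (ub (N1 + n)%N) = costN P (N1 + n) (traj Q),
    interp_state (xb (N1 + n)%N) = state q (traj Q) &
    interp_control P (xb (N1 + n)%N) = ctrl P (traj Q)].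
  have [fe _] := Hopt (N1 + n)%N (leq_addr _ _).
  have NN : (0 < N1 + n)%N by rewrite (leq_trans N10) // leq_addr.
  exact: (feasible_is_sample NN (ltnW m12) fe).
have [Qf HQf] := choice exQ.
have fQ n : feasible_poly P m1 beta b (N1 + n) (Qf n) by case: (HQf n).
have [nj [Zs [nm cs fs cl]]] := feasible_subsequence m12 b0 N10 fQ.
have nge j : (j <= nj j)%N.
  by elim: j => // j IH; apply: leq_ltn_trans IH (nm _ _ (ltnSn j)).
have ct j : conts q (traj (Qf (nj j))) by move=> i _; exact: traj_cont.
have clE (d : R) : 0 < d -> exists j0, forall j, (j0 <= j)%N -> unifclose q d (traj (Qf (nj j))) Zs.
  move=> /small_inv[j0 Hj]; exists j0 => j jj i t iq tI.
  by rewrite (le_trans (cl j i t iq tI)) // Hj.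
have cost (eta : R) : 0 < eta -> exists j0, forall j, (j0 <= j)%N ->
    `|costN P (N1 + nj j) (traj (Qf (nj j))) - costZ P Zs| <= eta /\
    `|costZ P (traj (Qf (nj j))) - costZ P Zs| <= eta.
  move=> e0; have [d [N0 [d0 Hd]]] := cost_close P cs e0; have [j0 Hj] := clE d d0.
  exists (maxn j0 N0) => j; rewrite geq_max => /andP[jj jN]; apply: Hd => //; last exact: Hj.
  by rewrite (leq_trans jN) // (leq_trans (nge j)) // leq_addl.
exists (fun j => N1 + nj j)%N, (state q Zs), (ctrl P Zs); split.
- split=> [j|i j ij]; first exact: leq_addr.
  by rewrite ltn_add2l nm.
- split=> // x' u' f'; apply: le_trans (xopt x' u' f'); rewrite JE.
  apply/ler_addgt0Pr => e e0; have e2 : 0 < e / 2 by rewrite divr_gt0.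
  have [j0 Hj] := cost _ e2.
  have [d [N0 [d0 Hd]]] := cost_close P cZ e2.
  have pZ1 i : (i < q + m1)%N -> primitive (Z i) (Z i.+1).
    by move=> im; apply: pZ; exact: ltn_trans qm1.
  (* Up to e, J(xs) <= J^N(optimal) <= J^N(approximation) <= J(x). *)
  have [N2 HN2] := approx_feasible m12 b0 bk d0 pZ1 cZ hc hh Happ ZB uB bB.
  pose j := maxn j0 (maxn N0 N2); pose N := (N1 + nj j)%N.
  have [jj jN0 jN2] : [/\ (j0 <= j)%N, (N0 <= N)%N & (N2 <= N)%N].
    have h : (maxn N0 N2 <= N)%N.
      by rewrite /N (leq_trans _ (leq_addl _ _)) // (leq_trans _ (nge j)) // leq_maxr.
    by split; [exact: leq_maxl | exact: leq_trans (leq_maxl _ _) h | exact: leq_trans (leq_maxr _ _) h].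
  have [Q fQN clQ] := HN2 N jN2.
  have N0' : (0 < N)%N by rewrite (leq_trans N10) // leq_addr.
  have [fS cS] := sample_feasible N0' (ltnW m12) fQN.
  have [_ /(_ _ _ fS)] := Hopt N (leq_addr _ _).
  have [_ cE _ _] := HQf (nj j); rewrite cS cE => le1.
  have [h1 _] := Hj j jj; have cQ : conts q (traj Q) by move=> i _; exact: traj_cont.
  have [h2 _] := Hd _ N jN0 cQ clQ.
  move: h1 h2; rewrite !ler_norml => /andP[h1 _] /andP[_ h2].
  by clear -h1 h2 le1; rewrite -/(costZ P Zs); lra.
- split; apply: uniform_cvg_seq => eps e0.
    have [j0 Hj] := clE eps e0; exists j0 => j jj t tI.
    have [_ _ -> _] := HQf (nj j); exact: close_state (Hj j jj) t tI.
  have [C [d [C0 d0 HC]]] := close_ctrl P cs.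
  have mi : 0 < Num.min d (eps / C) by rewrite lt_min d0 divr_gt0.
  have [j0 Hj] := clE _ mi; exists j0 => j jj t tI.
  have [_ _ _ ->] := HQf (nj j).
  have h : Num.min d (eps / C) <= d by rewrite ge_min lexx.
  apply: le_trans (HC _ _ h (Hj j jj) t tI) _.
  by rewrite mulrC -ler_pdivlMr // ge_min lexx orbT.
- apply/cvgrPdist_le => eps e0; have [j0 Hj] := cost eps e0.
  exists j0 => // j /= jj; rewrite distrC; have [_ -> _ _] := HQf (nj j).
  by have [h _] := Hj j jj.
- apply/cvgrPdist_le => eps e0; have [j0 Hj] := cost eps e0.
  exists j0 => // j /= jj; rewrite distrC; have [_ _ -> ->] := HQf (nj j).
  by have [_ h] := Hj j jj.
Qed.
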